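(* Let $n\ge2$, $1\le k\le n-1$, $\alpha_1,\alpha_2\in\mathbb{R}$ with $\alpha_1+\alpha_2>k-n$, and $1\le p\le\frac{\alpha_1+\alpha_2+n+1}{k+1}$. Let $\beta_1,\beta_2\in\mathbb{R}$ satisfy $\beta_1>k-n$, $\beta_2-\alpha_2\le\alpha_1-\beta_1\le k(p-1)$, and $\beta_1+\beta_2<p(k+1)-(n+1)$. Then there is $C>0$ such that for all $f\in L^p_{\alpha_1,\alpha_2}(\mathbb{H}^n)$ (not necessarily radial), $$\|R_kf\|_{L^p_{\beta_1,\beta_2}(\Xi_k(\mathbb{H}^n))}\le C\|f\|_{L^p_{\alpha_1,\alpha_2}(\mathbb{H}^n)}.$$
   Context: $\mathbb{H}^n$ real hyperbolic space of curvature $-1$ (Poincaré ball model), origin $0$, distance $d$, volume $dx$. $\Xi_k(\mathbb{H}^n)$: $k$-dimensional totally geodesic submanifolds, $d(0,\xi)=\inf_{x\in\xi}d(0,x)$, with measure $\int\varphi\,d\xi=c_{n,k}\int_{SO(n)}\int_0^\infty\varphi(\xi(g,h))\cosh^kh\sinh^{n-k-1}h\,dh\,dg$ where $dg$ is Haar probability measure and $\xi(g,h)$ is the image of $g(\mathbb{R}^k)\cap\mathbb{H}^n$ ($\mathbb{R}^k=\mathrm{span}\{e_1,\dots,e_k\}$) under the hyperbolic translation by distance $h$ along the geodesic through $0$ in direction $ge_{k+1}$. $R_kf(\xi)=\int_\xi f\,d_\xi x$. $\|f\|^p_{L^p_{\alpha_1,\alpha_2}(\mathbb{H}^n)}=\int|f|^p\sinh^{\alpha_1}d(0,x)\cosh^{\alpha_2}d(0,x)dx$;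 $\|\varphi\|^p_{L^p_{\beta_1,\beta_2}(\Xi_k)}=\int|\varphi(\xi)|^p\sinh^{\beta_1}d(0,\xi)\cosh^{\beta_2}d(0,\xi)d\xi$. *)

(* Defs.v *)
From HB Require Import structures.
From mathcomp Require Import all_boot all_order all_algebra.
From mathcomp Require Import all_classical all_reals all_analysis.
Set Implicit Arguments. Unset Strict Implicit. Unset Printing Implicit Defensive.
Import Order.TTheory GRing.Theory Num.Theory.
Local Open Scope classical_set_scope.
Local Open Scope ring_scope.

Section Hyperbolic.
Variable R : realType.

Definition coord (m : nat) (x : m.-tuple R) (i : nat) : R := nth 0 x i.

Definition dotE (m : nat) (x y : m.-tuple R) : R :=
  \sum_(i < m) coord x i * coord y i.
Definition sqnormE (m : nat) (x : m.-tuple R) : R := dotE x x.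
Definition normE (m : nat) (x : m.-tuple R) : R := Num.sqrt (sqnormE x).

Definition tadd (m : nat) (x y : m.-tuple R) : m.-tuple R :=
  [tuple coord x i + coord y i | i < m].
Definition tscale (m : nat) (a : R) (x : m.-tuple R) : m.-tuple R :=
  [tuple a * coord x i | i < m].

(* Iterated Lebesgue integral over R^m (coordinate by coordinate).  Used only
   for nonnegative integrands, for which (Tonelli) it is the integral w.r.t.
   m-dimensional Lebesgue measure. *)
Fixpoint iint (m : nat) : (m.-tuple R -> \bar R) -> \bar R :=
  match m with
  | 0 => fun F => F [tuple]
  | m'.+1 => fun F =>
      (\int[@lebesgue_measure R]_x iint (fun t : m'.-tuple R => F [tuple of x :: t]))%E
  end.

Definition lint (m : nat) (F : m.-tuple R -> \bar R) : \bar R :=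
  (iint (fun t => maxe (F t) 0) - iint (fun t => maxe (- F t) 0))%E.

Definition inball (m : nat) (x : m.-tuple R) : bool := sqnormE x < 1.

(* density of hyperbolic volume dx w.r.t. Lebesgue measure on the ball *)
Definition hdens (m : nat) (x : m.-tuple R) : R := (2 / (1 - sqnormE x)) ^+ m.

(* hyperbolic distance d(0,x) in the ball model *)
Definition hdist0 (m : nat) (x : m.-tuple R) : R :=
  ln ((1 + normE x) / (1 - normE x)).

Definition sinh (t : R) : R := (expR t - expR (- t)) / 2.
Definition cosh (t : R) : R := (expR t + expR (- t)) / 2.

Definition wgt (a1 a2 t : R) : R := sinh t `^ a1 * cosh t `^ a2.

Definition Hnorm_p (n : nat) (a1 a2 p : R) (f : n.-tuple R -> R) : \bar R :=
  iint (fun x : n.-tuple R =>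
    if inball x then ((`|f x| `^ p * wgt a1 a2 (hdist0 x)) * hdens x)%:E
    else 0%E).

Definition mx_of (n : nat) (G : n.-tuple (n.-tuple R)) : 'M[R]_n :=
  \matrix_(i < n, j < n) coord (tnth G i) j.
Definition tup_of (n : nat) (M : 'M[R]_n) : n.-tuple (n.-tuple R) :=
  [tuple [tuple M i j | j < n] | i < n].

Definition SOn (n : nat) : set 'M[R]_n :=
  [set M | M *m M^T = 1%:M /\ \det M = 1].

Definition is_Haar_SO (n : nat)
  (mu : probability (n.-tuple (n.-tuple R)) R) : Prop :=
  mu ((@mx_of n) @^-1` (~` @SOn n)) = 0%E /\
  forall Q : 'M[R]_n, @SOn n Q ->
  forall A : set (n.-tuple (n.-tuple R)), measurable A ->
    mu ((fun G => tup_of (Q *m mx_of G)) @^-1` A) = mu A.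

Definition gcol (n : nat) (G : n.-tuple (n.-tuple R)) (j : nat) : n.-tuple R :=
  [tuple coord (tnth G i) j | i < n].

(* hyperbolic translation of the ball along the geodesic through 0 in the
   direction of the unit vector u, by hyperbolic distance h: the Mobius
   transformation x |-> a (+) x with a = tanh(h/2) u, i.e.
   x |-> ((1 + 2<a,x> + |x|^2) a + (1 - |a|^2) x) / (1 + 2<a,x> + |a|^2 |x|^2) *)
Definition htrans (n : nat) (u : n.-tuple R) (h : R) (x : n.-tuple R)
  : n.-tuple R :=
  let a := tscale ((expR h - 1) / (expR h + 1)) u in
  tscale ((1 + 2 * dotE a x + sqnormE a * sqnormE x)^-1)
    (tadd (tscale (1 + 2 * dotE a x + sqnormE x) a)
          (tscale (1 - sqnormE a) x)).

(* the point of xi(g,h) with coordinates y in the hyperbolic k-ball B^k: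
   xi(g,h) = tau_h (g(R^k) \cap B^n), and y |-> g(y,0) is an isometry of
   H^k onto g(R^k) \cap B^n *)
Definition xipt (n k : nat) (G : n.-tuple (n.-tuple R)) (h : R)
  (y : k.-tuple R) : n.-tuple R :=
  htrans (gcol G k) h
    [tuple \sum_(j < k) coord y j * coord (gcol G j) i | i < n].

Definition dist0xi (n k : nat) (G : n.-tuple (n.-tuple R)) (h : R) : R :=
  inf [set hdist0 (xipt G h y) | y in [set y : k.-tuple R | inball y]].

(* R_k f (xi(g,h)) = \int_{xi(g,h)} f d_xi x, computed in the isometric chart
   y in H^k (the ball B^k with its hyperbolic volume) *)
Definition Rk (n k : nat) (f : n.-tuple R -> R) (G : n.-tuple (n.-tuple R))
  (h : R) : \bar R :=
  lint (fun y : k.-tuple R =>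
    if inball y then (f (xipt G h y) * hdens y)%:E else 0%E).

(* ||phi||^p_{L^p_{b1,b2}(Xi_k)} for phi = R_k f, with the measure
   d xi = c * dg * cosh^k h sinh^(n-k-1) h dh *)
Definition Xinorm_p (n k : nat) (mu : probability (n.-tuple (n.-tuple R)) R)
  (c b1 b2 p : R) (f : n.-tuple R -> R) : \bar R :=
  (c%:E * \int[mu]_G \int[@lebesgue_measure R]_(h in `[0%R, +oo[%classic)
     (poweR `|Rk k f G h| p * (wgt b1 b2 (dist0xi k G h)
        * (cosh h ^+ k * sinh h ^+ (n - k - 1)))%:E))%E.

End Hyperbolic.

(* Main.v *)
(* Let [h = d(0, xi)], [t = sinh h], and let [u] be the sinh of the distance inside [xi] to
   the foot point; then [X = sinh d(0, x)] satisfies [X^2 = t^2 + (1 + t^2) u^2].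
   Hoelder's inequality against the weight
   [N = t^del X^(-(k + del)) (1 + t^2)^(k/2) (1 + u^2)^(1/2)], whose integral over [xi] is
   bounded uniformly in [t], bounds [|R_k f (xi)|^p] by the integral of
   [|f|^p N^(1 - p)] over [xi]. Integrating over [xi], the invariance of the Haar measure
   replaces [|f|^p] by its spherical means, which are functions of [X] only, and everything
   reduces to a one-variable estimate for nonnegative functions of [X]. There the
   substitution [z = sqrt(1 + t^2) u] makes [X^2 = t^2 + z^2], and an elementary comparison
   of exponents leaves the integral of a radial function over the plane against
   [t^(del - 1) z^(k - 1) dt dz]. By dilation invariance this is a multiple of the radial
   integral that defines the norm of [f]. *)
Require Import Defs.
From HB Require Import structures.
From mathcomp Require Import all_boot all_order all_algebra.
From mathcomp Require Import all_classical all_reals all_analysis.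
From mathcomp Require Import measurable_realfun ring lra.
Set Implicit Arguments.
Unset Strict Implicit.
Unset Printing Implicit Defensive.
Import Order.TTheory GRing.Theory Num.Theory.
Import numFieldNormedType.Exports.
Local Open Scope classical_set_scope.
Local Open Scope ring_scope.

(** The Hoelder weight has one free exponent [del]. It must be positive for two reasons: it gives
    [N] its decay along [xi], and it makes [t^(del - 1)] integrable at [t = 0]. It must also be
    small enough for the exponents to compare in every regime of [t <= X], from both near 0 to both
    large. The hypotheses on the parameters leave room for such a [del]. Hoelder's inequality is run
    as Young's inequality with an optimised parameter, so [p = 1] needs no separate argument.
    Integrals over [R^m] are iterated integrals, and there is no surface measure on the sphere.
    Polar coordinates come from a principle instead: a dilation-invariant functional of the radius
    is a multiple of the integral against [dr / r], and one annulus fixes the multiple. The plane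
    integral and the inversion [r -> 1 / r] follow from the same principle. The measurability of
    [R_k f] in [(g, h)] is never established: only the functions that bound it from above have to be
    measurable. *)

Local Notation coord := Defs.coord.

(* [lebesgue_measure] lives on the display of [measurableTypeR]; this copy lives on the
   canonical display of [R], so that products and tuples over [R] can use it. *)
Definition leb_fun (R : realType) : set R -> \bar R := @lebesgue_measure R.

Section leb_measure.
Variable R : realType.

Let leb0 : @leb_fun R set0 = 0%E. Proof. exact: (measure0 (@lebesgue_measure R)). Qed.
Let leb_ge0 (A : set R) : (0 <= leb_fun A)%E.
Proof. exact: (measure_ge0 (@lebesgue_measure R)). Qed.
Let leb_sigma : semi_sigma_additive (@leb_fun R).
Proof.
move=> F mF tF mU.
exact: (@measure_semi_sigma_additive _ _ _ (@lebesgue_measure R) F mF tF mU).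
Qed.

HB.instance Definition _ := @isMeasure.Build _ R R (@leb_fun R) leb0 leb_ge0 leb_sigma.

Let leb_sfinite : sigma_finite [set: R] (@leb_fun R).
Proof.
have [F FT Fb] := sigma_finiteT (@lebesgue_measure R).
by exists F => // i; have [mF ?] := Fb i; split => //; exact: mF.
Qed.

HB.instance Definition _ :=
  @Measure_isSigmaFinite.Build _ R R (@leb_fun R) leb_sfinite.

Lemma leb_subproof : {m : {sigma_finite_measure set R -> \bar R} |
  forall A : set R, m A = @lebesgue_measure R A}.
Proof. by exists [the {sigma_finite_measure set R -> \bar R} of @leb_fun R]. Qed.

Definition leb : {sigma_finite_measure set R -> \bar R} := sval leb_subproof.

Lemma lebE (A : set R) : leb A = @lebesgue_measure R A.
Proof. exact: (svalP leb_subproof). Qed.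

(** The two measures agree on every set but live on different measurable types. The identity is
    measurable between these types, so the integral is transported as along a pushforward. *)
Lemma integral_lebE (f : R -> \bar R) : measurable_fun [set: R] f ->
  (forall x, (0 <= f x)%E) ->
  (\int[@lebesgue_measure R]_x f x = \int[leb]_x f x)%E.
Proof.
move=> mf f0.
have mid : measurable_fun [set: R] (idfun : R -> measurableTypeR R).
  by move=> _ A mA; rewrite setTI; exact: mA.
pose HM := isMeasurableFun.Build _ _ _ _ _ mid.
pose idP : {mfun R >-> measurableTypeR R} := HB.pack (idfun : R -> measurableTypeR R) HM.
transitivity (\int[pushforward leb idP]_x f x)%E.
  by apply: eq_measure_integral => A _ _; exact/esym/lebE.
by rewrite (@ge0_integral_pushforward _ _ _ _ _ _ mid).
Qed.

Lemma leb_itv (a b : R) (x y : bool) : a <= b ->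
  (leb : {measure set R -> \bar R}) [set` Interval (BSide x a) (BSide y b)] = (b - a)%:E.
Proof.
move=> ab; rewrite [LHS]lebE lebesgue_measure_itv/= lte_fin.
case: ltP => [_|ba]; first by rewrite EFinB.
suff -> : a = b by rewrite subrr.
by apply/eqP; rewrite eq_le ab ba.
Qed.

End leb_measure.

(** The integral of a nonnegative function is the supremum over the simple functions below it, so
    the comparison also covers integrands built from [Rk], whose measurability is not
    established. *)
Lemma le_integral_T d (T : measurableType d) (R : realType)
  (m : {measure set T -> \bar R}) (f g : T -> \bar R) :
  (forall x, (0 <= f x)%E) -> (forall x, (f x <= g x)%E) ->
  (\int[m]_x f x <= \int[m]_x g x)%E.
Proof.
move=> f0 fg.
have g0 x : (0 <= g x)%E by exact: le_trans (fg x).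
rewrite !ge0_integralTE//.
apply: le_ereal_sup => _ [h hf <-].
by exists h => // x; exact: le_trans (hf x) (fg x).
Qed.

Lemma integral_mrestr d (T : measurableType d) (R : realType)
  (m : {measure set T -> \bar R}) (D : set T) (mD : measurable D)
  (f : T -> \bar R) : measurable_fun [set: T] f -> (forall x, (0 <= f x)%E) ->
  (\int[mrestr m mD]_x f x = \int[m]_(x in D) f x)%E.
Proof.
move=> mf f0.
rewrite (@ge0_negligible_integral _ _ _ _ setT (~` D))//; last 2 first.
  exact: measurableC.
  by rewrite /= /mrestr setICl measure0.
rewrite setTD setCK; apply: eq_measure_integral => A mA AD /=.
by rewrite /mrestr setIidl.
Qed.

(** * Change of variables on the line by pushforward *)

Section substitution.
Context (R : realType).
Notation leb := (leb R).
Variables (phi w : R -> R).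
Hypothesis mphi : measurable_fun [set: R] phi.
Hypothesis mw : measurable_fun [set: R] w.
Hypothesis w0 : forall x, 0 <= w x.
Hypothesis phiw : forall a b, a < b ->
  (\int[leb]_(x in phi @^-1` `]a, b]) (w x)%:E = (b - a)%:E)%E.

(** The slice of [S] over [x] has length [w x], so the product measure restricted to this region
    under the graph realises the measure [w dx]. *)
Let S := [set x : R * R | (0 < x.2) && (x.2 < w x.1)].

Let mS : measurable S.
Proof.
rewrite -[S]setTI.
have mb : measurable_fun [set: R * R] (fun x : R * R => (0 < x.2) && (x.2 < w x.1)).
  apply: measurable_and; apply: measurable_fun_ltr => //.
  exact: (measurableT_comp mw).
have := mb measurableT [set true] I.
by congr measurable; apply/seteqP; split => x /=.
Qed.

Let Phi (x : R * R) := phi x.1.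

Let mPhi : measurable_fun [set: R * R] Phi.
Proof. exact: measurableT_comp. Qed.

Let HM := isMeasurableFun.Build _ _ _ _ _ mPhi.
Let PhiP : {mfun (R * R)%type >-> R} := HB.pack Phi HM.

Let base : {measure set (R * R) -> \bar R} :=
  mrestr (leb \x leb)%E mS.

Let nu := pushforward base PhiP.

Let nuE (g : R -> \bar R) : measurable_fun [set: R] g -> (forall x, (0 <= g x)%E) ->
  (\int[nu]_x g x = \int[leb]_x (g (phi x) * (w x)%:E))%E.
Proof.
move=> mg g0.
rewrite /nu (@ge0_integral_pushforward _ _ _ _ _ _ mPhi base setT g)//=.
have mgP : measurable_fun [set: R * R] (g \o Phi) by exact: measurableT_comp.
rewrite preimage_setT (@integral_mrestr _ _ _ _ _ mS)//.
rewrite integral_mkcond.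
rewrite fubini_tonelli1//; last 2 first.
- by apply/(measurable_restrictT _ _).1 => //; exact: measurable_funTS.
- by move=> x; rewrite patchE; case: ifPn.
apply: eq_integral => x _; rewrite /fubini_F.
have -> : (fun y => ((g \o Phi) \_ S) (x, y)) =
    (cst (g (phi x))) \_ (`]0, w x[%classic).
  apply/funext => y; rewrite !patchE/=.
  suff -> : ((x, y) \in S) = (y \in `]0, w x[%classic) by [].
  by apply/idP/idP => /set_mem h; apply/mem_set; move: h; rewrite /S /= in_itv.
by rewrite -integral_mkcond integral_cst// leb_itv// subr0.
Qed.

(** By [phiw] the image of [w dx] under [phi] gives every half-open interval its length, and this
    property characterises Lebesgue measure. *)
Lemma ge0_integral_subst (g : R -> \bar R) :
  measurable_fun [set: R] g -> (forall x, (0 <= g x)%E) ->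
  (\int[leb]_x g x = \int[leb]_x (g (phi x) * (w x)%:E))%E.
Proof.
move=> mg g0; rewrite -nuE//.
apply: eq_measure_integral => A mA _.
have mid : measurable_fun [set: R] (idfun : R -> measurableTypeR R).
  by move=> _ B mB; rewrite setTI; exact: mB.
pose HI := isMeasurableFun.Build _ _ _ _ _ mid.
pose idP : {mfun R >-> measurableTypeR R} := HB.pack (idfun : R -> measurableTypeR R) HI.
rewrite [LHS]lebE; apply: (@lebesgue_measure_unique R (pushforward nu idP)) => // _ [[a b] _ <-] /=.
have mI : measurable (`]a, b]%classic : set R) by [].
rewrite [RHS](_ : _ = (\int[nu]_x (\1_(`]a, b]%classic) x)%:E)%E); last first.
  by rewrite integral_indic// setIT.
rewrite nuE//; last by apply/measurable_EFinP; exact: measurable_indic.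
rewrite lebesgue_measure_itv/= lte_fin; case: ltP => ab.
  rewrite -EFinD -phiw// integral_mkcond; apply: eq_integral => x _.
  rewrite patchE indicE/= (_ : (x \in phi @^-1` `]a, b]) = (phi x \in `]a, b]%classic))//.
  by case: ifP => _; rewrite ?mul1e ?mul0e.
rewrite integral0_eq// => x _; rewrite indicE (_ : (_ \in _) = false) ?mul0e//.
apply/negP => /set_mem /=; rewrite in_itv/= => /andP[ax xb].
by have := lt_le_trans ax xb; rewrite ltNge ab.
Qed.

End substitution.

(** * Measurability of elementary functions *)

Section measurability.
Context d (T : measurableType d) (R : realType).
Implicit Types f g : T -> R.

Lemma measurable_fun_powR f (r : R) : measurable_fun [set: T] f ->
  measurable_fun [set: T] (fun x => f x `^ r).
Proof. by move=> mf; apply: (measurableT_comp (@measurable_powR R r)). Qed.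

Lemma measurable_fun_inv f : measurable_fun [set: T] f ->
  measurable_fun [set: T] (fun x => (f x)^-1).
Proof.
move=> mf.
rewrite (_ : (fun x => _) = (fun x => f x * (f x ^+ 2) `^ (-1))).
  apply: measurable_funM => //; apply: measurable_fun_powR.
  exact: measurable_funX.
apply/funext => x; rewrite powR_inv1 ?sqr_ge0//.
have [->|x0] := eqVneq (f x) 0; first by rewrite invr0 mul0r.
by field.
Qed.

Lemma measurable_fun_sqrt f : measurable_fun [set: T] f ->
  measurable_fun [set: T] (fun x => Num.sqrt (f x)).
Proof.
move=> mf; apply: (measurableT_comp _ mf).
by apply: continuous_measurable_fun; exact: sqrt_continuous.
Qed.

Lemma measurable_fun_expR f : measurable_fun [set: T] f ->
  measurable_fun [set: T] (fun x => expR (f x)).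
Proof. by move=> mf; apply: (measurableT_comp (@measurable_expR R)). Qed.

Lemma measurable_fun_lnR f : measurable_fun [set: T] f ->
  measurable_fun [set: T] (fun x => ln (f x)).
Proof. by move=> mf; apply: (measurableT_comp (@measurable_ln R)). Qed.

Lemma measurable_fun_abs f : measurable_fun [set: T] f ->
  measurable_fun [set: T] (fun x => `|f x|).
Proof. by move=> mf; apply: (measurableT_comp (@normr_measurable R setT)). Qed.

Lemma measurable_fun_sinh f : measurable_fun [set: T] f ->
  measurable_fun [set: T] (fun x => sinh (f x)).
Proof.
move=> mf; apply: measurable_funM => //; apply: measurable_funB;
  apply: measurable_fun_expR => //; exact: measurable_funN.
Qed.

Lemma measurable_fun_cosh f : measurable_fun [set: T] f ->
  measurable_fun [set: T] (fun x => cosh (f x)).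
Proof.
move=> mf; apply: measurable_funM => //; apply: measurable_funD;
  apply: measurable_fun_expR => //; exact: measurable_funN.
Qed.

Lemma measurable_fun_EFin f : measurable_fun [set: T] f ->
  measurable_fun [set: T] (fun x => (f x)%:E).
Proof. by move=> mf; apply/measurable_EFinP. Qed.

End measurability.

(* Matching on the function avoids the conversions that [assumption] would attempt. *)
Ltac mfun_hyp := match goal with
  h : measurable_fun _ ?f |- measurable_fun _ ?f => exact: h end.
Ltac mfun_step := lazymatch goal with
  | |- measurable_fun _ (fun _ => ?c) => exact: measurable_cst
  | |- measurable_fun _ (fun x => x) => exact: measurable_id
  | |- measurable_fun _ (fun x => EFin (@?f x)) => apply: measurable_fun_EFin
  | |- measurable_fun _ (fun x => mule (@?f x) (@?g x)) => apply: emeasurable_funM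
  | |- measurable_fun _ (fun x => fst (@?f x)) => apply: (measurableT_comp measurable_fst)
  | |- measurable_fun _ (fun x => snd (@?f x)) => apply: (measurableT_comp measurable_snd)
  | |- measurable_fun _ (fun x => andb (@?f x) (@?g x)) => apply: measurable_and
  | |- measurable_fun _ (fun x => Order.lt (@?f x) (@?g x)) => apply: measurable_fun_ltr
  | |- measurable_fun _ (fun x => Order.le (@?f x) (@?g x)) => apply: measurable_fun_ler
  | |- measurable_fun _ (fun x => powR (@?f x) _) => apply: measurable_fun_powR
  | |- measurable_fun _ (fun x => GRing.inv (@?f x)) => apply: measurable_fun_inv
  | |- measurable_fun _ (fun x => Num.sqrt (@?f x)) => apply: measurable_fun_sqrt
  | |- measurable_fun _ (fun x => expR (@?f x)) => apply: measurable_fun_expR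
  | |- measurable_fun _ (fun x => ln (@?f x)) => apply: measurable_fun_lnR
  | |- measurable_fun _ (fun x => Num.norm (@?f x)) => apply: measurable_fun_abs
  | |- measurable_fun _ (fun x => sinh (@?f x)) => apply: measurable_fun_sinh
  | |- measurable_fun _ (fun x => cosh (@?f x)) => apply: measurable_fun_cosh
  | |- measurable_fun _ (fun x => GRing.exp (@?f x) _) => apply: measurable_funX
  | |- measurable_fun _ (fun x => GRing.mul (@?f x) (@?g x)) => apply: measurable_funM
  | |- measurable_fun _ (fun x => GRing.add (@?f x) (GRing.opp (@?g x))) =>
      apply: measurable_funB
  | |- measurable_fun _ (fun x => GRing.add (@?f x) (@?g x)) => apply: measurable_funD
  | |- measurable_fun _ (fun x => GRing.opp (@?f x)) => apply: measurable_funN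
  | |- measurable_fun _ (fun x => bigop _ _ _) => apply: measurable_sum => ?
  | |- measurable_fun _ (fun x => if _ then _ else _) => apply: measurable_fun_ifT
  | |- measurable_fun _ (fun x => ?F (@?f x)) => apply: (measurableT_comp (f := F)); [mfun_hyp|]
  | |- measurable_fun _ (fun _ => _) => fail
  | |- measurable_fun ?D ?h => change (measurable_fun D (fun x => h x))
  end.
(** Extension point, redefined with [::=] as further operations are shown to be measurable. *)
Ltac mfun_ext := fail.
Ltac mfun := repeat (cbv beta; first [mfun_hyp | mfun_ext | mfun_step]).

(** * Translations, dilations and increasing C1 substitutions *)

Section substitutions.
Context (R : realType).
Notation leb := (leb R).
Implicit Types g : R -> \bar R.

Lemma integral_leb_shift g (a : R) : measurable_fun [set: R] g ->
  (forall x, (0 <= g x)%E) -> (\int[leb]_x g (x + a)%R = \int[leb]_x g x)%E.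
Proof.
move=> mg g0.
rewrite (@ge0_integral_subst R (fun x => x + a) (cst 1) _ _ _ _ g)//.
- by apply: eq_integral => x _; rewrite mule1.
- by mfun.
- move=> u v uv; rewrite (_ : _ @^-1` _ = `]u - a, v - a]%classic).
    rewrite (eq_integral (cst 1%:E))// integral_cst// leb_itv; last lra.
    by rewrite mul1e; congr (_%:E); ring.
  by apply/seteqP; split => x /=; rewrite !in_itv/=; lra.
Qed.

Lemma integral_leb_scale g (a : R) : 0 < a -> measurable_fun [set: R] g ->
  (forall x, (0 <= g x)%E) ->
  (\int[leb]_x g x = a%:E * \int[leb]_x g (a * x)%R)%E.
Proof.
move=> a0 mg g0.
rewrite (@ge0_integral_subst R (fun x => a * x) (cst a) _ _ _ _ g)//.
- rewrite -ge0_integralZl_EFin//; last 2 first.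
  + by mfun.
  + exact: ltW.
  by apply: eq_integral => x _; rewrite muleC.
- by mfun.
- by move=> x; exact: ltW.
- move=> u v uv; rewrite (_ : _ @^-1` _ = `]u / a, v / a]%classic).
    rewrite (eq_integral (cst a%:E))// integral_cst// leb_itv; last by rewrite ler_pM2r ?invr_gt0// ltW.
    by rewrite -EFinM; congr (_%:E); field; rewrite gt_eqF.
  apply/seteqP; split => x /=; rewrite !in_itv/= ltr_pdivrMr// ler_pdivlMr//;
  by rewrite mulrC.
Qed.

(** [D] is the interval where [phi] is the intended increasing map onto the line, with inverse [psi]
    and derivative [w']. The weight [w] extends [w'] by zero, so the values of [phi] outside [D] do
    not count. The preimage of []a, b]] in [D] is []psi a, psi b]], and the fundamental theorem of
    calculus computes its mass. *)
Lemma ge0_integral_substC1 (phi psi w w' : R -> R) (D : set R) :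
  measurable_fun [set: R] phi -> measurable_fun [set: R] w ->
  (forall x, 0 <= w x) ->
  (forall x, D x -> w x = w' x) -> (forall x, ~ D x -> w x = 0) ->
  (forall u, D (psi u) /\ phi (psi u) = u) ->
  (forall x y, D x -> D y -> (phi x < phi y) = (x < y)) ->
  (forall x y z, D x -> D z -> x <= y <= z -> D y) ->
  (forall x, D x -> is_derive x 1 phi (w' x)) ->
  (forall x, D x -> {for x, continuous w'}) ->
  forall g, measurable_fun [set: R] g -> (forall x, (0 <= g x)%E) ->
  (\int[leb]_x g x = \int[leb]_x (g (phi x) * (w x)%:E))%E.
Proof.
move=> mphi mw w0 ww' wD psiK phi_lt convD dphi cw g mg g0.
apply: ge0_integral_subst => // a b ab.
have [Da Ea] := psiK a; have [Db Eb] := psiK b.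
have pab : psi a < psi b by rewrite -phi_lt// Ea Eb.
have Dab x : psi a <= x <= psi b -> D x by exact: convD.
have dab x : x \in `[psi a, psi b] -> D x.
  by rewrite in_itv/= => h; exact: convD h.
have -> : (\int[leb]_(x in phi @^-1` `]a, b]) (w x)%:E =
    \int[leb]_(x in `]psi a, psi b]) (w' x)%:E)%E.
  rewrite integral_mkcond [RHS]integral_mkcond; apply: eq_integral => x _.
  rewrite !patchE.
  have [Dx|Dx] := pselect (D x).
    rewrite ww'//.
    suff -> : (x \in phi @^-1` `]a, b]) = (x \in `]psi a, psi b]%classic) by [].
    have ha : (a < phi x) = (psi a < x) by rewrite -{1}Ea phi_lt.
    have hb : (phi x <= b) = (x <= psi b) by rewrite !leNgt -{1}Eb phi_lt.
    by apply/idP/idP => /set_mem /= h; apply/mem_set; move: h => /=;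
      rewrite !in_itv/= ha hb.
  rewrite wD// if_same; case: ifPn => // /set_mem /= /subset_itv_oc_cc xab.
  by case: Dx; exact: dab.
have mw' : measurable_fun `]psi a, psi b] (fun x => (w' x)%:E).
  apply: (eq_measurable_fun (fun x => (w x)%:E)).
    move=> x /set_mem /= /subset_itv_oc_cc xab.
    by rewrite ww'//; exact: dab.
  by apply: measurable_funTS; mfun.
transitivity (\int[@lebesgue_measure R]_(x in `]psi a, psi b]) (w' x)%:E)%E.
  have pm : measurable_fun [set: R] ((fun x => (w' x)%:E) \_ `]psi a, psi b]).
    by apply/(measurable_restrictT _ _).1.
  rewrite integral_mkcond [RHS]integral_mkcond integral_lebE//.
  move=> x; rewrite patchE; case: ifPn => // /set_mem /= /subset_itv_oc_cc xab.
  by rewrite -ww' ?lee_fin//; exact: dab.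
rewrite integral_itv_obnd_cbnd; last exact: mw'.
rewrite (@continuous_FTC2 _ w' phi)//.
- by rewrite Ea Eb EFinB.
- apply: continuous_in_subspaceT => x /set_mem /= xab.
  by apply: cw; exact: dab.
- have dphi' x : x \in `[psi a, psi b] -> derivable phi x 1.
    by move=> xab; have [] := dphi x (dab _ xab).
  have cphi x : x \in `[psi a, psi b] -> {for x, continuous phi}.
    by move=> xab; apply: differentiable_continuous; exact/derivable1_diffP/dphi'.
  split.
  + by move=> x /subset_itv_oo_cc; exact: dphi'.
  + by apply: cvg_at_right_filter; apply: cphi; rewrite in_itv/= lexx ltW.
  + by apply: cvg_at_left_filter; apply: cphi; rewrite in_itv/= lexx ltW.
- move=> x /subset_itv_oo_cc xab; rewrite derive1E.
  by have [_ ->] := dphi x (dab _ xab).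
Qed.

End substitutions.

(** * Hyperbolic functions and the substitutions by [sinh] and [ballsinh] *)

Section hyperbolic_substitutions.
Context (R : realType).
Notation leb := (leb R).
Implicit Types g : R -> \bar R.

Lemma cosh_gt0 (x : R) : 0 < cosh x.
Proof. by rewrite /cosh divr_gt0// addr_gt0// expR_gt0. Qed.

Lemma cosh2 (x : R) : cosh x ^+ 2 = 1 + sinh x ^+ 2.
Proof. by rewrite /cosh /sinh expRN; field; rewrite gt_eqF ?expR_gt0. Qed.

Lemma sinh_lt (x y : R) : (sinh x < sinh y) = (x < y).
Proof.
have mono a b : a < b -> sinh a < sinh b.
  move=> ab; rewrite /sinh ltr_pM2r// ltrB//; first by rewrite ltr_expR.
  by rewrite ltr_expR ltrN2.
case: (ltgtP x y) => [/mono->//|/mono yx|->]; last exact: ltxx.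
by apply/negbTE; rewrite -leNgt ltW.
Qed.

Lemma sinh0 : sinh (0 : R) = 0.
Proof. by rewrite /sinh oppr0 subrr mul0r. Qed.

Lemma sinh_gt0 (x : R) : (0 < sinh x) = (0 < x).
Proof. by rewrite -sinh0 sinh_lt sinh0. Qed.

Definition asinh (u : R) : R := ln (u + Num.sqrt (u ^+ 2 + 1)).

Lemma asinhK (u : R) : sinh (asinh u) = u.
Proof.
have s0 : 0 <= u ^+ 2 + 1 by rewrite addr_ge0 ?sqr_ge0.
have sq : Num.sqrt (u ^+ 2 + 1) ^+ 2 = u ^+ 2 + 1 by rewrite sqr_sqrtr.
have pos : 0 < u + Num.sqrt (u ^+ 2 + 1).
  have := sqrtr_ge0 (u ^+ 2 + 1); nra.
rewrite /sinh /asinh expRN !lnK//; move: sq pos.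
set s := Num.sqrt _ => sq pos.
have su : s ^+ 2 - u ^+ 2 = 1 by rewrite sq; ring.
rewrite [(u + s)^-1](_ : _ = s - u); first by field.
by apply: (mulfI (lt0r_neq0 pos)); rewrite mulfV ?gt_eqF// -su; ring.
Qed.

Lemma is_derive_sinh (x : R) : is_derive x 1 (@sinh R) (cosh x).
Proof.
rewrite /sinh /cosh; apply: is_derive_eq; rewrite /GRing.scale/=.
by field.
Qed.

Lemma is_derive_cosh (x : R) : is_derive x 1 (@cosh R) (sinh x).
Proof.
rewrite /sinh /cosh; apply: is_derive_eq; rewrite /GRing.scale/=.
by field.
Qed.

Lemma integral_leb_sinh g : measurable_fun [set: R] g ->
  (forall x, (0 <= g x)%E) ->
  (\int[leb]_x g x = \int[leb]_h (g (sinh h) * (cosh h)%:E))%E.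
Proof.
move=> mg g0.
apply: (@ge0_integral_substC1 R (@sinh R) asinh (@cosh R) (@cosh R) setT) => //.
- by mfun.
- by mfun.
- by move=> x; exact/ltW/cosh_gt0.
- by move=> x [].
- by move=> u; split=> //; exact: asinhK.
- by move=> x y _ _; exact: sinh_lt.
- by move=> x _; exact: is_derive_sinh.
- move=> x _; apply: differentiable_continuous; apply/derivable1_diffP.
  by have [] := is_derive_cosh x.
Qed.

(** A point of the ball at hyperbolic distance [d] from the origin has Euclidean norm
    [s = tanh (d / 2)], and then this is [sinh d]. *)
Definition ballsinh (s : R) : R := 2 * s / (1 - s ^+ 2).
Definition ballsinh' (s : R) : R := 2 * (1 + s ^+ 2) / (1 - s ^+ 2) ^+ 2.
(** For [u = sinh d] this is [sinh d / (1 + cosh d) = tanh (d / 2)]. *)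
Definition sinhball (u : R) : R := u / (1 + Num.sqrt (1 + u ^+ 2)).

Let cond s : -1 < s < 1 -> 1 - s ^+ 2 != 0 :> R.
Proof. by move=> h; apply/lt0r_neq0; nra. Qed.

Lemma sinhballK (u : R) : -1 < sinhball u < 1 /\ ballsinh (sinhball u) = u.
Proof.
rewrite /ballsinh /sinhball.
have s0 : 0 <= 1 + u ^+ 2 by rewrite addr_ge0 ?sqr_ge0.
have sq : Num.sqrt (1 + u ^+ 2) ^+ 2 = 1 + u ^+ 2 by rewrite sqr_sqrtr.
have := sqrtr_ge0 (1 + u ^+ 2); move: sq.
set r := Num.sqrt _ => sq r0.
have r1 : 0 < 1 + r by lra.
split; first by rewrite ltr_pdivlMr// ltr_pdivrMr//; nra.
have -> : (u / (1 + r)) ^+ 2 = (r - 1) / (1 + r).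
  by rewrite expr_div_n (_ : u ^+ 2 = (r - 1) * (1 + r));
    [field; rewrite gt_eqF|move: sq; nra].
by field; rewrite gt_eqF//= (_ : 1 + r - (r - 1) = 2)//; ring.
Qed.

Lemma ballsinh_lt (x y : R) : -1 < x < 1 -> -1 < y < 1 ->
  (ballsinh x < ballsinh y) = (x < y).
Proof.
have mono a b : -1 < a < 1 -> -1 < b < 1 -> a < b -> ballsinh a < ballsinh b.
  move=> ha hb ab; rewrite /ballsinh -subr_gt0.
  have -> : 2 * b / (1 - b ^+ 2) - 2 * a / (1 - a ^+ 2) =
    2 * (b - a) * (1 + a * b) / ((1 - b ^+ 2) * (1 - a ^+ 2)).
    by field; rewrite !cond.
  by apply: divr_gt0; apply: mulr_gt0; nra.
move=> hx hy.
case: (ltgtP x y) => [/mono->//|/mono yx|->]; last exact: ltxx.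
by apply/negbTE; rewrite -leNgt ltW// yx.
Qed.

Lemma is_derive_ballsinh (s : R) : -1 < s < 1 ->
  is_derive s 1 ballsinh (ballsinh' s).
Proof.
move=> /cond s0.
have dV : is_derive s 1 (fun x : R => (1 - x ^+ 2)^-1)
    (- (1 - s ^+ 2) ^- 2 *: (- (2 * s))).
  apply: is_deriveV => //.
  by apply: is_derive_eq; rewrite /GRing.scale/=; ring.
rewrite /ballsinh /ballsinh'.
apply: is_derive_eq; rewrite /GRing.scale/=.
by field.
Qed.

Lemma continuous_ballsinh' (s : R) : -1 < s < 1 -> {for s, continuous ballsinh'}.
Proof.
move=> /cond s0; apply: differentiable_continuous; apply/derivable1_diffP.
have c2 : (1 - s ^+ 2) ^+ 2 != 0 by rewrite expf_eq0.
have [dV _] : is_derive s 1 (fun x : R => ((1 - x ^+ 2) ^+ 2)^-1)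
    (- ((1 - s ^+ 2) ^+ 2) ^- 2 *: (2 * (1 - s ^+ 2) * (- (2 * s)))).
  apply: is_deriveV => //.
  by apply: is_derive_eq; rewrite /GRing.scale/=; ring.
by rewrite /ballsinh'; apply: derivableM.
Qed.

Lemma integral_leb_ballsinh g : measurable_fun [set: R] g ->
  (forall x, (0 <= g x)%E) ->
  (\int[leb]_x g x = \int[leb]_s (g (ballsinh s) *
     (if (-1 < s) && (s < 1) then ballsinh' s else 0)%:E))%E.
Proof.
move=> mg g0.
apply: (@ge0_integral_substC1 R ballsinh sinhball
  (fun s => if (-1 < s) && (s < 1) then ballsinh' s else 0) ballsinh'
  [set s | (-1 < s) && (s < 1)]) => //.
- by rewrite /ballsinh; mfun.
- by rewrite /ballsinh'; mfun.
- by move=> x; case: ifP => // h; rewrite /ballsinh' divr_ge0 ?sqr_ge0//; nra.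
- by move=> x /= ->.
- by move=> x /= /negP /negbTE ->.
- by move=> u; have [] := sinhballK u.
- by move=> x y /= hx hy; exact: ballsinh_lt.
- by move=> x y z /=; lra.
- by move=> x /= hx; exact: is_derive_ballsinh.
- by move=> x /= hx; exact: continuous_ballsinh'.
Qed.

End hyperbolic_substitutions.

Section tonelli.
Context d1 d2 (T1 : measurableType d1) (T2 : measurableType d2) (R : realType).
Variables (m1 : {sigma_finite_measure set T1 -> \bar R})
          (m2 : {sigma_finite_measure set T2 -> \bar R}).
Variable f : T1 -> T2 -> \bar R.
Hypothesis mf : measurable_fun [set: T1 * T2] (fun p => f p.1 p.2).
Hypothesis f0 : forall x y, (0 <= f x y)%E.

Let fp (p : T1 * T2) := f p.1 p.2.
Let fp0 p : (0 <= fp p)%E. Proof. exact: f0. Qed.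

Lemma tonelli : (\int[m1]_x \int[m2]_y f x y = \int[m2]_y \int[m1]_x f x y)%E.
Proof. exact: (@fubini_tonelli _ _ _ _ _ m1 m2 fp mf fp0). Qed.

Lemma measurable_integral2 : measurable_fun [set: T1] (fun x => \int[m2]_y f x y)%E.
Proof. exact: (@measurable_fun_fubini_tonelli_F _ _ _ _ _ m2 fp mf fp0). Qed.

Lemma measurable_integral1 : measurable_fun [set: T2] (fun y => \int[m1]_x f x y)%E.
Proof. exact: (@measurable_fun_fubini_tonelli_G _ _ _ _ _ m1 fp mf fp0). Qed.

End tonelli.

Section positive_power.
Context (R : realType).
Implicit Types a b c x : R.

(* [powR] is 1 at negative bases; cutting it off there makes [pw a x * pw b x = pw (a + b) x]
   and the integrals over the half line hold without side conditions. *)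
Definition pw a x : R := if 0 < x then x `^ a else 0.

Lemma pw_ge0 a x : 0 <= pw a x.
Proof. by rewrite /pw; case: ifP => // _; exact: powR_ge0. Qed.

Lemma pwE a x : 0 < x -> pw a x = x `^ a.
Proof. by rewrite /pw => ->. Qed.

Lemma pw_neq0 a x : pw a x != 0 -> 0 < x.
Proof. by rewrite /pw; case: ifP => // _; rewrite eqxx. Qed.

Lemma pwD a b x : pw a x * pw b x = pw (a + b) x.
Proof.
rewrite /pw; case: ifP => [x0|_]; last by rewrite mul0r.
by rewrite powRD//; apply/implyP => _; exact: lt0r_neq0.
Qed.

Lemma pwM a c x : 0 < c -> pw a (c * x) = c `^ a * pw a x.
Proof.
move=> c0; rewrite /pw pmulr_rgt0//; case: ifP => [x0|_]; last by rewrite mulr0.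
by rewrite powRM// ltW.
Qed.

Lemma measurable_fun_pw d (T : measurableType d) a (f : T -> R) :
  measurable_fun [set: T] f -> measurable_fun [set: T] (fun t => pw a (f t)).
Proof. by move=> mf; rewrite /pw; mfun. Qed.

End positive_power.

Ltac mfun_pw := lazymatch goal with
  | |- measurable_fun _ (fun x => pw _ (@?f x)) => apply: measurable_fun_pw
  end.
Ltac mfun_ext ::= mfun_pw.

(** * Dilation-invariant functionals of a radius *)

Section dilation.
Context (R : realType).

(** Only functions of the radius [N] are tested: the image of [w dm] under [N] is invariant under
    multiplication by positive numbers, whatever the underlying space. Positivity of [N] where [w]
    lives allows dilating by the radius of a point. *)
Record dilation_invariant d (T : measurableType d)
  (m : {measure set T -> \bar R}) (w N : T -> R) : Prop := DilationInvariant {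
  dilation_w : measurable_fun [set: T] w;
  dilation_N : measurable_fun [set: T] N;
  dilation_w0 : forall x, 0 <= w x;
  dilation_N0 : forall x, w x != 0 -> 0 < N x;
  dilationE : forall (c : R) (F : R -> \bar R), 0 < c -> measurable_fun [set: R] F ->
    (forall r, (0 <= F r)%E) ->
    (\int[m]_x ((w x)%:E * F (c * N x)%R) = \int[m]_x ((w x)%:E * F (N x)))%E
}.

Context d1 d2 (T1 : measurableType d1) (T2 : measurableType d2).
Variables (m1 : {sigma_finite_measure set T1 -> \bar R})
          (m2 : {sigma_finite_measure set T2 -> \bar R}).
Variables (w1 N1 : T1 -> R) (w2 N2 : T2 -> R).
Hypothesis i1 : dilation_invariant m1 w1 N1.
Hypothesis i2 : dilation_invariant m2 w2 N2.

(* Two dilation-invariant functionals of a radial function are proportional: the usual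
   Fubini proof of the uniqueness of Haar measure, here on the multiplicative half line. *)
Lemma dilation_proportional (F G : R -> \bar R) :
  measurable_fun [set: R] F -> (forall r, (0 <= F r)%E) ->
  measurable_fun [set: R] G -> (forall r, (0 <= G r)%E) ->
  ((\int[m1]_x ((w1 x)%:E * F (N1 x))) * (\int[m2]_z ((w2 z)%:E * G (N2 z))) =
   (\int[m2]_z ((w2 z)%:E * F (N2 z))) * (\int[m1]_x ((w1 x)%:E * G (N1 x)^-1%R)))%E.
Proof.
move=> mF F0 mG G0.
have [mw1 mN1 w10 N10 D1] := i1; have [mw2 mN2 w20 N20 D2] := i2.
have W1 x : (0 <= (w1 x)%:E)%E by rewrite lee_fin.
have W2 x : (0 <= (w2 x)%:E)%E by rewrite lee_fin.
rewrite -ge0_integralZl//; last 3 first.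
- by mfun.
- by move=> z _; rewrite mule_ge0.
- by apply: integral_ge0 => x _; rewrite mule_ge0.
(* Three dilations, with the parameters [N2 z], [N1 x] and [(N2 z)^-1], separated by exchanges of
   the integrals, move [F] from one radius to the other. Where a weight vanishes the radius may fail
   to be positive, hence the case splits. *)
transitivity (\int[m2]_z \int[m1]_x
  (((w1 x)%:E * (w2 z)%:E) * (G (N2 z) * F (N2 z * N1 x)%R)))%E.
  apply: eq_integral => z _.
  have [wz|wz] := eqVneq (w2 z) 0.
    rewrite wz mul0e mule0; apply/esym/integral0_eq => x _.
    by rewrite mule0 mul0e.
  rewrite -(D1 (N2 z))//; last exact: N20.
  rewrite muleC -ge0_integralZl//.
  - by apply: eq_integral => x _; rewrite muleACA [(_%:E * _%:E)%E]muleC.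
  - by mfun.
  - by move=> x _; rewrite mule_ge0.
  - by rewrite mule_ge0.
rewrite tonelli; last 2 first.
- by mfun.
- by move=> z x; rewrite !mule_ge0.
transitivity (\int[m1]_x \int[m2]_z
  (((w1 x)%:E * (w2 z)%:E) * (G (N2 z / N1 x)%R * F (N2 z))))%E.
  apply: eq_integral => x _.
  have [wx|wx] := eqVneq (w1 x) 0.
    by rewrite !integral0_eq// => z _; rewrite wx !mul0e.
  transitivity ((w1 x)%:E * \int[m2]_z ((w2 z)%:E * (G (N1 x * N2 z / N1 x)%R * F (N1 x * N2 z)%R)))%E.
    rewrite -ge0_integralZl//; last 2 first.
    - by mfun.
    - by move=> z _; rewrite !mule_ge0.
    apply: eq_integral => z _; rewrite -!muleA [(N1 x * N2 z)%R]mulrC mulfK//.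
    by rewrite gt_eqF// N10.
  rewrite (D2 (N1 x) (fun r => G (r / N1 x)%R * F r)%E)//.
  - rewrite -ge0_integralZl//; last 2 first.
    + by mfun.
    + by move=> z _; rewrite !mule_ge0.
    by apply: eq_integral => z _; rewrite -!muleA.
  - exact: N10.
  - by mfun.
  - by move=> r; rewrite mule_ge0.
rewrite tonelli; last 2 first.
- by mfun.
- by move=> z x; rewrite !mule_ge0.
rewrite muleC -ge0_integralZl//; last 3 first.
- by mfun.
- by move=> z _; rewrite mule_ge0.
- by apply: integral_ge0 => x _; rewrite mule_ge0.
apply: eq_integral => z _.
have [wz|wz] := eqVneq (w2 z) 0.
  rewrite wz mul0e mule0; apply/integral0_eq => x _.
  by rewrite mule0 mul0e.
rewrite -(D1 (N2 z)^-1%R (fun r => G r^-1%R))//; last 2 first.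
- by rewrite invr_gt0 N20.
- by mfun.
rewrite muleC -ge0_integralZl//; last 3 first.
- by mfun.
- by move=> x _; rewrite mule_ge0.
- by rewrite mule_ge0.
apply: eq_integral => x _; rewrite invfM invrK.
rewrite -!muleA muleCA; congr (_ * _)%E; rewrite [RHS]muleCA; congr (_ * _)%E.
exact: muleC.
Qed.

End dilation.

(** * Sigma-finite measures on products and tuples *)

Section sigma_finite_pack.
Context d (T : measurableType d) (R : realType) (m : {measure set T -> \bar R}).
Hypothesis ms : sigma_finite [set: T] m.

Definition sigma_finite_fun of sigma_finite [set: T] m : set T -> \bar R := m.
Local Notation sf := (sigma_finite_fun ms).

Let sf0 : sf set0 = 0%E. Proof. exact: measure0. Qed.
Let sf_ge0 (A : set T) : (0 <= sf A)%E. Proof. exact: measure_ge0. Qed.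
Let sf_sigma : semi_sigma_additive sf.
Proof. exact: measure_semi_sigma_additive. Qed.

HB.instance Definition _ := @isMeasure.Build _ T R sf sf0 sf_ge0 sf_sigma.
HB.instance Definition _ := @Measure_isSigmaFinite.Build _ T R sf ms.

Lemma sigma_finite_pack :
  {nu : {sigma_finite_measure set T -> \bar R} | forall A, nu A = m A}.
Proof. by exists [the {sigma_finite_measure set T -> \bar R} of sf]. Qed.

End sigma_finite_pack.

Section product_sigma_finite.
Context d1 d2 (T1 : measurableType d1) (T2 : measurableType d2) (R : realType).
Variables (m1 : {sigma_finite_measure set T1 -> \bar R})
          (m2 : {sigma_finite_measure set T2 -> \bar R}).

Let pm : {measure set (T1 * T2)%type -> \bar R} := (m1 \x m2)%E.

Let pm_sfinite : sigma_finite [set: T1 * T2] pm.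
Proof.
have /sigma_finiteP[F [FT ndF Foo]] := sigma_finiteT m1.
have /sigma_finiteP[G [GT ndG Goo]] := sigma_finiteT m2.
exists (fun i => F i `*` G i).
  apply/esym; rewrite -subTset => -[x y] _.
  have [i _ Fx] : (\bigcup_i F i) x by rewrite -FT.
  have [j _ Gy] : (\bigcup_i G i) y by rewrite -GT.
  exists (maxn i j) => //; split => /=.
  - by move: Fx; exact/subsetPset/ndF/leq_maxl.
  - by move: Gy; exact/subsetPset/ndG/leq_maxr.
move=> i; have [mF Fi] := Foo i; have [mG Gi] := Goo i.
split; first exact: measurableX.
by rewrite /pm/= product_measure1E// lte_mul_pinfty// ge0_fin_numE.
Qed.

(* The library's sigma-finite instance on products is shadowed by the one for finite
   measures, so it is rebuilt here. *)
Definition prodm : {sigma_finite_measure set (T1 * T2)%type -> \bar R} :=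
  sval (sigma_finite_pack pm_sfinite).

Lemma integral_prodm (f : T1 * T2 -> \bar R) : measurable_fun [set: T1 * T2] f ->
  (forall p, (0 <= f p)%E) ->
  (\int[prodm]_p f p = \int[m1]_x \int[m2]_y f (x, y))%E.
Proof.
move=> mf f0; rewrite -fubini_tonelli1//; apply: eq_measure_integral => A _ _.
exact: (svalP (sigma_finite_pack pm_sfinite)).
Qed.

End product_sigma_finite.

(** The left inverse [g] preserves sigma-finiteness: a cover of [T1] by sets of finite measure is
    pulled back by [g] to such a cover of [T2]. *)
Lemma pushforward_sigma_finite d1 d2 (T1 : measurableType d1) (T2 : measurableType d2)
  (R : realType) (m : {sigma_finite_measure set T1 -> \bar R})
  (f : T1 -> T2) (g : T2 -> T1) : measurable_fun [set: T1] f ->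
  measurable_fun [set: T2] g -> cancel f g ->
  {nu : {sigma_finite_measure set T2 -> \bar R} |
    forall F : T2 -> \bar R, measurable_fun [set: T2] F -> (forall t, (0 <= F t)%E) ->
    (\int[nu]_t F t = \int[m]_x F (f x))%E}.
Proof.
move=> mf mg fK.
pose pf0 : {measure set T2 -> \bar R} := pushforward m f; pose pf := pf0 mf.
have pf_sfinite : sigma_finite [set: T2] pf.
  have [F FT Fb] := sigma_finiteT m.
  exists (fun i => g @^-1` (F i)).
    by rewrite -preimage_bigcup -FT preimage_setT.
  move=> i; have [mF Fi] := Fb i; split.
    by rewrite -[X in measurable X]setTI; exact: mg.
  rewrite /pf /pf0 /= /pushforward (_ : _ @^-1` _ = F i)//.
  by apply/seteqP; split => p /=; rewrite fK.
have [nu nuE] := sigma_finite_pack pf_sfinite.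
exists nu => F mF F0; rewrite (@eq_measure_integral _ _ _ setT pf)//; last by move=> A _ _; exact: nuE.
by rewrite (@ge0_integral_pushforward _ _ _ _ _ _ mf m setT F).
Qed.

Section tuple_measure.
Context (R : realType).

Let tcons m (p : R * m.-tuple R) : m.+1.-tuple R := [tuple of p.1 :: p.2].
Let tuncons m (t : m.+1.-tuple R) : R * m.-tuple R := (thead t, [tuple of behead t]).

Let measurable_tcons m : measurable_fun [set: R * m.-tuple R] (@tcons m).
Proof. exact: measurable_cons. Qed.

Let measurable_tuncons m : measurable_fun [set: m.+1.-tuple R] (@tuncons m).
Proof.
apply/measurable_fun_pairP; split; last exact: measurable_behead.
exact: (@measurable_tnth _ R m.+1 ord0).
Qed.

Let tconsK m : cancel (@tcons m) (@tuncons m).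
Proof.
move=> [x t]; rewrite /tuncons /tcons /=; congr (_, _).
by apply/val_inj.
Qed.

Let tuple_measure_step m (mu : {sigma_finite_measure set (m.-tuple R) -> \bar R}) :
  {nu : {sigma_finite_measure set (m.+1.-tuple R) -> \bar R} |
  forall F : m.+1.-tuple R -> \bar R, measurable_fun [set: m.+1.-tuple R] F ->
  (forall t, (0 <= F t)%E) ->
  (\int[nu]_t F t = \int[leb R]_x \int[mu]_t F [tuple of x :: t])%E}.
Proof.
have [nu nuE] := pushforward_sigma_finite (prodm (leb R) mu) (@measurable_tcons m)
  (@measurable_tuncons m) (@tconsK m).
exists nu => F mF F0; rewrite nuE//= integral_prodm//.
by apply: measurableT_comp => //; exact: measurable_tcons.
Qed.

(** Exhibits [iint] as integration against a sigma-finite measure, so that Tonelli's theorem applies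
    to it. In dimension 0 this is a Dirac mass; each further dimension pushes a product measure
    forward along the map that prepends a coordinate. *)
Lemma lebT_subproof m : {mu : {sigma_finite_measure set (m.-tuple R) -> \bar R} |
  forall F : m.-tuple R -> \bar R, measurable_fun [set: m.-tuple R] F ->
  (forall t, (0 <= F t)%E) -> (\int[mu]_t F t = iint F)%E}.
Proof.
elim: m => [|m [mu IH]].
  exists [the {sigma_finite_measure set (0.-tuple R) -> \bar R} of
    @dirac _ (0.-tuple R) [tuple] R].
  move=> F mF F0; rewrite integral_dirac// diracE in_setT mul1e /=.
  by congr F; exact: tuple0.
have [nu nuE] := tuple_measure_step mu.
exists nu => F mF F0; rewrite nuE//=.
have mF2 : measurable_fun [set: R * m.-tuple R]
    (fun p : R * m.-tuple R => F [tuple of p.1 :: p.2]).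
  by apply: measurableT_comp => //; exact: measurable_tcons.
rewrite -integral_lebE.
- apply: eq_integral => x _; rewrite -IH//.
  exact: (measurableT_comp mF2 (@measurable_pair1 _ _ _ _ x)).
- exact: (@measurable_integral2 _ _ R _ R mu (fun x t => F [tuple of x :: t]) mF2).
- by move=> x; apply: integral_ge0.
Qed.

Definition lebT m : {sigma_finite_measure set (m.-tuple R) -> \bar R} :=
  sval (lebT_subproof m).

Lemma iintE m (F : m.-tuple R -> \bar R) : measurable_fun [set: m.-tuple R] F ->
  (forall t, (0 <= F t)%E) -> (iint F = \int[lebT m]_t F t)%E.
Proof. by move=> mF F0; rewrite -(svalP (lebT_subproof m)). Qed.

Lemma integral_lebTS m (F : m.+1.-tuple R -> \bar R) :
  measurable_fun [set: m.+1.-tuple R] F -> (forall t, (0 <= F t)%E) ->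
  (\int[lebT m.+1]_t F t = \int[leb R]_x \int[lebT m]_t F [tuple of x :: t])%E.
Proof.
move=> mF F0; rewrite -iintE//=.
have mF2 : measurable_fun [set: R * m.-tuple R]
    (fun p : R * m.-tuple R => F [tuple of p.1 :: p.2]).
  by apply: measurableT_comp => //; exact: measurable_tcons.
rewrite -integral_lebE.
- apply: eq_integral => x _; rewrite -iintE//.
  exact: (measurableT_comp mF2 (@measurable_pair1 _ _ _ _ x)).
- exact: (@measurable_integral2 _ _ R _ R (lebT m) (fun x t => F [tuple of x :: t]) mF2).
- by move=> x; apply: integral_ge0.
Qed.

Lemma integral_lebT0 (F : 0.-tuple R -> \bar R) :
  measurable_fun [set: 0.-tuple R] F -> (forall t, (0 <= F t)%E) ->
  (\int[lebT 0]_t F t = F [tuple])%E.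
Proof. by move=> mF F0; rewrite -iintE. Qed.

End tuple_measure.

(** * Euclidean structure of tuples *)

Section tuple_algebra.
Context (R : realType).

Lemma coord_tnth m (x : m.-tuple R) (i : 'I_m) : coord x i = tnth x i.
Proof. by rewrite /coord (tnth_nth 0). Qed.

Lemma coord_default m (x : m.-tuple R) i : (m <= i)%N -> coord x i = 0.
Proof. by move=> mi; rewrite /coord nth_default// size_tuple. Qed.

Lemma coord_mktuple m (f : 'I_m -> R) (i : 'I_m) :
  coord [tuple f j | j < m] i = f i.
Proof. by rewrite coord_tnth tnth_mktuple. Qed.

Lemma coord_ext m (x y : m.-tuple R) :
  (forall i : 'I_m, coord x i = coord y i) -> x = y.
Proof. by move=> xy; apply: eq_from_tnth => i; rewrite -!coord_tnth. Qed.

Lemma coord_tadd m (x y : m.-tuple R) i : coord (tadd x y) i = coord x i + coord y i.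
Proof.
have [im|mi] := ltnP i m; last by rewrite !coord_default// addr0.
by rewrite -[i]/(nat_of_ord (Ordinal im)) coord_mktuple.
Qed.

Lemma coord_tscale m a (x : m.-tuple R) i : coord (tscale a x) i = a * coord x i.
Proof.
have [im|mi] := ltnP i m; last by rewrite !coord_default// mulr0.
by rewrite -[i]/(nat_of_ord (Ordinal im)) coord_mktuple.
Qed.

Lemma tadd_cons m x y (s t : m.-tuple R) :
  tadd [tuple of x :: s] [tuple of y :: t] = [tuple of x + y :: tadd s t].
Proof.
apply: coord_ext => -[[|i] im] /=; rewrite coord_tadd//.
by rewrite {3}/coord /= -/(coord (tadd s t) i) coord_tadd.
Qed.

Lemma tscale_cons m a x (t : m.-tuple R) :
  tscale a [tuple of x :: t] = [tuple of a * x :: tscale a t].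
Proof.
apply: coord_ext => -[[|i] im] /=; rewrite coord_tscale//.
by rewrite {2}/coord /= -/(coord (tscale a t) i) coord_tscale.
Qed.

Lemma sqnormE_ge0 m (x : m.-tuple R) : 0 <= sqnormE x.
Proof. by apply: sumr_ge0 => i _; rewrite -expr2 sqr_ge0. Qed.

Lemma normE_ge0 m (x : m.-tuple R) : 0 <= normE x.
Proof. exact: sqrtr_ge0. Qed.

Lemma normE_sq m (x : m.-tuple R) : normE x ^+ 2 = sqnormE x.
Proof. by rewrite sqr_sqrtr// sqnormE_ge0. Qed.

Lemma sqnormE_tscale m a (x : m.-tuple R) : sqnormE (tscale a x) = a ^+ 2 * sqnormE x.
Proof.
rewrite /sqnormE /dotE mulr_sumr; apply: eq_bigr => i _.
by rewrite !coord_tscale; ring.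
Qed.

Lemma normE_tscale m a (x : m.-tuple R) : 0 <= a -> normE (tscale a x) = a * normE x.
Proof.
by move=> a0; rewrite /normE sqnormE_tscale sqrtrM ?sqr_ge0// sqrtr_sqr ger0_norm.
Qed.

Lemma coord_le_sqnormE m (x : m.-tuple R) i : coord x i ^+ 2 <= sqnormE x.
Proof.
have [im|mi] := ltnP i m; last by rewrite !coord_default// expr0n sqnormE_ge0.
rewrite -[i]/(nat_of_ord (Ordinal im)) /sqnormE /dotE (bigD1 (Ordinal im))//=.
by rewrite -expr2 lerDl sumr_ge0// => j _; rewrite -expr2 sqr_ge0.
Qed.

Section measurability.
Context d (T : measurableType d) (m : nat).

Lemma measurable_fun_coord (f : T -> m.-tuple R) i : measurable_fun [set: T] f ->
  measurable_fun [set: T] (fun x => coord (f x) i).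
Proof.
move=> mf; have [im|mi] := ltnP i m.
  rewrite (_ : (fun x => _) = (fun t => tnth t (Ordinal im)) \o f).
    by apply: measurableT_comp => //; exact: measurable_tnth.
  by apply/funext => x; rewrite -[i]/(nat_of_ord (Ordinal im)) coord_tnth.
rewrite (_ : (fun x => _) = cst 0)//.
by apply/funext => x; rewrite coord_default.
Qed.

Lemma measurable_fun_mktuple d' (U : measurableType d') (g : T -> 'I_m -> U) :
  (forall i, measurable_fun [set: T] (g ^~ i)) ->
  measurable_fun [set: T] (fun x => [tuple g x i | i < m]).
Proof.
move=> mg; apply/measurable_fun_tnthP => i.
by rewrite (_ : _ \o _ = g ^~ i)//; apply/funext => x /=; rewrite tnth_mktuple.
Qed.

Lemma measurable_fun_dotE (f g : T -> m.-tuple R) : measurable_fun [set: T] f ->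
  measurable_fun [set: T] g -> measurable_fun [set: T] (fun x => dotE (f x) (g x)).
Proof.
move=> mf mg; apply: measurable_sum => i.
by apply: measurable_funM; exact: measurable_fun_coord.
Qed.

Lemma measurable_fun_sqnormE (f : T -> m.-tuple R) : measurable_fun [set: T] f ->
  measurable_fun [set: T] (fun x => sqnormE (f x)).
Proof. by move=> mf; exact: measurable_fun_dotE. Qed.

Lemma measurable_fun_normE (f : T -> m.-tuple R) : measurable_fun [set: T] f ->
  measurable_fun [set: T] (fun x => normE (f x)).
Proof. by move=> mf; apply: measurable_fun_sqrt; exact: measurable_fun_sqnormE. Qed.

Lemma measurable_fun_tadd (f g : T -> m.-tuple R) : measurable_fun [set: T] f ->
  measurable_fun [set: T] g -> measurable_fun [set: T] (fun x => tadd (f x) (g x)).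
Proof.
move=> mf mg; apply: measurable_fun_mktuple => i.
by apply: measurable_funD; exact: measurable_fun_coord.
Qed.

Lemma measurable_fun_tscale a (f : T -> m.-tuple R) : measurable_fun [set: T] a ->
  measurable_fun [set: T] f -> measurable_fun [set: T] (fun x => tscale (a x) (f x)).
Proof.
move=> ma mf; apply: measurable_fun_mktuple => i.
by apply: measurable_funM => //; exact: measurable_fun_coord.
Qed.

Lemma measurable_fun_tcons (f : T -> R) (g : T -> m.-tuple R) :
  measurable_fun [set: T] f -> measurable_fun [set: T] g ->
  measurable_fun [set: T] (fun x => [tuple of f x :: g x]).
Proof. exact: measurable_cons. Qed.

End measurability.

End tuple_algebra.

Ltac mfun_tuple := lazymatch goal with
  | |- measurable_fun _ (fun x => Defs.coord (@?f x) _) => apply: measurable_fun_coord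
  | |- measurable_fun _ (fun x => normE (@?f x)) => apply: measurable_fun_normE
  | |- measurable_fun _ (fun x => sqnormE (@?f x)) => apply: measurable_fun_sqnormE
  | |- measurable_fun _ (fun x => dotE (@?f x) (@?g x)) => apply: measurable_fun_dotE
  | |- measurable_fun _ (fun x => tadd (@?f x) (@?g x)) => apply: measurable_fun_tadd
  | |- measurable_fun _ (fun x => tscale (@?f x) (@?g x)) => apply: measurable_fun_tscale
  | |- measurable_fun _ (fun x => cons_tuple (@?f x) (@?g x)) => apply: measurable_fun_tcons
  | |- measurable_fun _ (fun x => tuple.tuple _) =>
      first [apply: measurable_fun_tcons | apply: measurable_fun_mktuple => ?]
  | |- measurable_fun _ (fun x => mktuple _) => apply: measurable_fun_mktuple => ?
  end.
Ltac mfun_ext ::= first [mfun_pw | mfun_tuple].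

(** * Translations, dilations and cubes in [R^m] *)

Section tuple_integrals.
Context (R : realType).
Notation leb := (leb R).
Notation lebT := (lebT R).

Lemma integral_lebT_shift m (F : m.-tuple R -> \bar R) (a : m.-tuple R) :
  measurable_fun [set: m.-tuple R] F -> (forall t, (0 <= F t)%E) ->
  (\int[lebT m]_t F (tadd t a) = \int[lebT m]_t F t)%E.
Proof.
elim: m F a => [|m IH] F a mF F0.
  by apply: eq_integral => t _; congr F; rewrite [LHS]tuple0 [RHS]tuple0.
have mF2 : measurable_fun [set: R * m.-tuple R] (fun p => F [tuple of p.1 :: p.2]).
  by mfun.
case/tupleP: a => a0 a.
rewrite !integral_lebTS//; last by mfun.
transitivity (\int[leb]_x \int[lebT m]_t F [tuple of (x + a0)%R :: t])%E.
  apply: eq_integral => x _; rewrite -[RHS](IH _ a)//; last by mfun.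
  by apply: eq_integral => t _; rewrite tadd_cons.
apply: (integral_leb_shift (g := fun x => \int[lebT m]_t F [tuple of x :: t])%E).
  exact: (measurable_integral2 (lebT m) (f := fun x t => F [tuple of x :: t])).
by move=> x; exact: integral_ge0.
Qed.

Lemma integral_lebT_scale m (F : m.-tuple R -> \bar R) (c : R) : 0 < c ->
  measurable_fun [set: m.-tuple R] F -> (forall t, (0 <= F t)%E) ->
  (\int[lebT m]_t F t = (c ^+ m)%:E * \int[lebT m]_t F (tscale c t))%E.
Proof.
move=> c0; elim: m F => [|m IH] F mF F0.
  rewrite expr0 mul1e.
  by apply: eq_integral => t _; congr F; rewrite [LHS]tuple0 [RHS]tuple0.
have mF2 : measurable_fun [set: R * m.-tuple R] (fun p => F [tuple of p.1 :: p.2]).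
  by mfun.
have mF3 : measurable_fun [set: R * m.-tuple R]
    (fun p => F [tuple of c * p.1 :: tscale c p.2]).
  by mfun.
rewrite !integral_lebTS//; last by mfun.
rewrite (integral_leb_scale (a := c))//; last 2 first.
- exact: (measurable_integral2 (lebT m) (f := fun x t => F [tuple of x :: t])).
- by move=> x; exact: integral_ge0.
rewrite exprS EFinM -muleA; congr (_ * _)%E.
rewrite -ge0_integralZl_EFin//; last 3 first.
- by move=> x _; exact: integral_ge0.
- under eq_fun do under eq_integral do rewrite tscale_cons.
  exact: (measurable_integral2 (lebT m) (f := fun x t => F [tuple of c * x :: tscale c t])).
- by rewrite exprn_ge0// ltW.
apply: eq_integral => x _; rewrite IH//; last by mfun.
by congr (_ * _)%E; apply: eq_integral => t _; rewrite tscale_cons.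
Qed.

(** The indicator of a cube, written as a product so that its integral factors over the coordinates.
    Cubes give the finite and positive bounds for balls and annuli. *)
Definition boxI m (l u : R) (t : m.-tuple R) : R :=
  \prod_(i < m) (if (l <= coord t i) && (coord t i <= u) then 1 else 0).

Lemma measurable_boxI m l u : measurable_fun [set: m.-tuple R] (boxI l u).
Proof. by apply: measurable_prod => i _; mfun. Qed.

Lemma boxI_ge0 m l u (t : m.-tuple R) : 0 <= boxI l u t.
Proof. by apply: prodr_ge0 => i _; case: ifP. Qed.

Lemma boxI_eq1 m l u (t : m.-tuple R) : (forall i : 'I_m, l <= coord t i <= u) ->
  boxI l u t = 1.
Proof. by move=> h; apply: big1 => i _; rewrite h. Qed.

Lemma boxI_neq0 m l u (t : m.-tuple R) : boxI l u t != 0 ->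
  forall i : 'I_m, l <= coord t i <= u.
Proof.
move=> h i; apply/negPn/negP => hi; move/eqP: h; apply.
by rewrite /boxI (bigD1 i)//= (negbTE hi) mul0r.
Qed.

Lemma boxI_le1 m l u (t : m.-tuple R) : boxI l u t <= 1.
Proof. by apply: prodr_ile1 => i _; case: ifP => //=; rewrite ler01 lexx. Qed.

Lemma integral_indic_itv (l u c : R) : l <= u ->
  (\int[leb]_x (if (l <= x)%R && (x <= u)%R then c else 0%R)%:E = (c * (u - l))%:E)%E.
Proof.
move=> lu; transitivity (\int[leb]_(x in `[l, u]) (cst c%:E) x)%E.
  rewrite [RHS]integral_mkcond; apply: eq_integral => x _; rewrite patchE.
  by rewrite mem_setE in_itv/=; case: ifP.
by rewrite integral_cst// leb_itv.
Qed.

Lemma integral_boxI m (l u : R) : l <= u ->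
  (\int[lebT m]_t (boxI l u t)%:E = ((u - l) ^+ m)%:E)%E.
Proof.
move=> lu; elim: m => [|m IH].
  rewrite integral_lebT0.
  - by rewrite /boxI big_ord0 expr0.
  - by apply: measurable_fun_EFin; exact: measurable_boxI.
  - by move=> t; rewrite lee_fin boxI_ge0.
rewrite integral_lebTS; last 2 first.
- by apply: measurable_fun_EFin; exact: measurable_boxI.
- by move=> t; rewrite lee_fin boxI_ge0.
transitivity (\int[leb]_x (if (l <= x)%R && (x <= u)%R then ((u - l) ^+ m)%R else 0%R)%:E)%E.
  apply: eq_integral => x _.
  transitivity (\int[lebT m]_t
      ((if (l <= x)%R && (x <= u)%R then 1%R else 0%R)%:E * (boxI l u t)%:E))%E.
    by apply: eq_integral => t _; rewrite /boxI big_ord_recl.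
  rewrite ge0_integralZl_EFin//.
  - by rewrite IH -EFinM; case: ifP => _; rewrite ?mul1r ?mul0r.
  - by move=> t _; rewrite lee_fin boxI_ge0.
  - by apply: measurable_fun_EFin; exact: measurable_boxI.
  - by case: ifP.
by rewrite integral_indic_itv// exprSr.
Qed.

End tuple_integrals.

(** * Rotation invariance of Lebesgue measure *)

Section orthogonal_invariance.
Context (R : realType) (n : nat).
Implicit Types (M : 'M[R]_n) (x y : n.-tuple R).

Definition mact M x : n.-tuple R := [tuple \sum_(j < n) M i j * coord x j | i < n].

Let cv x : 'cV[R]_n := \col_i coord x i.

Let cv_inj : injective cv.
Proof. by move=> x y /colP h; apply: coord_ext => i; have := h i; rewrite !mxE. Qed.

Let cv_mact M x : cv (mact M x) = M *m cv x.
Proof.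
apply/colP => i; rewrite !mxE coord_mktuple; apply: eq_bigr => j _.
by rewrite mxE.
Qed.

Lemma mact_mul M N x : mact (M *m N) x = mact M (mact N x).
Proof. by apply: cv_inj; rewrite !cv_mact mulmxA. Qed.

Lemma mact1 x : mact 1%:M x = x.
Proof. by apply: cv_inj; rewrite cv_mact mul1mx. Qed.

Lemma mact_tadd M x y : mact M (tadd x y) = tadd (mact M x) (mact M y).
Proof.
apply: coord_ext => i; rewrite coord_tadd !coord_mktuple -big_split/=.
by apply: eq_bigr => j _; rewrite coord_tadd mulrDr.
Qed.

Lemma mact_tscale M a x : mact M (tscale a x) = tscale a (mact M x).
Proof.
apply: coord_ext => i; rewrite coord_tscale !coord_mktuple mulr_sumr.
by apply: eq_bigr => j _; rewrite coord_tscale; ring.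
Qed.

Lemma dotE_mx x y : dotE x y = ((cv x)^T *m cv y) ord0 ord0.
Proof. by rewrite mxE; apply: eq_bigr => i _; rewrite !mxE. Qed.

Lemma sqnormE_mact M x : M *m M^T = 1%:M -> sqnormE (mact M x) = sqnormE x.
Proof.
move=> /mulmx1C MM.
by rewrite /sqnormE !dotE_mx cv_mact trmx_mul mulmxA -(mulmxA _ _ M) MM mulmx1.
Qed.

Lemma normE_mact M x : M *m M^T = 1%:M -> normE (mact M x) = normE x.
Proof. by move=> MM; rewrite /normE sqnormE_mact. Qed.

Lemma measurable_fun_mact d (T : measurableType d) (M : T -> 'M[R]_n) (f : T -> n.-tuple R) :
  (forall i j, measurable_fun [set: T] (fun t => M t i j)) ->
  measurable_fun [set: T] f -> measurable_fun [set: T] (fun t => mact (M t) (f t)).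
Proof. by move=> mM mf; rewrite /mact; mfun. Qed.

(** A rotation-invariant and even test function. The radius [sqrt n] makes the ball contain the cube
    [[-1, 1]^n], so its integral is positive; a larger cube shows that it is finite. *)
Let ballI x : R := if sqnormE x <= n%:R then 1 else 0.

Let ballI_gt0 : (0 < \int[lebT R n]_x (ballI x)%:E)%E.
Proof.
have : (0 < \int[lebT R n]_x (boxI (-1) 1 x)%:E)%E.
  by rewrite integral_boxI ?lte_fin ?exprn_gt0//; lra.
move/lt_le_trans; apply; apply: le_integral_T => x; first by rewrite lee_fin boxI_ge0.
rewrite lee_fin; have [->|/boxI_neq0 h] := eqVneq (boxI (-1) 1 x) 0.
  by rewrite /ballI; case: ifP.
rewrite (le_trans (boxI_le1 _ _ _))// /ballI ifT//.
have -> : n%:R = \sum_(i < n) (1 : R) by rewrite sumr_const card_ord.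
by apply: ler_sum => i _; have := h i; nra.
Qed.

Let ballI_lty : (\int[lebT R n]_x (ballI x)%:E < +oo)%E.
Proof.
have n0 : 0 <= n%:R :> R by [].
have : (\int[lebT R n]_x (boxI (- (n%:R + 1)) (n%:R + 1) x)%:E < +oo)%E.
  by rewrite integral_boxI ?ltry//; lra.
apply: le_lt_trans; apply: le_integral_T => x.
  by rewrite lee_fin /ballI; case: ifP.
rewrite lee_fin /ballI; case: ifPn => [h|_]; last exact: boxI_ge0.
rewrite boxI_eq1// => i; have := coord_le_sqnormE x i.
by move=> /le_trans /(_ h) hi; apply/andP; split; nra.
Qed.

(* Averaging [F (mact M x) * ballI z] over [x] and [z] and translating in either variable
   shows that [F] and [F o M] have the same integral: no change of variables needed. *)
Lemma integral_lebT_mact M (F : n.-tuple R -> \bar R) : M *m M^T = 1%:M ->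
  measurable_fun [set: n.-tuple R] F -> (forall t, (0 <= F t)%E) ->
  (\int[lebT R n]_t F (mact M t) = \int[lebT R n]_t F t)%E.
Proof.
move=> MM mF F0.
have mM : measurable_fun [set: n.-tuple R] (mact M).
  by apply: measurable_fun_mact => [i j|]; mfun.
have mB : measurable_fun [set: n.-tuple R] ballI.
  by rewrite /ballI; mfun.
have B0 x : (0 <= (ballI x)%:E)%E by rewrite lee_fin /ballI; case: ifP.
have BM x : ballI (mact M x) = ballI x by rewrite /ballI sqnormE_mact.
have BN x : ballI (tscale (-1) x) = ballI x.
  by rewrite /ballI sqnormE_tscale sqrrN expr1n mul1r.
suff : ((\int[lebT R n]_x (ballI x)%:E) * \int[lebT R n]_t F (mact M t) =
        (\int[lebT R n]_x (ballI x)%:E) * \int[lebT R n]_t F t)%E.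
  have fin : (\int[lebT R n]_x (ballI x)%:E)%E \is a fin_num.
    by rewrite ge0_fin_numE// ltW.
  move: ballI_gt0; rewrite -(fineK fin) lte_fin => b0.
  move/(congr1 (fun e => ((fine (\int[lebT R n]_x (ballI x)%:E))^-1%:E * e)%E)).
  by rewrite !muleA -!EFinM mulVf ?gt_eqF// !mul1e.
rewrite -ge0_integralZl//; last 2 first.
- by mfun.
- exact: ltW.
transitivity (\int[lebT R n]_x \int[lebT R n]_z
    ((ballI (tadd z (tscale (-1) (mact M x))))%:E * F (mact M x)))%E.
  apply: eq_integral => x _.
  rewrite ge0_integralZr//; last by mfun.
  congr (_ * _)%E.
  by rewrite (integral_lebT_shift (F := fun z => (ballI z)%:E))//; mfun.
rewrite tonelli; last 2 first.
- by mfun.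
- by move=> x z; rewrite mule_ge0.
transitivity (\int[lebT R n]_z \int[lebT R n]_x
    ((ballI x)%:E * F (tadd (mact M x) z)))%E.
  apply: eq_integral => z _.
  (* Shifting [x] by [M^T z] turns [M x] into [M x + z] and the argument [z - M x] of the ball into
     [- M x]; symmetry and invariance of the ball reduce the latter to [x]. *)
  rewrite -[LHS](integral_lebT_shift (mact M^T z)); last 2 first.
  - by mfun.
  - by move=> x; rewrite mule_ge0.
  apply: eq_integral => x _; rewrite mact_tadd -mact_mul MM mact1.
  congr (_ * _)%E; congr (_%:E); rewrite -[RHS]BM -[RHS]BN; congr ballI.
  by apply: coord_ext => i; rewrite !(coord_tadd, coord_tscale); ring.
rewrite tonelli; last 2 first.
- by mfun.
- by move=> x z; rewrite mule_ge0.
rewrite muleC -ge0_integralZl//; last 2 first.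
- by mfun.
- exact: integral_ge0.
apply: eq_integral => x _; rewrite muleC ge0_integralZl_EFin//; last 2 first.
- by mfun.
- by rewrite -lee_fin.
congr (_ * _)%E; rewrite -[RHS](integral_lebT_shift (mact M x))//.
by apply: eq_integral => z _; congr F; apply: coord_ext => i; rewrite !coord_tadd addrC.
Qed.

End orthogonal_invariance.

(** * Polar coordinates from dilation invariance *)

Section polar_coordinates.
Context (R : realType).
Notation leb := (leb R).
Notation lebT := (lebT R).

Lemma dilation_halfline : dilation_invariant leb (pw (-1)) (fun x : R => x).
Proof.
split => //.
- by rewrite -[pw _]/(fun x => pw (-1) x); mfun.
- by move=> x; exact: pw_ge0.
- by move=> x; exact: pw_neq0.
move=> c F c0 mF F0.
rewrite [RHS](integral_leb_scale c0); last 2 first.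
- by mfun.
- by move=> x; rewrite mule_ge0// lee_fin pw_ge0.
rewrite -ge0_integralZl_EFin//; last 3 first.
- by move=> x _; rewrite mule_ge0// lee_fin pw_ge0.
- by mfun.
- exact: ltW.
apply: eq_integral => x _; rewrite muleA -EFinM pwM// mulrA.
by rewrite powR_inv1 ?ltW// mulfV ?gt_eqF// mul1r.
Qed.

Lemma dilation_space m : dilation_invariant (lebT m)
  (fun x => pw (- m%:R) (normE x)) (@normE R m).
Proof.
split => //.
- by mfun.
- by rewrite -[@normE R m]/(fun x => normE x); mfun.
- by move=> x; exact: pw_ge0.
- by move=> x; exact: pw_neq0.
move=> c F c0 mF F0.
rewrite [RHS](integral_lebT_scale c0); last 2 first.
- by mfun.
- by move=> x; rewrite mule_ge0// lee_fin pw_ge0.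
rewrite -ge0_integralZl_EFin//; last 3 first.
- by move=> x _; rewrite mule_ge0// lee_fin pw_ge0.
- by mfun.
- by rewrite exprn_ge0// ltW.
apply: eq_integral => x _; rewrite muleA -EFinM normE_tscale ?ltW// pwM// mulrA.
by rewrite powR_invn ?ltW// mulfV ?mul1r// gt_eqF// exprn_gt0.
Qed.

Lemma integral_plane_scale (H : R -> R -> \bar R) (c : R) : 0 < c ->
  measurable_fun [set: R * R] (fun p => H p.1 p.2) -> (forall x y, (0 <= H x y)%E) ->
  (\int[prodm leb leb]_p H p.1 p.2 =
   \int[prodm leb leb]_p ((c * c)%:E * H (c * p.1)%R (c * p.2)%R))%E.
Proof.
move=> c0 mH H0.
have mcomp (u v : R * R -> R) : measurable_fun setT u -> measurable_fun setT v ->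
    measurable_fun [set: R * R] (fun p => H (u p) (v p)).
  move=> mu mv; apply: (measurableT_comp mH (g := fun p => (u p, v p))).
  exact: measurable_fun_pair.
have mHc : measurable_fun [set: R * R] (fun p => H p.1 (c * p.2)) by apply: mcomp; mfun.
have mHcc : measurable_fun [set: R * R] (fun p => H (c * p.1) (c * p.2)).
  by apply: mcomp; mfun.
rewrite [LHS]integral_prodm//.
transitivity (\int[leb]_x (c%:E * \int[leb]_y H x (c * y)%R))%E.
  apply: eq_integral => x _; rewrite [LHS](integral_leb_scale c0)//.
  exact: (measurableT_comp mH (@measurable_pair1 _ _ _ _ x)).
rewrite [LHS](integral_leb_scale c0); last 2 first.
- apply: emeasurable_funM => //.
  exact: (measurable_integral2 leb (f := fun x y => H x (c * y)%R)).
- by move=> x; rewrite mule_ge0 ?lee_fin ?(ltW c0)// integral_ge0.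
rewrite -ge0_integralZl_EFin ?ltW//; last 2 first.
- by move=> x _; rewrite mule_ge0 ?lee_fin ?(ltW c0)// integral_ge0.
- apply: emeasurable_funM => //.
  exact: (measurable_integral2 leb (f := fun x y => H (c * x)%R (c * y)%R)).
rewrite integral_prodm; last 2 first.
- by apply: emeasurable_funM => //.
- by move=> p; rewrite mule_ge0// lee_fin mulr_ge0// ltW.
apply: eq_integral => x _.
have mHx : measurable_fun [set: R] (fun y => H (c * x) (c * y)).
  exact: (measurableT_comp mHcc (@measurable_pair1 _ _ _ _ x)).
rewrite ge0_integralZl_EFin//; last by rewrite mulr_ge0// ltW.
by rewrite EFinM muleA.
Qed.

(** The weight is homogeneous of degree [(a - 1) + (b - 1) - (a + b) = -2], which cancels the factor
    [c * c] by which a dilation changes area. *)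
Lemma dilation_plane (a b : R) : dilation_invariant (prodm leb leb)
  (fun p => pw (a - 1) p.1 * pw (b - 1) p.2 *
     pw (- (a + b)) (Num.sqrt (p.1 ^+ 2 + p.2 ^+ 2)))
  (fun p => Num.sqrt (p.1 ^+ 2 + p.2 ^+ 2)).
Proof.
have w0 (p : R * R) : 0 <= pw (a - 1) p.1 * pw (b - 1) p.2 *
    pw (- (a + b)) (Num.sqrt (p.1 ^+ 2 + p.2 ^+ 2)).
  by rewrite !mulr_ge0// pw_ge0.
split => //.
- by mfun.
- by mfun.
- by move=> p; rewrite mulf_eq0 negb_or => /andP[_]; exact: pw_neq0.
move=> c F c0 mF F0.
rewrite [RHS](@integral_plane_scale (fun x y => ((pw (a - 1) x * pw (b - 1) y *
     pw (- (a + b)) (Num.sqrt (x ^+ 2 + y ^+ 2)))%:E *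
     F (Num.sqrt (x ^+ 2 + y ^+ 2)))%E) c c0); last 2 first.
- by mfun.
- by move=> x y; rewrite mule_ge0// lee_fin !mulr_ge0// pw_ge0.
apply: eq_integral => -[x y] _ /=.
rewrite !muleA -!EFinM.
have -> : (c * x) ^+ 2 + (c * y) ^+ 2 = c ^+ 2 * (x ^+ 2 + y ^+ 2) by ring.
rewrite sqrtrM ?sqr_ge0// sqrtr_sqr gtr0_norm// !pwM//.
congr ((_%:E) * _)%E.
have E : c * c * (c `^ (a - 1) * (c `^ (b - 1) * c `^ (- (a + b)))) = 1.
  rewrite -!powRD ?(gt_eqF c0) ?implybT//.
  have -> : a - 1 + (b - 1 + - (a + b)) = - 2%:R by ring.
  by rewrite powR_invn ?ltW// -expr2 mulfV// lt0r_neq0// exprn_gt0.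
rewrite [RHS](_ : _ = c * c * (c `^ (a - 1) * (c `^ (b - 1) * c `^ (- (a + b)))) *
  (pw (a - 1) x * pw (b - 1) y * pw (- (a + b)) (Num.sqrt (x ^+ 2 + y ^+ 2)))).
  by rewrite E mul1r.
by ring.
Qed.

(** Provides a test function of finite positive mass, so that the constant in
    [dilation_proportional] can be divided out. *)
Lemma halfline_annulus (a b : R) : 0 < a -> a < b ->
  exists s : R, 0 < s /\
  (\int[leb]_x ((pw (-1) x)%:E * (if (a <= x)%R && (x <= b)%R then 1%R else 0%R)%:E))%E = s%:E.
Proof.
move=> a0 ab; have b0 : 0 < b by lra.
set I := (\int[leb]_x _)%E.
have lo : ((b^-1 * (b - a))%:E <= I)%E.
  rewrite -integral_indic_itv ?(ltW ab)// /I; apply: le_integral_T => x.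
    by rewrite lee_fin; case: ifP => // _; rewrite invr_ge0 ltW.
  rewrite -EFinM lee_fin; case: ifP => [/andP[ax xb]|_]; last by rewrite mulr0.
  by rewrite mulr1 pwE ?powR_inv1 ?lef_pV2 ?posrE//; lra.
have hi : (I <= (a^-1 * (b - a))%:E)%E.
  rewrite -integral_indic_itv ?(ltW ab)// /I; apply: le_integral_T => x.
    by rewrite mule_ge0 ?lee_fin ?pw_ge0//; case: ifP.
  rewrite -EFinM lee_fin; case: ifP => [/andP[ax xb]|_]; last by rewrite mulr0.
  by rewrite mulr1 pwE ?powR_inv1 ?lef_pV2 ?posrE//; lra.
have fin : I \is a fin_num.
  rewrite fin_numE; apply/andP; split; apply/eqP => E.
  - by move: lo; rewrite E leeNy_eq.
  - by move: hi; rewrite E leye_eq.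
exists (fine I); split; last by rewrite fineK.
rewrite -lte_fin fineK//; apply: lt_le_trans lo; rewrite lte_fin mulr_gt0//; last lra.
by rewrite invr_gt0.
Qed.

(** The annulus contains the cube [[1, 2]^m], since [4 m <= (2 m)^2], so its mass is positive. It
    lies in the cube [[-2m, 2m]^m] and the weight is at most 1 on it, so its mass is finite. *)
Lemma space_annulus m : (0 < m)%N ->
  exists s : R, 0 < s /\
  (\int[lebT m]_x ((pw (- m%:R) (normE x))%:E *
     (if (1 <= normE x)%R && (normE x <= 2 * m%:R)%R then 1%R else 0%R)%:E))%E = s%:E.
Proof.
move=> m0; have m1 : 1 <= m%:R :> R by rewrite ler1n.
set I := (\int[lebT m]_x _)%E.
have lo : ((((2 * m%:R) `^ (- m%:R))%:E * \int[lebT m]_x (boxI 1 2 x)%:E) <= I)%E.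
  rewrite -ge0_integralZl_EFin ?powR_ge0//; last 2 first.
  - by move=> x _; rewrite lee_fin boxI_ge0.
  - by apply: measurable_fun_EFin; exact: measurable_boxI.
  rewrite /I; apply: le_integral_T => x; first by rewrite mule_ge0// lee_fin ?powR_ge0 ?boxI_ge0.
  rewrite -!EFinM lee_fin; have [->|/boxI_neq0 h] := eqVneq (boxI 1 2 x) 0.
    by rewrite mulr0 mulr_ge0 ?pw_ge0//; case: ifP.
  have n1 : 1 <= normE x.
    rewrite -(ler_pXn2r (n := 2)) ?nnegrE ?normE_ge0// normE_sq expr1n.
    apply: le_trans (coord_le_sqnormE x 0).
    by have := h (Ordinal m0) => /=; nra.
  have n2 : normE x <= 2 * m%:R.
    rewrite -(ler_pXn2r (n := 2)) ?nnegrE ?normE_ge0 ?mulr_ge0//.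
    rewrite normE_sq; apply: (@le_trans _ _ (\sum_(i < m) 4)).
      apply: ler_sum => i _; have /andP[h1 h2] := h i.
      by rewrite (_ : 4 = 2 * 2 :> R); [apply: ler_pM => //; lra|ring].
    rewrite sumr_const card_ord -[4 *+ m]mulr_natl (_ : _ ^+ 2 = m%:R * m%:R * 4); last by ring.
    by rewrite ler_pM2r// ler_peMr//; lra.
  rewrite n1 n2 /= mulr1 (le_trans (ler_piMr _ (boxI_le1 _ _ _))) ?powR_ge0//.
  rewrite pwE ?powR_invn; [|lra..|lra].
  by rewrite lef_pV2 ?posrE ?exprn_gt0//; [apply: lerXn2r; rewrite ?nnegrE//; lra|lra..].
have hi : (I <= \int[lebT m]_x (boxI (- (2 * m%:R)) (2 * m%:R) x)%:E)%E.
  apply: le_integral_T => x.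
    by rewrite mule_ge0 ?lee_fin ?pw_ge0//; case: ifP.
  rewrite -EFinM lee_fin; case: ifP => [/andP[ax xb]|_]; last by rewrite mulr0 boxI_ge0.
  rewrite boxI_eq1; last first.
    move=> i; have := coord_le_sqnormE x i; rewrite -normE_sq => h.
    by apply/andP; split; nra.
  rewrite mulr1 pwE ?powR_invn; [|lra..].
  by rewrite invf_le1 ?exprn_ege1// exprn_gt0//; lra.
rewrite integral_boxI ?ler1n// in lo.
rewrite integral_boxI in hi; last lra.
have fin : I \is a fin_num.
  rewrite fin_numE; apply/andP; split; apply/eqP => E.
  - by move: lo; rewrite E -EFinM leeNy_eq.
  - by move: hi; rewrite E leye_eq.
exists (fine I); split; last by rewrite fineK.
rewrite -lte_fin fineK//; apply: lt_le_trans lo; rewrite lte_fin mulr_gt0//.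
by rewrite powR_gt0//; lra.
Qed.

(** Both sides are dilation-invariant functionals of the radius, hence proportional. The constant
    [s], the area of the unit sphere, is obtained as the quotient of the masses of one annulus. *)
Lemma polar m : (0 < m)%N -> exists s : R, 0 < s /\
  forall F : R -> \bar R, measurable_fun [set: R] F -> (forall r, (0 <= F r)%E) ->
  (\int[lebT m]_x ((pw (- m%:R) (normE x))%:E * F (normE x)) =
   s%:E * \int[leb]_r ((pw (-1) r)%:E * F r))%E.
Proof.
move=> m0; have m1 : 1 <= m%:R :> R by rewrite ler1n.
have [u [u0 uE]] := space_annulus m0.
have [v [v0 vE]] : exists s : R, 0 < s /\
  (\int[leb]_x ((pw (-1) x)%:E *
     (if ((2 * m%:R)^-1 <= x)%R && (x <= 1)%R then 1%R else 0%R)%:E))%E = s%:E.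
  apply: halfline_annulus; first by rewrite invr_gt0; lra.
  by rewrite invf_lt1; lra.
exists (u / v); split; first exact: divr_gt0.
move=> F mF F0.
have E : (\int[lebT m]_x ((pw (- m%:R) (normE x))%:E * F (normE x)) * v%:E =
  \int[leb]_x ((pw (-1) x)%:E * F x) * u%:E)%E.
  rewrite -vE -uE.
  (* [dilation_proportional] inverts the argument of its test function on one side; the inversion
     carries [[1, 2m]] to [[1 / (2m), 1]]. *)
  rewrite (dilation_proportional (dilation_space m) dilation_halfline mF F0
    (G := fun x => (if ((2 * m%:R)^-1 <= x)%R && (x <= 1)%R then 1%R else 0%R)%:E)); last 2 first.
  - by mfun.
  - by move=> r; case: ifP.
  congr (_ * _)%E; apply: eq_integral => x _.
  have [->|/pw_neq0 nx] := eqVneq (pw (- m%:R) (normE x)) 0.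
    by rewrite !mul0e.
  congr (_ * _)%E; rewrite /= lef_pV2 ?posrE//; last lra.
  by rewrite invf_le1// andbC.
move/(congr1 (fun e => (e * v^-1%:E)%E)): E.
rewrite -!muleA -!EFinM mulfV ?gt_eqF// mule1 => ->.
by rewrite muleC.
Qed.

End polar_coordinates.

(** * Integrals of powers on the half line and in the plane *)

Section power_integrals.
Context (R : realType).
Notation leb := (leb R).

(** When both spaces are the half line, the one-sided inversion in [dilation_proportional] becomes
    the invariance itself, once the finite positive mass [s] is cancelled. *)
Lemma halfline_inv (F : R -> \bar R) : measurable_fun [set: R] F ->
  (forall r, (0 <= F r)%E) ->
  (\int[leb]_r ((pw (-1) r)%:E * F r^-1%R) = \int[leb]_r ((pw (-1) r)%:E * F r))%E.
Proof.
move=> mF F0.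
have [s [s0 sE]] := @halfline_annulus R 1 2 ltr01 ltac:(lra).
have /= := dilation_proportional (@dilation_halfline R) (@dilation_halfline R)
  (F := fun x => (if (1 <= x)%R && (x <= 2)%R then 1%R else 0%R)%:E) (G := F).
rewrite sE => E.
have {}E : (s%:E * \int[leb]_r ((pw (-1) r)%:E * F r) =
  s%:E * \int[leb]_r ((pw (-1) r)%:E * F r^-1%R))%E.
  by apply: E => //; [mfun|move=> r; case: ifP].
move/(congr1 (fun e => (s^-1%:E * e)%E)): E.
by rewrite !muleA -!EFinM mulVf ?gt_eqF// !mul1e.
Qed.

Lemma powR_cvgy0 (g : R) : 0 < g -> x `^ (- g) @[x --> +oo] --> (0 : R).
Proof.
move=> g0; apply/cvgrPdist_lt => /= e e0; near=> x.
have x0 : 0 < x by near: x; exact: nbhs_pinfty_gt.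
rewrite sub0r normrN ger0_norm ?powR_ge0// powRN.
have h : e `^ (- g^-1) < x by near: x; exact: nbhs_pinfty_gt.
have := gt0_ltr_powR g0 _ _ h; rewrite !nnegrE powR_ge0 ltW// => /(_ isT isT).
rewrite -powRrM mulNr mulVf ?gt_eqF// powRN powRr1 ?ltW// => ex.
by rewrite -[e]invrK ltf_pV2 ?posrE ?invr_gt0 ?powR_gt0.
Unshelve. all: by end_near.
Qed.

Lemma integral_powR_tail (g : R) : 0 < g ->
  (\int[leb]_x (if (1 <= x)%R then pw (- g - 1) x else 0%R)%:E = g^-1%:E)%E.
Proof.
move=> g0.
rewrite -integral_lebE; last 2 first.
- by mfun.
- by move=> x; rewrite lee_fin; case: ifP => // _; exact: pw_ge0.
transitivity (\int[@lebesgue_measure R]_(x in `[1%R, +oo[) (x `^ (- g - 1))%:E)%E.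
  rewrite [RHS]integral_mkcond; apply: eq_integral => x _; rewrite patchE.
  rewrite mem_setE in_itv/= andbT; case: ifP => // x1.
  by rewrite pwE//; lra.
rewrite (@ge0_continuous_FTC2y _ _ (fun x => - g^-1 * x `^ (- g)) 1 0).
- by rewrite powR1 mulr1 EFinN oppeK add0e.
- by move=> x _; exact: powR_ge0.
- apply: continuous_in_subspaceT => x /set_mem /=; rewrite in_itv/= andbT => x1.
  apply: differentiable_continuous; apply/derivable1_diffP.
  by apply: derivable_powR; rewrite in_itv/= andbT; lra.
- rewrite -[X in _ --> X](mulr0 (- g^-1)).
  by apply: cvgMr; exact: powR_cvgy0.
- move=> x x1; apply: derivableM => //.
  by apply: derivable_powR; rewrite in_itv/= andbT; lra.
- have : {for 1, continuous (fun x : R => - g^-1 * x `^ (- g))}.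
    apply: differentiable_continuous; apply/derivable1_diffP.
    apply: derivableM => //.
    by apply: derivable_powR; rewrite in_itv/= andbT; lra.
  by move=> c1; apply: cvg_at_right_filter; exact: c1.
- move=> x; rewrite in_itv/= andbT => x1.
  have x0 : 0 < x by lra.
  rewrite derive1E.
  have dp := is_derive1_powR (- g) x0.
  have [_ ->] : is_derive x 1 (fun x => - g^-1 * x `^ (- g))
      (- g^-1 * (- g * x `^ (- g - 1))).
    by apply: is_derive_eq; rewrite /GRing.scale/= ?mulr0 ?addr0.
  by field; rewrite gt_eqF.
Qed.

(** The inversion [x -> 1 / x] reduces this to the tail, which keeps the fundamental theorem of
    calculus away from the singularity at 0. *)
Lemma integral_powR_head (g : R) : 0 < g ->
  (\int[leb]_x (if (x <= 1)%R then pw (g - 1) x else 0%R)%:E = g^-1%:E)%E.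
Proof.
move=> g0; rewrite -(integral_powR_tail g0).
transitivity (\int[leb]_x ((pw (-1) x)%:E * (if (x <= 1)%R then pw g x else 0%R)%:E))%E.
  apply: eq_integral => x _; rewrite -EFinM; congr (_%:E).
  by case: ifP => _; rewrite ?mulr0// pwD addrC.
rewrite -halfline_inv; last 2 first.
- by mfun.
- by move=> r; rewrite lee_fin; case: ifP => // _; exact: pw_ge0.
apply: eq_integral => x _; rewrite -EFinM; congr (_%:E).
have [x0|x0] := ltP 0 x; last first.
  rewrite {1}/pw ltNge x0 /= mul0r; case: ifP => // x1.
  by rewrite /pw ltNge x0.
rewrite invf_le1//; case: ifP => _; last by rewrite mulr0.
rewrite !pwE ?invr_gt0// -powR_inv1 ?ltW// -powRrM mulN1r.
by rewrite -powRD ?(gt_eqF x0) ?implybT// addrC.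
Qed.

Lemma plane_radial_le (a b : R) : 0 < a -> 0 < b -> exists C : R, 0 < C /\
  forall F : R -> \bar R, measurable_fun [set: R] F -> (forall r, (0 <= F r)%E) ->
  (\int[leb]_t \int[leb]_z ((pw (a - 1) t * pw (b - 1) z *
      pw (- (a + b)) (Num.sqrt (t ^+ 2 + z ^+ 2)))%:E * F (Num.sqrt (t ^+ 2 + z ^+ 2))) <=
   C%:E * \int[leb]_r ((pw (-1) r)%:E * F r))%E.
Proof.
move=> a0 b0.
have [s [s0 sE]] := @halfline_annulus R 1 2 ltr01 ltac:(lra).
pose C := 2 `^ (a + b) * a^-1 * b^-1 / s.
have C0 : 0 < C by rewrite !mulr_gt0 ?powR_gt0 ?invr_gt0.
exists C; split => // F mF F0.
pose w (p : R * R) := pw (a - 1) p.1 * pw (b - 1) p.2 *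
  pw (- (a + b)) (Num.sqrt (p.1 ^+ 2 + p.2 ^+ 2)).
have w0 p : 0 <= w p by rewrite !mulr_ge0// pw_ge0.
have mw : measurable_fun [set: R * R] w by rewrite /w; mfun.
rewrite -(@integral_prodm _ _ _ _ _ _ _ (fun p => (w p)%:E *
  F (Num.sqrt (p.1 ^+ 2 + p.2 ^+ 2)))%E); last 2 first.
- by mfun.
- by move=> p; rewrite mule_ge0// lee_fin.
pose G (x : R) : \bar R := (if (1 <= x)%R && (x <= 2)%R then 1%R else 0%R)%:E.
have mG : measurable_fun [set: R] G by rewrite /G; mfun.
have G0 r : (0 <= G r)%E by rewrite lee_fin; case: ifP.
have E := dilation_proportional (dilation_plane a b) (@dilation_halfline R) mF F0 mG G0.
rewrite sE in E.
have bnd : (\int[prodm leb leb]_p ((w p)%:E * G (Num.sqrt (p.1 ^+ 2 + p.2 ^+ 2))^-1%R) <=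
    (2 `^ (a + b) * a^-1 * b^-1)%:E)%E.
  pose u g x := if (x <= 1) then pw (g - 1) x else 0 : R.
  have u0 g x : 0 <= u g x by rewrite /u; case: ifP => // _; exact: pw_ge0.
  have mu g d (T : measurableType d) (f : T -> R) : measurable_fun [set: T] f ->
    measurable_fun [set: T] (fun x => u g (f x)) by move=> mf; rewrite /u; mfun.
  have -> : ((2 `^ (a + b) * a^-1 * b^-1)%:E =
    \int[prodm leb leb]_p ((2 `^ (a + b))%:E * ((u a p.1)%:E * (u b p.2)%:E)))%E.
    rewrite ge0_integralZl_EFin ?powR_ge0//; last 2 first.
    - by move=> p _; rewrite mule_ge0// lee_fin.
    - by apply: emeasurable_funM; apply: measurable_fun_EFin; apply: mu; mfun.
    rewrite integral_prodm; last 2 first.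
    - by apply: emeasurable_funM; apply: measurable_fun_EFin; apply: mu; mfun.
    - by move=> p; rewrite mule_ge0// lee_fin.
    rewrite -mulrA EFinM; congr (_ * _)%E; rewrite EFinM.
    rewrite -integral_powR_head// -ge0_integralZr; last 4 first.
    - exact: measurableT.
    - by apply: measurable_fun_EFin; apply: (mu a); mfun.
    - by move=> x _; rewrite lee_fin; exact: (u0 a).
    - by rewrite lee_fin invr_ge0 ltW.
    apply: eq_integral => x _; rewrite -integral_powR_head//= -ge0_integralZl_EFin//.
    - by move=> y _; rewrite lee_fin; exact: (u0 b).
    - by apply: measurable_fun_EFin; apply: (mu b); mfun.
    - exact: (u0 a).
  apply: le_integral_T => -[x y].
    by rewrite mule_ge0// lee_fin.
  rewrite -!EFinM lee_fin /=; case: ifP => [/andP[r1 r2]|_]; last first.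
    by rewrite mulr0 !mulr_ge0// powR_ge0.
  rewrite mulr1 /w /=.
  have [->|/pw_neq0 x0] := eqVneq (pw (a - 1) x) 0.
    by rewrite !mul0r !mulr_ge0// powR_ge0.
  have [->|/pw_neq0 y0] := eqVneq (pw (b - 1) y) 0.
    by rewrite mulr0 mul0r !mulr_ge0// powR_ge0.
  set r := Num.sqrt _ in r1 r2 *.
  have r0 : 0 < r by rewrite -invr_gt0; lra.
  have r_le1 : r <= 1 by rewrite -[r]invrK invf_le1// invr_gt0.
  have r_ge : 2^-1 <= r by rewrite -[r]invrK lef_pV2 ?posrE ?invr_gt0.
  have rE : r ^+ 2 = x ^+ 2 + y ^+ 2.
    by rewrite sqr_sqrtr// addr_ge0 ?sqr_ge0.
  have x1 : x <= 1 by nra.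
  have y1 : y <= 1 by nra.
  rewrite /u x1 y1 mulrC ler_wpM2r ?mulr_ge0 ?pw_ge0// pwE// powRN.
  rewrite -[X in _ <= X]invrK lef_pV2 ?posrE ?invr_gt0 ?powR_gt0//.
  rewrite -powRN -[2 in leLHS]invrK -powR_inv1// -powRrM mulN1r opprK.
  by apply: ge0_ler_powR; rewrite ?nnegrE//; lra.
have {}E : (\int[prodm leb leb]_p ((w p)%:E * F (Num.sqrt (p.1 ^+ 2 + p.2 ^+ 2))) =
  s^-1%:E * (\int[leb]_z ((pw (-1) z)%:E * F z) *
    \int[prodm leb leb]_p ((w p)%:E * G (Num.sqrt (p.1 ^+ 2 + p.2 ^+ 2))^-1%R)))%E.
  by rewrite -E muleCA -EFinM mulVf ?gt_eqF// mule1.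
rewrite E /C mulrC EFinM -muleA.
apply: lee_wpmul2l; first by rewrite lee_fin invr_ge0 ltW.
rewrite muleC; apply: lee_wpmul2r => //.
by apply: integral_ge0 => x _; rewrite mule_ge0// lee_fin pw_ge0.
Qed.

End power_integrals.

(** * Polar coordinates in hyperbolic space *)

Section hyperbolic_polar.
Context (R : realType).
Notation leb := (leb R).
Notation lebT := (lebT R).

Lemma powR_exp (x r : R) : 0 < x -> x `^ r = expR (r * ln x).
Proof. by move=> x0; rewrite /powR gt_eqF. Qed.

(** The origin is fixed by the dilation by 2, so its mass [I] satisfies [I = 2^m I]; being finite,
    it is zero. *)
Lemma integral_lebT_origin m : (0 < m)%N ->
  (\int[lebT m]_x (if normE x <= 0 then 1%R else 0%R)%:E = 0)%E.
Proof.
move=> m0; set I := (\int[lebT m]_x _)%E.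
have I0 : (0 <= I)%E by apply: integral_ge0 => x _; rewrite lee_fin; case: ifP.
have hi : (I <= \int[lebT m]_x (boxI (-1) 1 x)%:E)%E.
  apply: le_integral_T => x; first by rewrite lee_fin; case: ifP.
  rewrite lee_fin; case: ifP => [nx|_]; last exact: boxI_ge0.
  have n0 : normE x = 0 by apply/eqP; rewrite eq_le nx normE_ge0.
  rewrite boxI_eq1// => i; have := coord_le_sqnormE x i.
  by rewrite -normE_sq n0 => h; apply/andP; split; nra.
rewrite integral_boxI in hi; last lra.
have fin : I \is a fin_num by rewrite ge0_fin_numE// (le_lt_trans hi)// ltry.
have E : (I = (2 ^+ m)%:E * I)%E.
  rewrite {1}/I (@integral_lebT_scale _ _ _ 2)//; last 2 first.
  - by mfun.
  - by move=> x; rewrite lee_fin; case: ifP.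
  congr (_ * _)%E; apply: eq_integral => x _; congr (_%:E).
  by rewrite normE_tscale// pmulr_rle0.
have := I0; rewrite le_eqVlt => /orP[/eqP//|Ipos].
have m2 : 1 < 2 ^+ m :> R by rewrite exprn_egt1// ?lt0n_neq0//; lra.
move: E Ipos; rewrite -(fineK fin) -EFinM lte_fin => -[] E Ipos.
have : 2 ^+ m * fine I = 1 * fine I by rewrite -E mul1r.
by move/(mulIf (lt0r_neq0 Ipos)) => m21; rewrite m21 ltxx in m2.
Qed.

(** The origin has to be discarded in polar coordinates, because [pw] vanishes there while [hdens]
    does not. *)
Lemma eq_integral_lebT_normE m (f g : m.-tuple R -> \bar R) : (0 < m)%N ->
  measurable_fun [set: m.-tuple R] f -> measurable_fun [set: m.-tuple R] g ->
  (forall x, (0 <= f x)%E) -> (forall x, (0 <= g x)%E) ->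
  (forall x, 0 < normE x -> f x = g x) ->
  (\int[lebT m]_x f x = \int[lebT m]_x g x)%E.
Proof.
move=> m0 mf mg f0 g0 fg.
have mN : measurable [set x : m.-tuple R | normE x <= 0].
  have mb : measurable_fun [set: m.-tuple R] (fun x => normE x <= 0) by mfun.
  have := mb measurableT [set true] I; rewrite setTI.
  by congr measurable; apply/seteqP; split => x /=.
apply: ge0_ae_eq_integral => //.
exists [set x | normE x <= 0]; split => //.
- have := integral_lebT_origin m0.
  rewrite (eq_integral (EFin \o \1_[set x : m.-tuple R | normE x <= 0])).
    by rewrite integral_indic// setIT.
  move=> x _ /=; rewrite indicE; congr (_%:E).
  case: ifP => h; first by rewrite mem_set.
  by rewrite memNset//= h.
- move=> x /= /not_implyP[_ h]; rewrite leNgt; apply/negP => x0.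
  by apply: h; exact: fg.
Qed.

Lemma ballsinh_sqrt (r : R) : 0 < r < 1 ->
  (1 + ballsinh r ^+ 2) `^ (- 2^-1) = (1 - r ^+ 2) / (1 + r ^+ 2).
Proof.
move=> /andP[r0 r1]; have h : 0 < 1 - r ^+ 2 by nra.
have h' : 0 < 1 + r ^+ 2 by nra.
have -> : 1 + ballsinh r ^+ 2 = ((1 + r ^+ 2) / (1 - r ^+ 2)) ^+ 2.
  by rewrite /ballsinh; field; rewrite gt_eqF.
rewrite powRN powR12_sqrt ?sqr_ge0// sqrtr_sqr ger0_norm; last by rewrite divr_ge0// ltW.
by rewrite invf_div.
Qed.

(** At distance [d] hyperbolic volume is a multiple of [sinh^(m - 1) d] times the element of [d];
    with [u = sinh d] the latter is [(1 + u^2)^(-1/2) du]. The proof takes Euclidean polar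
    coordinates in the ball and then substitutes [u = ballsinh r]. *)
Lemma hyperbolic_polar m : (0 < m)%N -> exists s : R, 0 < s /\
  forall g : R -> \bar R, measurable_fun [set: R] g -> (forall r, (0 <= g r)%E) ->
  (\int[lebT m]_y ((if inball y then hdens y else 0%R)%:E * g (ballsinh (normE y))) =
   s%:E * \int[leb]_u ((pw (m%:R - 1) u * (1 + u ^+ 2) `^ (- 2^-1))%:E * g u))%E.
Proof.
move=> m0; have [s [s0 sE]] := @polar R m m0.
exists s; split => // g mg g0.
pose F (r : R) := ((if r < 1 then pw m%:R r * (2 / (1 - r ^+ 2)) ^+ m else 0)%:E *
  g (ballsinh r))%E.
have mF : measurable_fun [set: R] F by rewrite /F /ballsinh; mfun.
have F0 r : (0 <= F r)%E.
  rewrite mule_ge0// lee_fin; case: ifP => // r1.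
  have [r0|r0] := ltP 0 r; last by rewrite /pw ltNge r0 mul0r.
  by rewrite mulr_ge0 ?pw_ge0// exprn_ge0// divr_ge0//; nra.
transitivity (\int[lebT m]_x ((pw (- m%:R) (normE x))%:E * F (normE x)))%E.
  apply: eq_integral_lebT_normE => //.
  - by rewrite /inball /hdens /ballsinh; mfun.
  - by mfun.
  - move=> y; rewrite mule_ge0// lee_fin /inball /hdens; case: ifP => // h.
    by rewrite exprn_ge0// divr_ge0// subr_ge0 ltW.
  - by move=> y; rewrite mule_ge0// lee_fin pw_ge0.
  move=> y y0; rewrite /F muleA -EFinM /inball /hdens -normE_sq.
  have -> : (normE y ^+ 2 < 1) = (normE y < 1).
    by rewrite expr_lt1// ?normE_ge0.
  case: ifP => _; last by rewrite mulr0.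
  rewrite mulrA pwD addNr pwE// powRr0 mul1r.
  by congr (_ * _)%E.
rewrite sE//; congr (_ * _)%E.
pose h (u : R) := ((pw (m%:R - 1) u * (1 + u ^+ 2) `^ (- 2^-1))%:E * g u)%E.
have mh : measurable_fun [set: R] h by rewrite /h; mfun.
have h0 u : (0 <= h u)%E.
  by rewrite mule_ge0// lee_fin mulr_ge0 ?pw_ge0 ?powR_ge0.
rewrite -/(h _) [RHS](integral_leb_ballsinh mh h0).
apply: eq_integral => r _; rewrite /F /h muleA -EFinM [RHS]muleAC -EFinM.
congr (_ * _)%E; congr (_%:E).
have [r0|r0] := ltP 0 r; last first.
  rewrite {1}/pw ltNge r0 mul0r; case: ifP => [/andP[r1 _]|_]; last by rewrite mulr0.
  rewrite (_ : pw _ (ballsinh r) = 0) ?mul0r// /pw ltNge.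
  rewrite (_ : ballsinh r <= 0)// /ballsinh.
  by rewrite ler_pdivrMr; nra.
rewrite (_ : -1 < r) /=; last lra.
case: ifP => r1; last by rewrite !mulr0.
have r01 : 0 < r < 1 by rewrite r0 r1.
have q0 : 0 < 1 - r ^+ 2 by nra.
have q1 : 0 < 1 + r ^+ 2 by nra.
rewrite (ballsinh_sqrt r01) !pwE//; last by rewrite /ballsinh divr_gt0//; lra.
rewrite powR_inv1 ?ltW// powR_mulrn ?ltW//.
have b0 : 0 < ballsinh r by rewrite /ballsinh divr_gt0//; lra.
have -> : ballsinh r `^ (m%:R - 1) = ballsinh r ^+ m / ballsinh r.
  by rewrite powRB ?(gt_eqF b0) ?implybT// powRr1 ?ltW// powR_mulrn// ltW.
rewrite [in RHS]/ballsinh -!mulrA -exprMn !mulrA.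
rewrite /ballsinh' (_ : 2 * r / (1 - r ^+ 2) = r * (2 / (1 - r ^+ 2))); last by ring.
rewrite -[in LHS]mulrA; set e := (_ ^+ m).
by field; rewrite !gt_eqF.
Qed.

End hyperbolic_polar.

(** * The one-variable estimate *)

Section radial_estimate.
Context (R : realType).
Notation leb := (leb R).

(* The exponent inequality behind the Schur test. Here [a], [b], [c], [d] stand for
   [ln t], [ln X], [ln (1 + t^2) / 2] and [ln (1 + X^2) / 2]. *)
Lemma schur_exponent (n k a1 a2 b1 b2 p : R) : 1 <= k -> a1 + a2 > k - n ->
  1 <= p -> p <= (a1 + a2 + n + 1) / (k + 1) -> b1 > k - n ->
  b2 - a2 <= a1 - b1 -> a1 - b1 <= k * (p - 1) ->
  exists2 del : R, 0 < del & forall a b c d : R,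
    0 <= c -> c <= d -> a <= b -> b <= d -> d - b <= c - a ->
    (b1 + n - k - 1) * a + (b2 + (k - 1) * (1 - p)) * c - p * d
      + del * (1 - p) * a + (k + del) * (p - 1) * b
    <= (del - 1) * a - (del + k) * b + (n + a1) * b + (a2 - 1) * d.
Proof.
move=> k1 h1 p1 hp hb1 h2 h3.
rewrite ler_pdivlMr in hp; last lra.
pose g := b1 + n - k; pose A := b2 + (k - 1) * (1 - p).
pose e1 := k * (p - 1) + b1 - a1; pose eb := (k - 1) * (p - 1) + b1 - a1 - a2.
have g0 : 0 < g by rewrite /g; lra.
(* For [p > 1] the strict inequality comes from the upper bound on [p]; for [p = 1] it is
   [a1 + a2 > k - n]. *)
have ebg : eb < g by rewrite /eb /g; nra.
have ebA : eb <= - A by rewrite /eb /A; nra.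
(* [th] is any number between [eb] and [- A], and [tp] is its positive part. Keeping [tp] below [g]
   is what makes [del = (g - tp) / p] positive. *)
have [th [tp [tp0 thtp tpg thA ebth]]] : exists th tp : R,
    [/\ 0 <= tp, th <= tp, tp < g, A <= - th & eb <= th].
  have [A0|A0] := leP 0 A.
    by exists (- A), 0; split; lra.
  have [e0|e0] := leP 0 eb.
    by exists eb, eb; split; lra.
  by exists 0, 0; split; lra.
pose del := (g - tp) / p.
exists del; first by rewrite /del divr_gt0//; lra.
move=> a b c d c0 cd ab bd dbca.
have Edel : del * p = g - tp by rewrite /del mulfVK// gt_eqF//; lra.
have Ea : del * p * a = (g - tp) * a by rewrite Edel.
have Eb : del * p * b = (g - tp) * b by rewrite Edel.
(* With this [del] the left side minus the right side is [tp a + A c + (e1 - tp) b - (p - 1 + a2)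
   d]. Replacing [e1 b] by [e1 d] leaves [tp (a - b) + A c + eb d]. This is at most
   [tp (a - b) + th (d - c)], hence at most [tp ((d - b) - (c - a)) <= 0]. *)
have i1 : A * c <= - th * c by rewrite ler_wpM2r.
have i2 : e1 * b <= e1 * d by rewrite ler_wpM2l// /e1; lra.
have i3 : eb * d <= th * d by rewrite ler_wpM2r//; lra.
have i4 : th * (d - c) <= tp * (d - c) by rewrite ler_wpM2r//; lra.
have i5 : tp * (d - b) <= tp * (c - a) by rewrite ler_wpM2l.
move: i1 i2 i3 i4 i5 Ea Eb; rewrite /A /e1 /eb /g => i1 i2 i3 i4 i5 Ea Eb.
lra.
Qed.

Lemma ln_sqr (x : R) : 0 < x -> ln (x ^+ 2) = 2 * ln x.
Proof. by move=> x0; rewrite expr2 lnM ?posrE//; ring. Qed.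

Lemma ln_sqrt (x : R) : 0 < x -> ln (Num.sqrt x) = ln x / 2.
Proof. by move=> x0; rewrite -powR12_sqrt ?ltW// ln_powR mulrC. Qed.

Definition sinhdist (t u : R) : R := Num.sqrt (t ^+ 2 + (1 + t ^+ 2) * u ^+ 2).

Definition schur_weight (k del t u : R) : R :=
  t `^ del * sinhdist t u `^ (- (k + del)) * (1 + t ^+ 2) `^ (k / 2) *
  (1 + u ^+ 2) `^ 2^-1.

Let sq1_gt0 (x : R) : 0 < 1 + x ^+ 2. Proof. by have := sqr_ge0 x; lra. Qed.

Lemma sinhdist_gt0 (t u : R) : 0 < t -> 0 < sinhdist t u.
Proof.
move=> t0; rewrite sqrtr_gt0 ltr_pwDl ?exprn_gt0//.
by rewrite mulr_ge0 ?sqr_ge0// ltW.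
Qed.

Lemma schur_weight_gt0 (k del t u : R) : 0 < t -> 0 < schur_weight k del t u.
Proof. by move=> t0; rewrite !mulr_gt0 ?powR_gt0 ?sinhdist_gt0. Qed.

Lemma measurable_fun_sinhdist d (T : measurableType d) (f g : T -> R) :
  measurable_fun [set: T] f -> measurable_fun [set: T] g ->
  measurable_fun [set: T] (fun x => sinhdist (f x) (g x)).
Proof. by move=> mf mg; rewrite /sinhdist; mfun. Qed.

Lemma measurable_fun_schur_weight d (T : measurableType d) k del (f g : T -> R) :
  measurable_fun [set: T] f -> measurable_fun [set: T] g ->
  measurable_fun [set: T] (fun x => schur_weight k del (f x) (g x)).
Proof. by move=> mf mg; rewrite /schur_weight /sinhdist; mfun. Qed.

(** With [v = c u] and [c = sqrt (1 + t^2) / t] one has [X = t sqrt (1 + v^2)]. All powers of [t]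
    then cancel, and the integrand becomes [v^(k - 1) (1 + v^2)^(-(k + del) / 2)]. *)
Lemma integral_schur_weight (k del t : R) : 0 < k -> 0 < del -> 0 < t ->
  (\int[leb]_u (pw (k - 1) u * (1 + u ^+ 2) `^ (- 2^-1) * schur_weight k del t u)%:E
   <= (k^-1 + del^-1)%:E)%E.
Proof.
move=> k0 d0 t0; have [c cE] : exists c, c = Num.sqrt (1 + t ^+ 2) / t by exists (Num.sqrt (1 + t ^+ 2) / t).
have c0 : 0 < c by rewrite cE divr_gt0// sqrtr_gt0.
pose h (v : R) := (pw (k - 1) v * (1 + v ^+ 2) `^ (- ((k + del) / 2)))%:E.
have mh : measurable_fun [set: R] h by rewrite /h; mfun.
have h0 v : (0 <= h v)%E by rewrite lee_fin mulr_ge0 ?pw_ge0 ?powR_ge0.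
have -> : (\int[leb]_u (pw (k - 1) u * (1 + u ^+ 2) `^ (- 2^-1) *
    schur_weight k del t u)%:E = \int[leb]_v h v)%E.
  have mhc : measurable_fun [set: R] (fun v => h (c * v)).
    by apply: (measurableT_comp mh); mfun.
  rewrite [RHS](integral_leb_scale c0 mh h0).
  rewrite -(ge0_integralZl_EFin _ measurableT _ mhc (ltW c0)); last by move=> v _; exact: h0.
  apply: eq_integral => u _; rewrite /h -EFinM; congr (_%:E).
  have [u0|u0] := ltP 0 u; last first.
    by rewrite /pw pmulr_rgt0// ltNge u0 /= !mul0r mulr0.
  rewrite !pwE ?mulr_gt0// /schur_weight.
  have X0 := sinhdist_gt0 u t0.
  have lX : ln (sinhdist t u) = ln t + ln (1 + (c * u) ^+ 2) / 2.
    have -> : sinhdist t u = t * Num.sqrt (1 + (c * u) ^+ 2).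
      rewrite /sinhdist exprMn cE expr_div_n sqr_sqrtr ?ltW//.
      have -> : t ^+ 2 + (1 + t ^+ 2) * u ^+ 2 =
          t ^+ 2 * (1 + (1 + t ^+ 2) / t ^+ 2 * u ^+ 2).
        by field; rewrite gt_eqF.
      by rewrite sqrtrM ?sqr_ge0// sqrtr_sqr gtr0_norm.
    by rewrite lnM ?posrE ?sqrtr_gt0// ln_sqrt.
  have lc : ln c = ln (1 + t ^+ 2) / 2 - ln t.
    by rewrite cE ln_div ?posrE ?sqrtr_gt0// ln_sqrt.
  rewrite -{1}[c]lnK ?posrE// !powR_exp ?mulr_gt0 ?sq1_gt0// -!expRD lnM ?posrE//.
  by congr expR; rewrite lX lc; ring.
(* Below 1 the factor with [1 + v^2] is at most 1; above 1 it is at most [v^(-(k + del))], which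
   leaves [v^(- del - 1)]. *)
rewrite EFinD -integral_powR_head// -integral_powR_tail//.
rewrite -ge0_integralD//; last 4 first.
- by move=> x _; rewrite lee_fin; case: ifP => // _; exact: pw_ge0.
- by mfun.
- by move=> x _; rewrite lee_fin; case: ifP => // _; exact: pw_ge0.
- by mfun.
apply: le_integral_T => // v; rewrite -EFinD lee_fin.
have [v0|v0] := ltP 0 v; last first.
  by rewrite /pw ltNge v0 /= mul0r; case: ifP; case: ifP.
have [v1|v1] := leP v 1.
  apply: (@le_trans _ _ (pw (k - 1) v)); last first.
    by rewrite lerDl; case: ifP => // _; exact: pw_ge0.
  rewrite ler_piMr ?pw_ge0// powR_exp// -[leRHS]expR0 ler_expR.
  have : 0 <= ln (1 + v ^+ 2) by rewrite ln_ge0// lerDl sqr_ge0.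
  by nra.
rewrite (ltW v1) add0r !pwE// !powR_exp ?sq1_gt0// -expRD ler_expR.
have : ln (v ^+ 2) <= ln (1 + v ^+ 2) by rewrite ler_ln ?posrE ?exprn_gt0// lerDr.
by rewrite ln_sqr//; nra.
Qed.

(** For fixed [t] the substitution [z = c u] in [plane_radial_le] turns both sides into integrals
    over [u], and the integrands compare pointwise: in logarithms this is [schur_exponent]. *)
Lemma radial_estimate (n k a1 a2 b1 b2 p : R) : 1 <= k -> a1 + a2 > k - n ->
  1 <= p -> p <= (a1 + a2 + n + 1) / (k + 1) -> b1 > k - n ->
  b2 - a2 <= a1 - b1 -> a1 - b1 <= k * (p - 1) ->
  exists del C : R, [/\ 0 < del, 0 < C & forall F : R -> \bar R,
    measurable_fun [set: R] F -> (forall r, (0 <= F r)%E) ->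
    (\int[leb]_t ((pw (b1 + n - k - 1) t * (1 + t ^+ 2) `^ ((b2 + k - 1) / 2))%:E *
       \int[leb]_u ((pw (k - 1) u * (1 + u ^+ 2) `^ (- 2^-1) *
         schur_weight k del t u `^ (1 - p))%:E * F (sinhdist t u))) <=
     C%:E * \int[leb]_x ((pw (n + a1 - 1) x * (1 + x ^+ 2) `^ ((a2 - 1) / 2))%:E * F x))%E].
Proof.
move=> k1 h1 p1 hp hb1 h2 h3.
have [del d0 hexp] := schur_exponent k1 h1 p1 hp hb1 h2 h3.
have k0 : 0 < k by lra.
have [C [C0 hC]] := @plane_radial_le R del k d0 k0.
exists del, C; split => // F mF F0.
(* [v] carries one power of [x] more than the weight of the norm; the measure [dr / r] takes it
   back. *)
pose v (x : R) := pw (n + a1) x * (1 + x ^+ 2) `^ ((a2 - 1) / 2).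
have v0 x : 0 <= v x by rewrite mulr_ge0 ?pw_ge0 ?powR_ge0.
have mv d (T : measurableType d) (f : T -> R) : measurable_fun [set: T] f ->
    measurable_fun [set: T] (fun x => v (f x)) by move=> mf; rewrite /v; mfun.
pose G (x : R) := ((v x)%:E * F x)%E.
have mG : measurable_fun [set: R] G.
  by apply: emeasurable_funM => //; apply: measurable_fun_EFin; apply: mv; mfun.
have G0 x : (0 <= G x)%E by rewrite mule_ge0// lee_fin.
have -> : (\int[leb]_x ((pw (n + a1 - 1) x * (1 + x ^+ 2) `^ ((a2 - 1) / 2))%:E * F x) =
    \int[leb]_r ((pw (-1) r)%:E * G r))%E.
  apply: eq_integral => x _; rewrite /G muleA -EFinM /v mulrA pwD.
  by rewrite [- 1 + _]addrC.
apply: le_trans (hC G mG G0).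
apply: le_integral_T => t.
  rewrite mule_ge0 ?lee_fin ?mulr_ge0 ?pw_ge0 ?powR_ge0// integral_ge0// => u _.
  by rewrite mule_ge0// lee_fin !mulr_ge0 ?pw_ge0 ?powR_ge0.
have [t0|t0] := ltP 0 t; last first.
  rewrite {1}/pw ltNge t0 mul0r mul0e integral_ge0// => z _.
  by rewrite mule_ge0// lee_fin !mulr_ge0 ?pw_ge0.
have [c cE] : exists c, c = Num.sqrt (1 + t ^+ 2) by exists (Num.sqrt (1 + t ^+ 2)).
have c0 : 0 < c by rewrite cE sqrtr_gt0.
have mL : measurable_fun [set: R] (fun u => ((pw (k - 1) u * (1 + u ^+ 2) `^ (- 2^-1) *
    schur_weight k del t u `^ (1 - p))%:E * F (sinhdist t u))%E).
  apply: emeasurable_funM.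
    apply: measurable_fun_EFin; apply: measurable_funM; first by mfun.
    by apply: measurable_fun_powR; apply: measurable_fun_schur_weight; mfun.
  by apply: (measurableT_comp mF); apply: measurable_fun_sinhdist; mfun.
have mz (f : R -> R) : measurable_fun [set: R] f ->
    measurable_fun [set: R] (fun z => ((pw (del - 1) t * pw (k - 1) (f z) *
      pw (- (del + k)) (Num.sqrt (t ^+ 2 + f z ^+ 2)))%:E *
      G (Num.sqrt (t ^+ 2 + f z ^+ 2)))%E).
  move=> mf; apply: emeasurable_funM; first by mfun.
  by apply: (measurableT_comp mG); mfun.
have z0 z : (0 <= (pw (del - 1) t * pw (k - 1) z *
      pw (- (del + k)) (Num.sqrt (t ^+ 2 + z ^+ 2)))%:E *
      G (Num.sqrt (t ^+ 2 + z ^+ 2)))%E.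
  by rewrite mule_ge0// lee_fin !mulr_ge0 ?pw_ge0.
have mid : measurable_fun [set: R] (fun z : R => z) by mfun.
have mcz : measurable_fun [set: R] (fun z : R => c * z) by mfun.
rewrite [leRHS](integral_leb_scale c0 (mz _ mid) z0).
rewrite -(ge0_integralZl_EFin _ measurableT _ (mz _ mcz) (ltW c0)); last first.
  by move=> z _; exact: z0.
rewrite -(ge0_integralZl_EFin _ measurableT _ mL); last 2 first.
- by move=> z _; rewrite mule_ge0// lee_fin !mulr_ge0 ?pw_ge0 ?powR_ge0.
- by rewrite mulr_ge0 ?pw_ge0 ?powR_ge0.
apply: le_integral_T => u.
  by rewrite !mule_ge0// lee_fin !mulr_ge0 ?pw_ge0 ?powR_ge0.
have -> : Num.sqrt (t ^+ 2 + (c * u) ^+ 2) = sinhdist t u.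
  by rewrite exprMn cE sqr_sqrtr ?ltW.
rewrite /G !muleA -!EFinM; apply: lee_wpmul2r => //; rewrite lee_fin /v.
have [u0|u0] := ltP 0 u; last first.
  by rewrite /pw pmulr_rgt0// (ltNge 0 u) u0 /= !(mul0r, mulr0).
have X0 := sinhdist_gt0 u t0.
have XE : sinhdist t u ^+ 2 = t ^+ 2 + (1 + t ^+ 2) * u ^+ 2.
  by rewrite sqr_sqrtr// addr_ge0 ?sqr_ge0// mulr_ge0 ?sqr_ge0// ltW.
have XE1 : 1 + sinhdist t u ^+ 2 = (1 + t ^+ 2) * (1 + u ^+ 2) by rewrite XE; ring.
have tX2 : t ^+ 2 <= sinhdist t u ^+ 2.
  by rewrite XE lerDl mulr_ge0 ?sqr_ge0// ltW.
have tX : t <= sinhdist t u by rewrite -(ler_pXn2r (n := 2)) ?nnegrE ?(ltW t0) ?(ltW X0).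
have lX1 : ln (1 + sinhdist t u ^+ 2) = ln (1 + t ^+ 2) + ln (1 + u ^+ 2).
  by rewrite XE1 lnM ?posrE.
have lc : ln c = ln (1 + t ^+ 2) / 2 by rewrite cE ln_sqrt.
have w1 : ln (schur_weight k del t u) = del * ln t - (k + del) * ln (sinhdist t u) +
    k / 2 * ln (1 + t ^+ 2) + ln (1 + u ^+ 2) / 2.
  by rewrite /schur_weight !lnM ?posrE ?mulr_gt0 ?powR_gt0// !ln_powR; ring.
have t2 := ln_sqr t0; have X2 := ln_sqr X0.
have lnt0 : 0 <= ln (1 + t ^+ 2) by rewrite ln_ge0// lerDl ltW// exprn_gt0.
have lnu0 : 0 <= ln (1 + u ^+ 2) by rewrite ln_ge0// lerDl ltW// exprn_gt0.
have lntX : ln t <= ln (sinhdist t u) by rewrite ler_ln ?posrE.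
have lnX1 : ln (sinhdist t u ^+ 2) <= ln (1 + sinhdist t u ^+ 2).
  by rewrite ler_ln ?posrE ?sq1_gt0 ?exprn_gt0// lerDr.
(* This is the condition [d - b <= c - a]: the function [(1 + x^2) / x^2] decreases and [t <= X]. *)
have lncross : ln (1 + sinhdist t u ^+ 2) + ln (t ^+ 2) <=
    ln (1 + t ^+ 2) + ln (sinhdist t u ^+ 2).
  rewrite -!lnM ?posrE ?sq1_gt0 ?exprn_gt0// ler_ln ?posrE ?mulr_gt0 ?sq1_gt0 ?exprn_gt0//.
  by rewrite !mulrDl !mul1r [_ * t ^+ 2]mulrC lerD2r.
have key := hexp (ln t) (ln (sinhdist t u)) (ln (1 + t ^+ 2) / 2)
  (ln (1 + sinhdist t u ^+ 2) / 2) ltac:(lra) ltac:(lra) lntX ltac:(lra) ltac:(lra).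
rewrite !pwE ?mulr_gt0// -{1}[c]lnK ?posrE//.
have sw0 := schur_weight_gt0 k del u t0.
rewrite !powR_exp ?sw0 ?mulr_gt0 ?sq1_gt0//.
rewrite -!expRD ler_expR w1 lnM ?posrE// lc.
by move: key; rewrite lX1 => key; lra.
Qed.

End radial_estimate.

(** * Hoelder's inequality with a weight *)

Section weighted_hoelder.
Context (R : realType).

(** The convex function [r^p / p] lies above its tangent at 1. For [p > 1] this is Young's
    inequality with second factor 1; the conjugate exponent forces [p = 1] apart. *)
Lemma tangent_powR (r p : R) : 0 <= r -> 1 <= p -> r <= r `^ p / p + (1 - p^-1).
Proof.
move=> r0; rewrite le_eqVlt => /orP[/eqP <-|p1].
  by rewrite invr1 subrr addr0 mulr1 powRr1.
have pq : p^-1 + (p / (p - 1))^-1 = 1 by rewrite invf_div; field; rewrite !gt_eqF//; lra.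
have := @conjugate_powR R r 1 p (p / (p - 1)) r0 ler01 ltac:(lra).
rewrite mulr1 powR1 mul1r => /(_ _ pq) h.
apply: le_trans (h _) _; first by rewrite divr_gt0//; lra.
by move: pq; rewrite lerD2l; set q := (p / (p - 1))^-1; clearbody q; lra.
Qed.

(* Young's inequality with the optimal parameter, which covers [p = 1] uniformly. *)
Lemma weighted_hoelder d (T : measurableType d) (m : {measure set T -> \bar R})
  (u N w : T -> R) (p A : R) : 1 <= p -> 0 < A ->
  measurable_fun [set: T] u -> measurable_fun [set: T] N -> measurable_fun [set: T] w ->
  (forall x, 0 <= u x) -> (forall x, 0 <= N x) -> (forall x, 0 <= w x) ->
  (forall x, w x != 0 -> 0 < N x) ->
  (\int[m]_x (N x * w x)%:E <= A%:E)%E ->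
  (poweR (\int[m]_x (u x * w x)%:E) p <=
   (A `^ (p - 1))%:E * \int[m]_x (u x `^ p * N x `^ (1 - p) * w x)%:E)%E.
Proof.
move=> p1 A0 mu mN mw u0 N0 w0 wN hA.
have p0 : 0 < p by lra.
set B := (\int[m]_x (u x `^ p * _ * _)%:E)%E.
have B0 : (0 <= B)%E.
  by apply: integral_ge0 => x _; rewrite lee_fin !mulr_ge0 ?powR_ge0.
have [->|Boo] := eqVneq B +oo%E.
  by rewrite gt0_muley ?leey// lte_fin powR_gt0.
have Bfin : B \is a fin_num by rewrite ge0_fin_numE// ltey.
have [b bE] : exists b, B = b%:E by exists (fine B); rewrite fineK.
have b0 : 0 <= b by rewrite -lee_fin -bE.
set S := (\int[m]_x (u x * w x)%:E)%E.
have S0 : (0 <= S)%E by apply: integral_ge0 => x _; rewrite lee_fin mulr_ge0.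
(* Taking [b' > b] keeps the parameter positive even when [B = 0]; [b'] tends to [b] at the end. *)
have key (b' : R) : b < b' -> (S <= (b' `^ p^-1 * A `^ (1 - p^-1))%:E)%E.
  move=> bb'; have b'0 : 0 < b' by lra.
  (* The minimiser over [l] of [l^(1 - p) b' / p + (1 - 1 / p) l A], which is the integrated form of
     the pointwise bound. *)
  pose l := (b' / A) `^ p^-1.
  have l0 : 0 < l by rewrite powR_gt0 ?divr_gt0.
  have c10 : 0 <= l `^ (1 - p) / p by rewrite divr_ge0 ?powR_ge0// ltW.
  have c20 : 0 <= (1 - p^-1) * l.
    by rewrite mulr_ge0 ?(ltW l0)// subr_ge0 invf_le1.
  apply: (@le_trans _ _ (\int[m]_x ((l `^ (1 - p) / p)%:E * (u x `^ p * N x `^ (1 - p) * w x)%:E +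
     ((1 - p^-1) * l)%:E * (N x * w x)%:E))%E).
    apply: le_integral_T => x; first by rewrite lee_fin mulr_ge0.
    rewrite -!EFinM -EFinD lee_fin.
    have [->|/wN Nx] := eqVneq (w x) 0; first by rewrite !mulr0 addr0.
    rewrite [leRHS](_ : _ = (l `^ (1 - p) / p * (u x `^ p * N x `^ (1 - p)) +
      (1 - p^-1) * l * N x) * w x); last by ring.
    rewrite ler_wpM2r//.
    have Nl : 0 < N x * l by rewrite mulr_gt0.
    have := ler_wpM2l (ltW Nl) (tangent_powR (divr_ge0 (u0 x) (ltW Nl)) p1).
    rewrite [X in X <= _ -> _]mulrCA mulfV ?gt_eqF// mulr1 => /le_trans; apply.
    rewrite le_eqVlt; apply/orP; left; apply/eqP.
    rewrite mulrDr; congr (_ + _); last by ring.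
    rewrite powRM ?u0 ?invr_ge0 ?(ltW Nl)// -[(N x * l)^-1]powR_inv1 ?(ltW Nl)//.
    rewrite -powRrM mulN1r powRM ?(ltW Nx) ?(ltW l0)//.
    have E (y : R) : 0 < y -> y * y `^ (- p) = y `^ (1 - p).
      by move=> y0; rewrite powRN powRB ?(gt_eqF y0) ?implybT// powRr1 ?ltW.
    by rewrite -!E//; ring.
  rewrite ge0_integralD//; last 4 first.
  - by move=> x _; rewrite -EFinM lee_fin !mulr_ge0 ?powR_ge0 ?invr_ge0// ltW.
  - by mfun.
  - by move=> x _; rewrite -EFinM lee_fin mulr_ge0// mulr_ge0.
  - by mfun.
  rewrite !ge0_integralZl_EFin//; last 4 first.
  - by move=> x _; rewrite lee_fin mulr_ge0.
  - by mfun.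
  - by move=> x _; rewrite lee_fin !mulr_ge0 ?powR_ge0.
  - by mfun.
  rewrite -/B bE.
  apply: (@le_trans _ _ ((l `^ (1 - p) / p)%:E * b'%:E + ((1 - p^-1) * l)%:E * A%:E)%E).
    apply: leeD; apply: lee_wpmul2l; rewrite ?lee_fin// ltW//.
  rewrite -!EFinM -EFinD lee_fin le_eqVlt; apply/orP; left; apply/eqP.
  have -> : l `^ (1 - p) = l * (b' / A)^-1.
    rewrite powRD ?powRr1 ?(ltW l0)//; last by rewrite (gt_eqF l0) implybT.
    rewrite powRN /l -powRrM mulVf ?gt_eqF// powRr1// divr_ge0// ltW//.
  have lE : l * A = b' `^ p^-1 * A `^ (1 - p^-1).
    rewrite /l powRM ?invr_ge0 ?ltW// -[A^-1]powR_inv1 ?ltW// -powRrM mulN1r.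
    rewrite -mulrA -{2}[A]powRr1 ?ltW// -powRD; last by rewrite (gt_eqF A0) implybT.
    by rewrite [- _ + _]addrC.
  rewrite -lE; field.
  by rewrite !gt_eqF.
have [s sE] : exists s, S = s%:E.
  exists (fine S); rewrite fineK// ge0_fin_numE//.
  by apply: le_lt_trans (key (b + 1) _) _; rewrite ?ltry// ltrDl.
have s0 : 0 <= s by rewrite -lee_fin -sE.
rewrite bE sE poweR_EFin -EFinM lee_fin mulrC -ler_pdivrMr ?powR_gt0//.
apply/ler_addgt0Pl => e e0; rewrite [e + b]addrC.
have := key (b + e); rewrite ltrDl sE lee_fin => /(_ e0) hs.
rewrite ler_pdivrMr ?powR_gt0//.
have := ge0_ler_powR (ltW p0) s0 _ hs; rewrite nnegrE mulr_ge0 ?powR_ge0// => /(_ isT).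
move=> /le_trans; apply.
rewrite powRM ?powR_ge0// -!powRrM mulVf ?gt_eqF// powRr1; last lra.
by rewrite mulrBl mul1r mulVf ?gt_eqF.
Qed.

End weighted_hoelder.

(** * Haar measure on the rotation group and spherical means *)

Section haar.
Context (R : realType) (n : nat).
Local Notation mats := (n.-tuple (n.-tuple R)).
Implicit Types (Q M : 'M[R]_n) (x : n.-tuple R).

Lemma tup_ofK : cancel (@tup_of R n) (@mx_of R n).
Proof. by move=> M; apply/matrixP => i j; rewrite mxE tnth_mktuple coord_mktuple. Qed.

Lemma SOn_tr Q : SOn Q -> SOn Q^T.
Proof. by move=> [QQ dQ]; split; [rewrite trmxK; exact: mulmx1C|rewrite det_tr]. Qed.

Lemma measurable_fun_mx_of d (T : measurableType d) (g : T -> mats) (i j : 'I_n) :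
  measurable_fun [set: T] g -> measurable_fun [set: T] (fun t => mx_of (g t) i j).
Proof.
move=> mg; rewrite (_ : (fun t => _) = (fun t => coord (tnth (g t) i) j)).
  apply: measurable_fun_coord.
  by apply: (measurableT_comp (measurable_tnth i)).
by apply/funext => t; rewrite mxE.
Qed.

Lemma measurable_fun_tup_of d (T : measurableType d) (g : T -> 'M[R]_n) :
  (forall i j, measurable_fun [set: T] (fun t => g t i j)) ->
  measurable_fun [set: T] (fun t => tup_of (g t)).
Proof.
by move=> mg; apply: measurable_fun_mktuple => i; apply: measurable_fun_mktuple => j.
Qed.

Lemma measurable_fun_mulmx d (T : measurableType d) (g h : T -> 'M[R]_n) i j :
  (forall i j, measurable_fun [set: T] (fun t => g t i j)) ->
  (forall i j, measurable_fun [set: T] (fun t => h t i j)) ->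
  measurable_fun [set: T] (fun t => (g t *m h t) i j).
Proof.
move=> mg mh.
rewrite (_ : (fun t => _) = (fun t => \sum_l g t i l * h t l j)).
  by apply: measurable_sum => l; apply: measurable_funM.
by apply/funext => t; rewrite mxE.
Qed.

(** The defining equations are gathered into one sum of squares, so the set is the preimage of 0
    under a single measurable function. *)
Lemma measurable_SOn : measurable (@mx_of R n @^-1` @SOn R n).
Proof.
pose h (G : mats) := \sum_(i < n) \sum_(j < n)
  ((mx_of G *m (mx_of G)^T) i j - (1%:M : 'M[R]_n) i j) ^+ 2 + (\det (mx_of G) - 1) ^+ 2.
have mh : measurable_fun [set: mats] h.
  apply: measurable_funD.
    apply: measurable_sum => i; apply: measurable_sum => j; apply: measurable_funX.
    apply: measurable_funB => //; apply: measurable_fun_mulmx => a b.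
      exact: measurable_fun_mx_of.
    under eq_fun do rewrite mxE.
    exact: measurable_fun_mx_of.
  apply: measurable_funX; apply: measurable_funB => //.
  apply: measurable_sum => s; apply: measurable_funM => //.
  by apply: measurable_prod => i _; exact: measurable_fun_mx_of.
have := mh measurableT [set 0] (measurable_set1 0); rewrite setTI.
congr measurable; apply/seteqP; split => G /=; rewrite /h.
  have s0 : 0 <= \sum_(i < n) \sum_(j < n)
      ((mx_of G *m (mx_of G)^T) i j - (1%:M : 'M[R]_n) i j) ^+ 2.
    by apply: sumr_ge0 => i _; apply: sumr_ge0 => j _; exact: sqr_ge0.
  move/eqP; rewrite paddr_eq0 ?sqr_ge0// => /andP[/eqP s1].
  rewrite sqrf_eq0 subr_eq0 => /eqP dG; split => //.
  apply/matrixP => i j; apply/eqP; rewrite -subr_eq0 -sqrf_eq0.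
  have row0 : \sum_(l < n) ((mx_of G *m (mx_of G)^T) i l - (1%:M : 'M[R]_n) i l) ^+ 2 = 0.
    apply: (psumr_eq0P _ s1) => // l _.
    by apply: sumr_ge0 => l' _; exact: sqr_ge0.
  by apply/eqP; apply: (psumr_eq0P _ row0) => // l _; exact: sqr_ge0.
move=> [-> ->]; rewrite subrr expr0n/= addr0.
by apply: big1 => i _; apply: big1 => j _; rewrite subrr expr0n.
Qed.

Variable mu : probability mats R.
Hypothesis haar : is_Haar_SO mu.
Implicit Types F : mats -> \bar R.

Lemma haar_ae F1 F2 : measurable_fun [set: mats] F1 -> measurable_fun [set: mats] F2 ->
  (forall G, (0 <= F1 G)%E) -> (forall G, (0 <= F2 G)%E) ->
  (forall G, SOn (mx_of G) -> F1 G = F2 G) ->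
  (\int[mu]_G F1 G = \int[mu]_G F2 G)%E.
Proof.
move=> m1 m2 F10 F20 F12; apply: ge0_ae_eq_integral => //.
exists (@mx_of R n @^-1` (~` @SOn R n)); split.
- by rewrite -preimage_setC; apply: measurableC; exact: measurable_SOn.
- exact: haar.1.
- by move=> G /= /not_implyP[_ h] /F12.
Qed.

Let measurable_lmul Q : measurable_fun [set: mats] (fun G => tup_of (Q *m mx_of G)).
Proof.
apply: measurable_fun_tup_of => i j; apply: measurable_fun_mulmx => a b; first by mfun.
exact: measurable_fun_mx_of.
Qed.

Lemma haar_left Q F : SOn Q -> measurable_fun [set: mats] F -> (forall G, (0 <= F G)%E) ->
  (\int[mu]_G F (tup_of (Q *m mx_of G)) = \int[mu]_G F G)%E.
Proof.
move=> SQ mF F0.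
pose pf0 : {measure set mats -> \bar R} :=
  pushforward mu (fun G => tup_of (Q *m mx_of G)).
pose pf := pf0 (measurable_lmul Q).
rewrite -(@ge0_integral_pushforward _ _ _ _ _ _ (measurable_lmul Q) mu setT F)//.
by apply: (@eq_measure_integral _ _ _ setT mu pf) => A mA _; exact: haar.2.
Qed.

Let mtrT : measurable_fun [set: mats] (fun G => tup_of (mx_of G)^T).
Proof.
apply: measurable_fun_tup_of => i j; under eq_fun do rewrite mxE.
exact: measurable_fun_mx_of.
Qed.

(** Unimodularity of a compact group: integrate [F (G^T H)] over both variables. Left invariance in
    [G] produces the transposed integral, left invariance in [H] the original one, and [mu] has mass
    1. *)
Lemma haar_tr F : measurable_fun [set: mats] F -> (forall G, (0 <= F G)%E) ->
  (\int[mu]_G F (tup_of (mx_of G)^T) = \int[mu]_G F G)%E.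
Proof.
move=> mF F0.
have mF2 (g h : mats * mats -> 'M[R]_n) :
    (forall i j, measurable_fun [set: mats * mats] (fun p => g p i j)) ->
    (forall i j, measurable_fun [set: mats * mats] (fun p => h p i j)) ->
    measurable_fun [set: mats * mats] (fun p => F (tup_of (g p *m h p))).
  move=> mg mh; apply: (measurableT_comp mF); apply: measurable_fun_tup_of => i j.
  exact: measurable_fun_mulmx.
have mJ : measurable_fun [set: mats * mats]
    (fun p => F (tup_of ((mx_of p.1)^T *m mx_of p.2))).
  apply: mF2 => i j.
    by under eq_fun do rewrite mxE; exact: measurable_fun_mx_of.
  exact: measurable_fun_mx_of.
transitivity (\int[mu]_H \int[mu]_G F (tup_of ((mx_of G)^T *m mx_of H)))%E.
  apply: esym; transitivity (\int[mu]_H (cst (\int[mu]_G F (tup_of (mx_of G)^T)) H))%E.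
    apply: haar_ae => //.
    - exact: (measurable_integral1 mu (f := fun G H => F (tup_of ((mx_of G)^T *m mx_of H)))).
    - by move=> H; exact: integral_ge0.
    - by move=> H; exact: integral_ge0.
    move=> H SH /=.
    rewrite -(@haar_left (mx_of H)^T (fun G => F (tup_of (mx_of G)^T)))//.
    - by apply: eq_integral => G _; rewrite tup_ofK trmx_mul trmxK.
    - exact: SOn_tr.
    - exact: (measurableT_comp mF mtrT).
  by rewrite integral_cst// [X in (_ * X)%E]probability_setT mule1.
rewrite -(@tonelli _ _ _ _ _ mu mu (fun G H => F (tup_of ((mx_of G)^T *m mx_of H))))//.
transitivity (\int[mu]_G (cst (\int[mu]_H F H) G))%E.
  apply: haar_ae => //.
  - exact: (measurable_integral2 mu (f := fun G H => F (tup_of ((mx_of G)^T *m mx_of H)))).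
  - by move=> G; exact: integral_ge0.
  - by move=> G; exact: integral_ge0.
  move=> G SG /=; rewrite -[RHS](@haar_left (mx_of G)^T)//.
  exact: SOn_tr.
by rewrite integral_cst// [X in (_ * X)%E]probability_setT mule1.
Qed.

(** Transposition exchanges right multiplication by [Q] with left multiplication by its
    transpose. *)
Lemma haar_right Q F : SOn Q -> measurable_fun [set: mats] F ->
  (forall G, (0 <= F G)%E) ->
  (\int[mu]_G F (tup_of (mx_of G *m Q)) = \int[mu]_G F G)%E.
Proof.
move=> SQ mF F0.
have mr : measurable_fun [set: mats] (fun G => tup_of (mx_of G *m Q)).
  apply: measurable_fun_tup_of => i j; apply: measurable_fun_mulmx => a b; last by mfun.
  exact: measurable_fun_mx_of.
rewrite -(haar_tr (measurableT_comp mF mr))//=.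
rewrite -[RHS](haar_tr mF F0).
rewrite -[RHS](@haar_left Q^T (fun G => F (tup_of (mx_of G)^T)))//.
- by apply: eq_integral => G _; rewrite !tup_ofK trmx_mul trmxK.
- exact: SOn_tr.
- exact: (measurableT_comp mF mtrT).
Qed.

Definition unit0 : n.-tuple R := [tuple (i == 0 :> nat)%:R | i < n].

Lemma coord_unit0 (i : 'I_n) : coord unit0 i = (i == 0 :> nat)%:R.
Proof. exact: coord_mktuple. Qed.

Lemma unit0_sqnorm : (0 < n)%N -> sqnormE unit0 = 1.
Proof.
move=> n0; have u0 : coord unit0 0 = 1 := coord_unit0 (Ordinal n0).
rewrite /sqnormE /dotE (bigD1 (Ordinal n0))//= u0 mulr1.
rewrite big1 ?addr0// => i; rewrite -val_eqE/= => i0.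
by rewrite coord_unit0 (negbTE i0) mulr0.
Qed.

(* A reflection carries [b] to [a]; a reflection in the last coordinate corrects the sign
   of the determinant. *)
Lemma SOn_transitive x : (2 <= n)%N ->
  exists2 Q, SOn Q & x = mact Q (tscale (normE x) unit0).
Proof.
move=> n2; have n0 : (0 < n)%N by exact: ltn_trans n2.
set b := tscale _ _.
have nb : sqnormE b = sqnormE x.
  by rewrite sqnormE_tscale unit0_sqnorm// mulr1 normE_sq.
have [H HH Hb] : exists2 H : 'M[R]_n, H *m H^T = 1%:M & x = mact H b.
  have [->|xb] := eqVneq x b; first by exists 1%:M; rewrite ?mact1// trmx1 mulmx1.
  pose v : 'cV[R]_n := \col_i (coord x i - coord b i).
  pose s := sqnormE (tadd x (tscale (-1) b)).
  have vv : v^T *m v = s%:M.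
    apply/matrixP => i j; rewrite !ord1 !mxE eqxx mulr1n.
    by apply: eq_bigr => l _; rewrite !mxE coord_tadd coord_tscale; ring.
  have s0 : s != 0.
    apply: contra xb => /eqP s0; apply/eqP/coord_ext => i.
    have := coord_le_sqnormE (tadd x (tscale (-1) b)) i; rewrite -/s s0.
    rewrite coord_tadd coord_tscale mulN1r => h.
    by apply/eqP; rewrite -subr_eq0 -sqrf_eq0 eq_le h sqr_ge0.
  have sE : s = 2 * (sqnormE x - dotE x b).
    have -> : 2 * (sqnormE x - dotE x b) = sqnormE x + sqnormE b - 2 * dotE x b.
      by rewrite nb; ring.
    rewrite /s /sqnormE /dotE mulr_sumr -big_split/= -sumrB; apply: eq_bigr => i _.
    by rewrite coord_tadd coord_tscale; ring.
  have vb : \sum_(l < n) v l 0 * coord b l = - (s / 2).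
    have -> : - (s / 2) = dotE x b - sqnormE b by rewrite sE nb; field.
    rewrite /sqnormE /dotE -sumrB; apply: eq_bigr => l _.
    by rewrite mxE; ring.
  exists (1%:M - (2 / s) *: (v *m v^T)).
    have -> : (1%:M - (2 / s) *: (v *m v^T))^T = 1%:M - (2 / s) *: (v *m v^T).
      by rewrite [LHS]linearB/= trmx1 [X in _ - X]linearZ/= trmx_mul trmxK.
    rewrite mulmxBl mul1mx mulmxBr mulmx1.
    rewrite -!scalemxAl -!scalemxAr mulmxA -(mulmxA v) vv mul_mx_scalar -scalemxAl.
    set W := v *m v^T.
    have -> : (2 / s) *: ((2 / s) *: (s *: W)) = (2 / s) *: W + (2 / s) *: W.
      by rewrite !scalerA -scalerDl; congr (_ *: _); field.
    by rewrite opprB addrK subrK.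
  apply: coord_ext => i; rewrite coord_mktuple.
  transitivity (coord b i - 2 / s * v i 0 * \sum_(l < n) v l 0 * coord b l).
    rewrite vb mxE; move: s0; set xi := coord x i; set bi := coord b i => s0.
    by field.
  rewrite mulr_sumr (bigD1 i)//= [RHS](bigD1 i)//= opprD addrA.
  rewrite -sumrN; congr (_ + _); last first.
    apply: eq_bigr => l li; rewrite !mxE (negbTE (_ : i != l)) 1?eq_sym//.
    by rewrite big_ord1 !mxE mulr0n; ring.
  by rewrite !mxE eqxx big_ord1 !mxE mulr1n; ring.
have : \det H ^+ 2 = 1.
  by rewrite expr2 -{2}[H]trmxK det_tr -det_mulmx HH det1.
move/eqP; rewrite sqrf_eq1 => /orP[/eqP dH|/eqP dH]; first by exists H.
have lt : (n.-1 < n)%N by rewrite prednK.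
pose dv : 'rV[R]_n := \row_i (if i == Ordinal lt then -1 else 1).
pose D := diag_mx dv.
have DD : D *m D^T = 1%:M.
  rewrite tr_diag_mx mulmx_diag; apply/matrixP => i j; rewrite !mxE.
  by case: (i == Ordinal lt); rewrite ?mulrNN mulr1.
(* [b] lies on the first axis and [2 <= n], so the last coordinate, the only one that [D] changes,
   is zero. *)
have Db : mact D b = b.
  apply: coord_ext => i; rewrite coord_mktuple (bigD1 i)//= big1 => [|j ji].
    rewrite !mxE eqxx addr0 mulr1n; case: eqP => [->|_]; last by rewrite mul1r.
    rewrite coord_tscale coord_unit0 /= (_ : (n.-1 == 0)%N = false) ?mulr0//.
    by case: (n) n2 => [|[|m]].
  by rewrite !mxE (negbTE (_ : i != j)) 1?eq_sym// mulr0n mul0r.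
exists (H *m D); last by rewrite mact_mul Db.
split; first by rewrite trmx_mul mulmxA -(mulmxA H) DD mulmx1.
rewrite det_mulmx dH det_diag (bigD1 (Ordinal lt))//= !mxE eqxx big1 ?mulr1 ?mulrNN ?mulr1//.
by move=> i il; rewrite mxE (negbTE il).
Qed.

Definition spherical_mean (f : n.-tuple R -> \bar R) (r : R) : \bar R :=
  (\int[mu]_G f (mact (mx_of G) (tscale r unit0)))%E.

(** [x] is a rotation of a multiple of the first basis vector, and right invariance absorbs that
    rotation. *)
Lemma spherical_meanE (f : n.-tuple R -> \bar R) x : (2 <= n)%N ->
  measurable_fun [set: n.-tuple R] f -> (forall x, (0 <= f x)%E) ->
  (\int[mu]_G f (mact (mx_of G) x) = spherical_mean f (normE x))%E.
Proof.
move=> n2 mf f0; have [Q SQ {1}->] := SOn_transitive x n2.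
rewrite /spherical_mean -[RHS](@haar_right Q
  (fun G => f (mact (mx_of G) (tscale (normE x) unit0))))//.
  by apply: eq_integral => G _; rewrite tup_ofK mact_mul.
apply: (measurableT_comp mf); apply: measurable_fun_mact => [i j|]; last by mfun.
exact: measurable_fun_mx_of.
Qed.

Lemma measurable_spherical_mean (f : n.-tuple R -> \bar R) :
  measurable_fun [set: n.-tuple R] f -> (forall x, (0 <= f x)%E) ->
  measurable_fun [set: R] (spherical_mean f).
Proof.
move=> mf f0.
apply: (measurable_integral2 mu (f := fun r G => f (mact (mx_of G) (tscale r unit0)))) => //.
apply: (measurableT_comp mf); apply: measurable_fun_mact => [i j|]; last by mfun.
by apply: measurable_fun_mx_of; mfun.
Qed.

Lemma spherical_mean_ge0 (f : n.-tuple R -> \bar R) r : (forall x, (0 <= f x)%E) ->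
  (0 <= spherical_mean f r)%E.
Proof. by move=> f0; exact: integral_ge0. Qed.

(* Lebesgue measure is rotation invariant, so averaging over rotations turns a function
   into its spherical means. *)
Lemma integral_spherical_mean (f : n.-tuple R -> \bar R) (w : R -> \bar R) : (2 <= n)%N ->
  measurable_fun [set: n.-tuple R] f -> (forall x, (0 <= f x)%E) ->
  measurable_fun [set: R] w -> (forall r, (0 <= w r)%E) ->
  (\int[lebT R n]_x (w (normE x) * f x) =
   \int[lebT R n]_x (w (normE x) * spherical_mean f (normE x)))%E.
Proof.
move=> n2 mf f0 mw w0.
have mJ : measurable_fun [set: n.-tuple R * mats]
    (fun p => w (normE p.1) * f (mact (mx_of p.2) p.1))%E.
  apply: emeasurable_funM; first by mfun.
  apply: (measurableT_comp mf); apply: measurable_fun_mact => [i j|]; last by mfun.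
  by apply: measurable_fun_mx_of; mfun.
transitivity (\int[lebT R n]_x \int[mu]_G (w (normE x) * f (mact (mx_of G) x)))%E; last first.
  apply: eq_integral => x _; rewrite ge0_integralZl//.
    by rewrite spherical_meanE.
  apply: (measurableT_comp mf); apply: measurable_fun_mact => [i j|]; last by mfun.
  exact: measurable_fun_mx_of.
rewrite (tonelli (lebT R n) mu (f := fun x G => (w (normE x) * f (mact (mx_of G) x))%E))//; last first.
  by move=> x G; rewrite mule_ge0.
transitivity (\int[mu]_G (cst (\int[lebT R n]_x (w (normE x) * f x)) G))%E.
  by rewrite [RHS]integral_cst// [X in _ = (_ * X)%E]probability_setT mule1.
apply: haar_ae => //.
- apply: (measurable_integral1 (lebT R n)
    (f := fun x G => (w (normE x) * f (mact (mx_of G) x))%E)) => // x G.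
  by rewrite mule_ge0.
- by move=> G; apply: integral_ge0 => x _; rewrite mule_ge0.
- by move=> G; apply: integral_ge0 => x _; rewrite mule_ge0.
move=> G [GG _] /=.
rewrite -[LHS](integral_lebT_mact GG); last 2 first.
- by mfun.
- by move=> x; rewrite mule_ge0.
by apply: eq_integral => x _; rewrite normE_mact.
Qed.

End haar.

(** * Hyperbolic geometry of the submanifolds *)

Section geometry.
Context (R : realType) (n k : nat).
Hypothesis kn : (k < n)%N.
Local Notation mats := (n.-tuple (n.-tuple R)).

Definition unitk : n.-tuple R := [tuple (i == k :> nat)%:R | i < n].
Definition embed (y : k.-tuple R) : n.-tuple R := [tuple coord y i | i < n].
(* The point of the standard submanifold [xi (1, h)] with chart coordinates [y]. *)
Definition xipt0 (h : R) (y : k.-tuple R) : n.-tuple R := htrans unitk h (embed y).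

Lemma coord_embed y (i : 'I_n) : coord (embed y) i = coord y i.
Proof. exact: coord_mktuple. Qed.

Lemma coord_unitk (i : 'I_n) : coord unitk i = (i == k :> nat)%:R.
Proof. exact: coord_mktuple. Qed.

Lemma dotE_mact (M : 'M[R]_n) x y : M *m M^T = 1%:M ->
  dotE (mact M x) (mact M y) = dotE x y.
Proof.
move=> MM.
have pol (u v : n.-tuple R) : sqnormE (tadd u v) = sqnormE u + sqnormE v + 2 * dotE u v.
  rewrite /sqnormE /dotE mulr_sumr -!big_split/=; apply: eq_bigr => i _.
  by rewrite !coord_tadd; ring.
have := sqnormE_mact (tadd x y) MM.
by rewrite mact_tadd !pol !sqnormE_mact//; lra.
Qed.

Lemma dotE_tscalel m a (x y : m.-tuple R) : dotE (tscale a x) y = a * dotE x y.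
Proof.
by rewrite /dotE mulr_sumr; apply: eq_bigr => i _; rewrite coord_tscale mulrA.
Qed.

(** The Moebius formula involves its vectors only through inner products and linear combinations, so
    it commutes with orthogonal maps. *)
Lemma htrans_mact (M : 'M[R]_n) u h x : M *m M^T = 1%:M ->
  htrans (mact M u) h (mact M x) = mact M (htrans u h x).
Proof.
move=> MM; rewrite /htrans; cbv zeta; rewrite -!mact_tscale.
by rewrite dotE_mact// !sqnormE_mact// -mact_tadd -mact_tscale.
Qed.

Lemma xiptE (G : mats) h y : SOn (mx_of G) ->
  xipt G h y = mact (mx_of G) (xipt0 h y).
Proof.
move=> [MM _].
have gE : gcol G k = mact (mx_of G) unitk.
  apply: coord_ext => i; rewrite !coord_mktuple (bigD1 (Ordinal kn))//= big1.
    rewrite -[k]/(nat_of_ord (Ordinal kn)) coord_unitk/= eqxx mulr1 addr0.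
    by rewrite mxE.
  move=> j; rewrite -val_eqE/= => jk.
  by rewrite coord_unitk (negbTE jk) mulr0.
have yE : [tuple \sum_(j < k) coord y j * coord (gcol G j) i | i < n] =
    mact (mx_of G) (embed y).
  apply: coord_ext => i; rewrite !coord_mktuple.
  rewrite (big_ord_widen n (fun j => coord y j * coord (gcol G j) i)) ?(ltnW kn)//.
  rewrite big_mkcond; apply: eq_bigr => j _; rewrite coord_embed mxE.
  case: ltnP => [_|kj]; first by rewrite coord_mktuple mulrC.
  by rewrite (coord_default y kj) mulr0.
by rewrite /xipt gE yE htrans_mact.
Qed.

Lemma sqnormE_unitk : sqnormE unitk = 1.
Proof.
have u0 : coord unitk k = 1 by rewrite (coord_unitk (Ordinal kn))/= eqxx.
rewrite /sqnormE /dotE (bigD1 (Ordinal kn))//= u0 mulr1.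
rewrite big1 ?addr0// => i; rewrite -val_eqE/= => ik.
by rewrite coord_unitk (negbTE ik) mulr0.
Qed.

Lemma sqnormE_embed y : sqnormE (embed y) = sqnormE y.
Proof.
rewrite /sqnormE /dotE (big_ord_widen n (fun i => coord y i * coord y i)) ?(ltnW kn)//.
rewrite [RHS]big_mkcond; apply: eq_bigr => i _; rewrite coord_embed.
by case: ltnP => // ki; rewrite (coord_default y ki) mulr0.
Qed.

Lemma dotE_unitk_embed y : dotE unitk (embed y) = 0.
Proof.
apply: big1 => i _; rewrite coord_unitk coord_embed.
case: eqP => [->|_]; last by rewrite mul0r.
by rewrite (coord_default y (leqnn k)) mulr0.
Qed.

(** This is [tanh (h / 2)], the Euclidean norm of a point at distance [h] from the origin. *)
Definition htanh (h : R) : R := (expR h - 1) / (expR h + 1).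

Lemma htanh_bnd h : 0 <= h -> 0 <= htanh h < 1.
Proof.
move=> h0; have e1 : 1 <= expR h by rewrite -[leLHS]expR0 ler_expR.
by rewrite /htanh divr_ge0/= ?ltr_pdivrMr; lra.
Qed.

Lemma ballsinh_htanh h : ballsinh (htanh h) = sinh h.
Proof.
rewrite /ballsinh /htanh /sinh expRN; have e0 := expR_gt0 h.
have -> : 1 - ((expR h - 1) / (expR h + 1)) ^+ 2 = 4 * expR h / (expR h + 1) ^+ 2.
  by field; rewrite gt_eqF//; lra.
by field; rewrite !gt_eqF//; lra.
Qed.

(** The direction of translation is orthogonal to [R^k], so the inner product in the Moebius formula
    vanishes and its two terms are orthogonal. *)
Lemma sqnormE_xipt0 h y :
  sqnormE (xipt0 h y) =
  (htanh h ^+ 2 + sqnormE y) / (1 + htanh h ^+ 2 * sqnormE y).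
Proof.
have s0 := sqnormE_ge0 y; have t0 := sqr_ge0 (htanh h).
rewrite /xipt0 /htrans; cbv zeta; rewrite -/(htanh h) sqnormE_tscale.
rewrite !(sqnormE_tscale, dotE_tscalel) dotE_unitk_embed sqnormE_unitk sqnormE_embed.
have orth (a b : R) u v : dotE u v = 0 ->
    sqnormE (tadd (tscale a u) (tscale b v : n.-tuple R)) =
    a ^+ 2 * sqnormE u + b ^+ 2 * sqnormE v.
  move=> uv; transitivity (a ^+ 2 * sqnormE u + b ^+ 2 * sqnormE v + 2 * a * b * dotE u v).
    rewrite /sqnormE /dotE !mulr_sumr -!big_split/=; apply: eq_bigr => i _.
    by rewrite !coord_tadd !coord_tscale; ring.
  by rewrite uv mulr0 addr0.
rewrite orth; last by rewrite dotE_tscalel dotE_unitk_embed mulr0.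
rewrite sqnormE_tscale sqnormE_unitk sqnormE_embed.
move: s0 t0; set s := sqnormE y; set t := htanh h => s0 t0.
by field; rewrite gt_eqF//; nra.
Qed.

Lemma inball_normE m (y : m.-tuple R) : inball y = (normE y < 1).
Proof. by rewrite /inball -normE_sq expr_lt1// normE_ge0. Qed.

Lemma normE_xipt0 h y : 0 <= h -> inball y ->
  htanh h <= normE (xipt0 h y) < 1.
Proof.
move=> /htanh_bnd /andP[t0 t1]; rewrite /inball => y1; have y0 := sqnormE_ge0 y.
have d0 : 0 < 1 + htanh h ^+ 2 * sqnormE y by nra.
apply/andP; split.
  rewrite -(ler_pXn2r (n := 2)) ?nnegrE ?normE_ge0// normE_sq sqnormE_xipt0.
  rewrite ler_pdivlMr// mulrDr mulr1 lerD2l.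
  have T1 : htanh h ^+ 2 <= 1 by rewrite expr_le1// ltW.
  have T0 := sqr_ge0 (htanh h).
  have : htanh h ^+ 2 * htanh h ^+ 2 <= 1 by nra.
  by nra.
rewrite -inball_normE /inball sqnormE_xipt0 ltr_pdivrMr//.
have : htanh h ^+ 2 < 1 by rewrite expr_lt1.
by nra.
Qed.

(** The hyperbolic theorem of Pythagoras, [1 + X^2 = (1 + t^2) (1 + u^2)], for the right angle at
    the foot point. *)
Lemma ballsinh_xipt0 h y : 0 < h -> inball y ->
  ballsinh (normE (xipt0 h y)) = sinhdist (sinh h) (ballsinh (normE y)).
Proof.
move=> h0 yB; have /andP[r0 r1] := normE_xipt0 (ltW h0) yB.
have /andP[t0 t1] := htanh_bnd (ltW h0).
have {}r0 : 0 <= normE (xipt0 h y) by exact: le_trans t0 r0.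
have B0 : 0 <= ballsinh (normE (xipt0 h y)).
  by rewrite /ballsinh divr_ge0 ?mulr_ge0// subr_ge0 expr_le1// ltW.
rewrite /sinhdist -[LHS]ger0_norm// -sqrtr_sqr; congr Num.sqrt.
rewrite -ballsinh_htanh /ballsinh.
have -> : (2 * normE (xipt0 h y) / (1 - normE (xipt0 h y) ^+ 2)) ^+ 2 =
    4 * sqnormE (xipt0 h y) / (1 - sqnormE (xipt0 h y)) ^+ 2.
  by rewrite -normE_sq expr_div_n; ring.
have -> : (2 * normE y / (1 - normE y ^+ 2)) ^+ 2 =
    4 * sqnormE y / (1 - sqnormE y) ^+ 2.
  by rewrite -normE_sq expr_div_n; ring.
rewrite sqnormE_xipt0.
have y0 := sqnormE_ge0 y; have y1 : sqnormE y < 1 := yB.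
have T1 : htanh h ^+ 2 < 1 by rewrite expr_lt1.
have T0 := sqr_ge0 (htanh h).
have d0 : 0 < 1 + htanh h ^+ 2 * sqnormE y by nra.
move: y0 y1 T1 T0 d0; move: (sqnormE y) (htanh h) => s t y0 y1 T1 T0 d0.
have -> : 1 - (t ^+ 2 + s) / (1 + t ^+ 2 * s) =
    (1 - t ^+ 2) * (1 - s) / (1 + t ^+ 2 * s).
  by field; rewrite gt_eqF.
by field; rewrite !gt_eqF//; lra.
Qed.

Lemma sinh_hdist0 m (x : m.-tuple R) : inball x -> sinh (hdist0 x) = ballsinh (normE x).
Proof.
rewrite inball_normE => x1; have x0 := normE_ge0 x.
rewrite /sinh /hdist0 expRN lnK; last by rewrite posrE divr_gt0//; lra.
rewrite /ballsinh (_ : 1 - normE x ^+ 2 = (1 - normE x) * (1 + normE x)); last by ring.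
by field; rewrite !gt_eqF//; lra.
Qed.

Lemma ln_htanh h : ln ((1 + htanh h) / (1 - htanh h)) = h.
Proof.
rewrite -[RHS]expRK; congr ln; rewrite /htanh; have e0 := expR_gt0 h.
by field; rewrite !gt_eqF//; lra.
Qed.

(** The infimum is attained at the foot point [y = 0]: every other point has norm at least
    [tanh (h / 2)], and the distance increases with the norm. *)
Lemma dist0xiE (G : mats) h : SOn (mx_of G) -> 0 <= h -> dist0xi k G h = h.
Proof.
move=> SG h0; have /andP[t0 t1] := htanh_bnd h0.
pose z : k.-tuple R := tscale 0 [tuple 0 | i < k].
have z0 : sqnormE z = 0 by rewrite sqnormE_tscale expr0n mul0r.
have zB : inball z by rewrite /inball z0.
have dE y : hdist0 (xipt G h y) =
    ln ((1 + normE (xipt0 h y)) / (1 - normE (xipt0 h y))).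
  by rewrite xiptE// /hdist0 normE_mact//; exact: SG.1.
have hE : hdist0 (xipt G h z) = h.
  rewrite dE -[RHS]ln_htanh.
  have -> // : normE (xipt0 h z) = htanh h.
  by rewrite /normE sqnormE_xipt0 z0 mulr0 !addr0 divr1 sqrtr_sqr ger0_norm.
have lbh : lbound [set hdist0 (xipt G h y) | y in [set y : k.-tuple R | inball y]] h.
  move=> _ [y /= yB <-].
  have /andP[ty y1] := normE_xipt0 h0 yB.
  rewrite dE -[leLHS]ln_htanh; move: ty y1 t0 t1.
  move: (normE _) (htanh h) => r t tr r1 t0 t1.
  rewrite ler_ln ?posrE ?divr_gt0//; [|lra..].
  by rewrite ler_pdivrMr ?subr_gt0// mulrAC ler_pdivlMr ?subr_gt0//; nra.
rewrite /dist0xi; apply/eqP; rewrite eq_le; apply/andP; split.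
  rewrite -[leRHS]hE; apply: ge_inf; first by exists h.
  by exists z.
by apply: lb_le_inf => //; exists h, z.
Qed.

Lemma measurable_fun_xipt0 d (T : measurableType d) (f : T -> R) (g : T -> k.-tuple R) :
  measurable_fun [set: T] f -> measurable_fun [set: T] g ->
  measurable_fun [set: T] (fun t => xipt0 (f t) (g t)).
Proof.
move=> mf mg.
have me : measurable_fun [set: T] (fun t => embed (g t)) by rewrite /embed; mfun.
by rewrite /xipt0 /htrans; cbv zeta; mfun.
Qed.

End geometry.

(** Adding [+oo] times the indicator of the null set [N] to [g] leaves its integral unchanged and
    makes it dominate [f] everywhere. Measurability is asked of the upper bound alone. *)
Lemma le_integral_ae d (T : measurableType d) (R : realType)
  (m : {measure set T -> \bar R}) (N : set T) (f g : T -> \bar R) :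
  measurable N -> m N = 0%E -> (forall x, (0 <= f x)%E) -> (forall x, (0 <= g x)%E) ->
  measurable_fun [set: T] g -> (forall x, ~ N x -> (f x <= g x)%E) ->
  (\int[m]_x f x <= \int[m]_x g x)%E.
Proof.
move=> mN N0 f0 g0 mg fg.
have mI : measurable_fun [set: T] (fun x => (\1_N x)%:E : \bar R).
  by apply/measurable_EFinP; exact: measurable_indic.
have I0 x : (0 <= (\1_N x)%:E :> \bar R)%E by rewrite lee_fin.
have -> : (\int[m]_x g x = \int[m]_x (g x + +oo * (\1_N x)%:E))%E.
  have mI' : measurable_fun [set: T] (fun x => +oo * (\1_N x)%:E : \bar R)%E.
    by apply: emeasurable_funM.
  rewrite (ge0_integralD _ measurableT _ mg _ mI')//.
  by rewrite [X in (_ + X)%E]ge0_integralZl// integral_indic// setIT N0 mule0 adde0.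
apply: le_integral_T => // x.
have [Nx|Nx] := pselect (N x).
  rewrite indicE mem_set// mule1 addey ?leey//.
  by rewrite gt_eqF// (lt_le_trans _ (g0 x)).
by apply: (le_trans (fg x Nx)); rewrite leeDl// mule_ge0.
Qed.

(** * Bounds for the transform at a single submanifold *)

Section transform_bounds.
Context (R : realType).

(** [lint] is the difference of the integrals of the positive and negative parts, and the right side
    is their sum. If both parts are infinite, so is the sum, whatever value the difference takes. *)
Lemma abse_lint_le m (F : m.-tuple R -> R) : measurable_fun [set: m.-tuple R] F ->
  (`|lint (EFin \o F)| <= \int[lebT R m]_t (`|F t|)%:E)%E.
Proof.
move=> mF; have mE : measurable_fun [set: m.-tuple R] (EFin \o F).
  exact/measurable_EFinP.
pose Fp t : \bar R := maxe ((EFin \o F) t) 0.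
pose Fn t : \bar R := maxe (- (EFin \o F) t)%E 0.
have mp : measurable_fun [set: m.-tuple R] Fp by exact: measurable_maxe.
have mn : measurable_fun [set: m.-tuple R] Fn.
  by apply: measurable_maxe => //; exact: measurableT_comp.
have p0 t : (0 <= Fp t)%E by rewrite le_max lexx orbT.
have n0 t : (0 <= Fn t)%E by rewrite le_max lexx orbT.
have ip : (0 <= \int[lebT R m]_t Fp t)%E by exact: integral_ge0.
have jn : (0 <= \int[lebT R m]_t Fn t)%E by exact: integral_ge0.
have D : (\int[lebT R m]_t (Fp t + Fn t) =
    \int[lebT R m]_t Fp t + \int[lebT R m]_t Fn t)%E by exact: ge0_integralD.
have sub (a b : \bar R) : (0 <= a -> 0 <= b -> `|a - b| <= a + b)%E.
  by move=> a0 b0; rewrite -{2}(gee0_abs a0) -{2}(gee0_abs b0); exact: lee_abs_sub.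
rewrite /lint -/Fp -/Fn !iintE//; apply: le_trans (sub _ _ ip jn) _; rewrite -D.
rewrite le_eqVlt; apply/orP; left; apply/eqP; apply: eq_integral => t _.
have [h|/ltW h] := lerP 0 (F t).
  have -> : Fp t = (F t)%:E by apply/max_idPl; rewrite lee_fin.
  have -> : Fn t = 0%E by apply/max_idPr; rewrite lee_fin oppr_le0.
  by rewrite adde0 ger0_norm.
have -> : Fp t = 0%E by apply/max_idPr; rewrite lee_fin.
have -> : Fn t = (- F t)%:E by apply/max_idPl; rewrite lee_fin oppr_ge0.
by rewrite add0e ler0_norm.
Qed.

Definition balldens m (y : m.-tuple R) : R := if inball y then hdens y else 0.

Lemma balldens_ge0 m (y : m.-tuple R) : 0 <= balldens y.
Proof.
rewrite /balldens; case: ifP => // yB; rewrite /hdens exprn_ge0// divr_ge0// subr_ge0.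
exact: ltW.
Qed.

Lemma measurable_fun_balldens d (T : measurableType d) m (g : T -> m.-tuple R) :
  measurable_fun [set: T] g -> measurable_fun [set: T] (fun t => balldens (g t)).
Proof. by move=> mg; rewrite /balldens /inball /hdens; mfun. Qed.

Lemma ballsinhK (r : R) : -1 < r < 1 -> sinhball (ballsinh r) = r.
Proof.
move=> hr; have [hb E] := sinhballK (ballsinh r).
by apply/eqP; rewrite eq_le !leNgt -(ballsinh_lt hb hr) -(ballsinh_lt hr hb) E ltxx.
Qed.

Variables (n k : nat).
Hypothesis kn : (k < n)%N.
Hypothesis k0 : (0 < k)%N.
Local Notation mats := (n.-tuple (n.-tuple R)).
Variable f : n.-tuple R -> R.
Hypothesis mf : measurable_fun [set: n.-tuple R] f.

Lemma Rk_le (G : mats) h : SOn (mx_of G) ->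
  (`|Rk k f G h| <=
   \int[lebT R k]_y (`|f (mact (mx_of G) (xipt0 n h y))| * balldens y)%:E)%E.
Proof.
move=> SG.
have mg : measurable_fun [set: k.-tuple R] (fun y => f (mact (mx_of G) (xipt0 n h y))).
  apply: (measurableT_comp mf); apply: measurable_fun_mact => [i j|]; first by mfun.
  by apply: measurable_fun_xipt0; mfun.
pose F (y : k.-tuple R) := f (mact (mx_of G) (xipt0 n h y)) * balldens y.
have mF : measurable_fun [set: k.-tuple R] F.
  by apply: measurable_funM => //; apply: measurable_fun_balldens; mfun.
have -> : Rk k f G h = lint (EFin \o F).
  rewrite /Rk; congr lint; apply/funext => y; rewrite /F /balldens /=.
  by case: ifP => _; rewrite ?mulr0// xiptE.
apply: (le_trans (abse_lint_le mF)).
rewrite le_eqVlt; apply/orP; left; apply/eqP; apply: eq_integral => y _.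
by rewrite /F normrM [`|balldens y|]ger0_norm// balldens_ge0.
Qed.

Variables (p del s : R).
Hypothesis p1 : 1 <= p.
Hypothesis del0 : 0 < del.
Hypothesis s0 : 0 < s.
Hypothesis sE : forall g : R -> \bar R, measurable_fun [set: R] g ->
  (forall r, (0 <= g r)%E) ->
  (\int[lebT R k]_y ((if inball y then hdens y else 0%R)%:E * g (ballsinh (normE y))) =
   s%:E * \int[leb R]_u ((pw (k%:R - 1) u * (1 + u ^+ 2) `^ (- 2^-1))%:E * g u))%E.

Local Notation wt h y := (schur_weight k%:R del (sinh h) (ballsinh (normE y))).
Local Notation A := (s * (k%:R^-1 + del^-1)).

Let kR0 : 0 < k%:R :> R. Proof. by rewrite ltr0n. Qed.

Let A0 : 0 < A.
Proof. by rewrite mulr_gt0// addr_gt0// invr_gt0. Qed.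

Lemma measurable_fun_wt d (T : measurableType d) (a : T -> R) (g : T -> k.-tuple R) :
  measurable_fun [set: T] a -> measurable_fun [set: T] g ->
  measurable_fun [set: T] (fun t => wt (a t) (g t)).
Proof.
by move=> ma mg; apply: measurable_fun_schur_weight; rewrite /ballsinh; mfun.
Qed.

(** The constant [A] bounds the mass of the weight on the submanifold: [s] comes from polar
    coordinates there, [k^-1 + del^-1] from [integral_schur_weight]. It depends on neither [G] nor
    [h]. *)
Lemma Rk_hoelder (G : mats) h : SOn (mx_of G) -> 0 < h ->
  (poweR `|Rk k f G h| p <= (A `^ (p - 1))%:E *
   \int[lebT R k]_y (`|f (mact (mx_of G) (xipt0 n h y))| `^ p *
      wt h y `^ (1 - p) * balldens y)%:E)%E.
Proof.
move=> SG h0; have t0 : 0 < sinh h by rewrite sinh_gt0.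
have mg : measurable_fun [set: k.-tuple R] (fun y => `|f (mact (mx_of G) (xipt0 n h y))|).
  apply: measurable_fun_abs.
  apply: (measurableT_comp mf); apply: measurable_fun_mact => [i j|]; first by mfun.
  by apply: measurable_fun_xipt0; mfun.
apply: (@le_trans _ _ (poweR (\int[lebT R k]_y
    (`|f (mact (mx_of G) (xipt0 n h y))| * balldens y)%:E) p)%E).
  apply: gt0_ler_poweR; [exact: le_trans p1| | |exact: Rk_le].
  - by rewrite in_itv/= abse_ge0 leey.
  - rewrite in_itv/= leey andbT; apply: integral_ge0 => y _.
    by rewrite lee_fin mulr_ge0 ?balldens_ge0.
apply: weighted_hoelder => //.
- by apply: measurable_fun_wt; mfun.
- by apply: measurable_fun_balldens; mfun.
- by move=> y; exact/ltW/schur_weight_gt0.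
- by move=> y; exact: balldens_ge0.
- by move=> y _; exact: schur_weight_gt0.
have mN : measurable_fun [set: R] (fun u => (schur_weight k%:R del (sinh h) u)%:E).
  by apply: measurable_fun_EFin; apply: measurable_fun_schur_weight; mfun.
have N0 u : (0 <= (schur_weight k%:R del (sinh h) u)%:E)%E.
  by rewrite lee_fin; exact/ltW/schur_weight_gt0.
rewrite (_ : (\int[lebT R k]_y _)%E = (s%:E * \int[leb R]_u
  ((pw (k%:R - 1) u * (1 + u ^+ 2) `^ (- 2^-1))%:E *
   (schur_weight k%:R del (sinh h) u)%:E))%E); last first.
  by rewrite -(sE mN N0); apply: eq_integral => y _; rewrite -EFinM mulrC.
rewrite EFinM; apply: lee_wpmul2l; first by rewrite lee_fin ltW.
apply: le_trans (integral_schur_weight kR0 del0 t0).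
by under eq_integral do rewrite -EFinM.
Qed.

End transform_bounds.

(** * Reduction of both norms to the radial profile *)

Section transform_estimate.
Context (R : realType) (n k : nat).
Local Notation mats := (n.-tuple (n.-tuple R)).
Variables (b1 b2 p del s : R) (f : n.-tuple R -> R).
Variables (mu : probability mats R) (c : R).
Hypothesis n2 : (2 <= n)%N.
Hypothesis kn : (k < n)%N.
Hypothesis k0 : (0 < k)%N.
Hypothesis haar : is_Haar_SO mu.
Hypothesis c0 : 0 < c.
Hypothesis mf : measurable_fun [set: n.-tuple R] f.
Hypothesis p1 : 1 <= p.
Hypothesis del0 : 0 < del.
Hypothesis s0 : 0 < s.
Hypothesis sE : forall g : R -> \bar R, measurable_fun [set: R] g ->
  (forall r, (0 <= g r)%E) ->
  (\int[lebT R k]_y ((if inball y then hdens y else 0%R)%:E * g (ballsinh (normE y))) =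
   s%:E * \int[leb R]_u ((pw (k%:R - 1) u * (1 + u ^+ 2) `^ (- 2^-1))%:E * g u))%E.

Local Notation wt h y := (schur_weight k%:R del (sinh h) (ballsinh (normE y))).
Local Notation A := (s * (k%:R^-1 + del^-1)).

Definition abspow (x : n.-tuple R) : \bar R := (`|f x| `^ p)%:E.

Lemma abspow_ge0 x : (0 <= abspow x)%E.
Proof. by rewrite lee_fin powR_ge0. Qed.

Lemma measurable_abspow : measurable_fun [set: n.-tuple R] abspow.
Proof. by rewrite /abspow; mfun. Qed.

(* The profile of the spherical means of [|f|^p], as a function of [sinh d(0, x)]. *)
Definition profile (X : R) : \bar R := spherical_mean mu abspow (sinhball X).

Lemma profile_ge0 X : (0 <= profile X)%E.
Proof. exact/spherical_mean_ge0/abspow_ge0. Qed.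

Lemma measurable_profile : measurable_fun [set: R] profile.
Proof.
have := measurable_spherical_mean mu measurable_abspow abspow_ge0.
move=> m1; have m2 : measurable_fun [set: R] (@sinhball R) by rewrite /sinhball; mfun.
exact: measurableT_comp m1 m2.
Qed.

Lemma profileE r : 0 <= r < 1 -> spherical_mean mu abspow r = profile (ballsinh r).
Proof. by move=> hr; rewrite /profile ballsinhK//; lra. Qed.

Lemma wgt_xidens_ge0 d h : 0 <= h ->
  0 <= wgt b1 b2 d * (cosh h ^+ k * sinh h ^+ (n - k - 1)).
Proof.
move=> h0; have t0 : 0 <= sinh h.
  by move: h0; rewrite le_eqVlt => /predU1P[<-|h0]; rewrite ?sinh0// ltW// sinh_gt0.
by rewrite /wgt !mulr_ge0 ?powR_ge0// exprn_ge0// ltW// cosh_gt0.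
Qed.

Lemma Xinorm_ge0 : (0 <= Xinorm_p k mu c b1 b2 p f)%E.
Proof.
rewrite /Xinorm_p mule_ge0 ?lee_fin ?(ltW c0)//; apply: integral_ge0 => G _.
apply: integral_ge0 => h; rewrite /= in_itv/= andbT => h0.
by rewrite mule_ge0 ?poweR_ge0// lee_fin wgt_xidens_ge0.
Qed.

(** The weighted density of the measure on submanifolds, with [d(0, xi)] replaced by [h] and
    extended by zero so that integrals run over the whole line. *)
Definition xidens (h : R) : R :=
  if 0 < h then wgt b1 b2 h * (cosh h ^+ k * sinh h ^+ (n - k - 1)) else 0.

Lemma xidens_ge0 h : 0 <= xidens h.
Proof.
by rewrite /xidens; case: ifP => // h0; rewrite wgt_xidens_ge0// ltW.
Qed.

Lemma measurable_fun_xidens d (T : measurableType d) (g : T -> R) :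
  measurable_fun [set: T] g -> measurable_fun [set: T] (fun t => xidens (g t)).
Proof. by move=> mg; rewrite /xidens /wgt; mfun. Qed.

Definition sheetdens (h : R) (y : k.-tuple R) : R := wt h y `^ (1 - p) * balldens y.

Lemma sheetdens_ge0 h y : 0 <= sheetdens h y.
Proof. by rewrite mulr_ge0 ?powR_ge0 ?balldens_ge0. Qed.

Lemma measurable_fun_sheetdens d (T : measurableType d) (a : T -> R) (g : T -> k.-tuple R) :
  measurable_fun [set: T] a -> measurable_fun [set: T] g ->
  measurable_fun [set: T] (fun t => sheetdens (a t) (g t)).
Proof.
move=> ma mg; apply: measurable_funM; last exact: measurable_fun_balldens.
by apply: measurable_fun_powR; exact: measurable_fun_wt.
Qed.

Let sheet (G : mats) (h : R) : \bar R :=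
  (\int[lebT R k]_y ((sheetdens h y)%:E * abspow (mact (mx_of G) (xipt0 n h y))))%E.

Let sheet_ge0 G h : (0 <= sheet G h)%E.
Proof.
by apply: integral_ge0 => y _; rewrite mule_ge0 ?abspow_ge0// lee_fin sheetdens_ge0.
Qed.

Let measurable_sheetfun : measurable_fun [set: (mats * R) * k.-tuple R]
  (fun q => (sheetdens q.1.2 q.2)%:E * abspow (mact (mx_of q.1.1) (xipt0 n q.1.2 q.2)))%E.
Proof.
apply: emeasurable_funM.
  by apply: measurable_fun_EFin; apply: measurable_fun_sheetdens; mfun.
apply: (measurableT_comp measurable_abspow); apply: measurable_fun_mact => [i j|].
  by apply: measurable_fun_mx_of; mfun.
by apply: measurable_fun_xipt0; mfun.
Qed.

Let measurable_sheet : measurable_fun [set: mats * R] (fun q => sheet q.1 q.2).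
Proof.
apply: (measurable_integral2 (lebT R k) measurable_sheetfun) => q y.
by rewrite mule_ge0 ?abspow_ge0// lee_fin sheetdens_ge0.
Qed.

Let sheetmean (h : R) : \bar R :=
  (\int[lebT R k]_y ((sheetdens h y)%:E * spherical_mean mu abspow (normE (xipt0 n h y))))%E.

(** Every [G] rotates the same standard submanifold and the density ignores [G], so Haar integration
    acts on [|f|^p] alone. *)
Let integral_sheet h : (\int[mu]_G sheet G h = sheetmean h)%E.
Proof.
have mJ : measurable_fun [set: mats * k.-tuple R]
    (fun q => (sheetdens h q.2)%:E * abspow (mact (mx_of q.1) (xipt0 n h q.2)))%E.
  have mq : measurable_fun [set: mats * k.-tuple R] (fun q => ((q.1, h), q.2)).
    by apply: measurable_fun_pair; [apply: measurable_fun_pair|]; mfun.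
  exact: measurableT_comp measurable_sheetfun mq.
have J0 G y : (0 <= (sheetdens h y)%:E * abspow (mact (mx_of G) (xipt0 n h y)))%E.
  by rewrite mule_ge0 ?abspow_ge0// lee_fin sheetdens_ge0.
rewrite /sheet (tonelli mu (lebT R k) mJ J0); apply: eq_integral => y _.
have mG : measurable_fun [set: mats] (fun G => abspow (mact (mx_of G) (xipt0 n h y))).
  apply: (measurableT_comp measurable_abspow); apply: measurable_fun_mact => [i j|].
    by apply: measurable_fun_mx_of; mfun.
  by mfun.
rewrite -(spherical_meanE haar _ n2 measurable_abspow abspow_ge0).
apply: ge0_integralZl => //; [by move=> G _; exact: abspow_ge0|].
by rewrite lee_fin sheetdens_ge0.
Qed.

(** [Rk_hoelder] applies to almost every [(G, h)]. Its right side is jointly measurable, so the Haar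
    integral can be moved inside, where it forms spherical means. *)
Lemma Xinorm_le : (Xinorm_p k mu c b1 b2 p f <= (c * A `^ (p - 1))%:E *
  \int[leb R]_h ((xidens h)%:E * \int[lebT R k]_y
     ((sheetdens h y)%:E * spherical_mean mu abspow (normE (xipt0 n h y)))))%E.
Proof.
have a0 : (0 <= (A `^ (p - 1))%:E)%E by rewrite lee_fin powR_ge0.
have mx : measurable_fun [set: R] (fun h => (xidens h)%:E).
  by apply: measurable_fun_EFin; apply: measurable_fun_xidens; mfun.
have x0 h : (0 <= (xidens h)%:E)%E by rewrite lee_fin xidens_ge0.
have mL : measurable_fun [set: mats * R] (fun q => (xidens q.2)%:E * sheet q.1 q.2)%E.
  apply: emeasurable_funM => //.
  by apply: measurable_fun_EFin; apply: measurable_fun_xidens; mfun.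
have L0 G h : (0 <= (xidens h)%:E * sheet G h)%E by rewrite mule_ge0.
have msG G : measurable_fun [set: R] (sheet G).
  have mq : measurable_fun [set: R] (fun h => (G, h)).
    by apply: measurable_fun_pair; mfun.
  exact: measurableT_comp measurable_sheet mq.
have msh h : measurable_fun [set: mats] (sheet^~ h).
  have mq : measurable_fun [set: mats] (fun G => (G, h)).
    by apply: measurable_fun_pair; mfun.
  exact: measurableT_comp measurable_sheet mq.
have mLG G : measurable_fun [set: R] (fun h => (xidens h)%:E * sheet G h)%E.
  exact: emeasurable_funM mx (msG G).
have mI : measurable_fun [set: mats] (fun G => \int[leb R]_h ((xidens h)%:E * sheet G h))%E.
  exact: (measurable_integral2 (leb R) mL).
rewrite /Xinorm_p EFinM -muleA; apply: lee_wpmul2l; first by rewrite lee_fin ltW.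
rewrite (_ : (\int[leb R]_h _)%E = \int[mu]_G \int[leb R]_h ((xidens h)%:E * sheet G h))%E; last first.
  rewrite (tonelli mu (leb R) mL L0); apply: eq_integral => h _.
  by rewrite ge0_integralZl// integral_sheet.
rewrite -ge0_integralZl//; last by move=> G _; exact: integral_ge0.
apply: (@le_integral_ae _ _ _ mu (@mx_of R n @^-1` (~` @SOn R n))).
- by rewrite -preimage_setC; apply: measurableC; exact: measurable_SOn.
- exact: haar.1.
- move=> G; apply: integral_ge0 => h; rewrite /= in_itv/= andbT => h0.
  by rewrite mule_ge0 ?poweR_ge0// lee_fin wgt_xidens_ge0.
- by move=> G; rewrite mule_ge0// integral_ge0.
- exact: emeasurable_funM (measurable_cst _) mI.
move=> G /contrapT SG.
rewrite integral_mkcond -ge0_integralZl// -integral_lebE; last 2 first.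
- exact: emeasurable_funM (measurable_cst _) (mLG G).
- by move=> h; rewrite mule_ge0.
(* At [h = 0] the original density can be nonzero ([b1 = 0] and [k = n - 1]) while [xidens]
   vanishes, and the Hoelder weight requires [sinh h > 0]. This point is a null set. *)
apply: (@le_integral_ae _ _ _ lebesgue_measure [set 0]) => //.
- exact: lebesgue_measure_set1.
- move=> h; rewrite patchE; case: ifPn => // /set_mem; rewrite /= in_itv/= andbT => h0.
  by rewrite mule_ge0 ?poweR_ge0// lee_fin wgt_xidens_ge0.
- by move=> h; rewrite mule_ge0.
- exact: emeasurable_funM (measurable_cst _) (mLG G).
move=> h /= /eqP hn0; rewrite patchE; case: ifPn => [/set_mem|_]; last by rewrite mule_ge0.
rewrite /= in_itv/= andbT => hge0; have h0 : 0 < h by rewrite lt_neqAle eq_sym hn0.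
rewrite dist0xiE// muleCA muleC.
have xE : wgt b1 b2 h * (cosh h ^+ k * sinh h ^+ (n - k - 1)) = xidens h.
  by rewrite /xidens h0.
rewrite xE; apply: lee_wpmul2l => //.
apply: le_trans (Rk_hoelder kn k0 mf p1 del0 s0 sE SG h0) _.
apply: lee_wpmul2l => //; rewrite le_eqVlt; apply/orP; left; apply/eqP.
by apply: eq_integral => y _; rewrite /abspow -EFinM /sheetdens; congr EFin; ring.
Qed.

(** By [ballsinh_xipt0] the integrand depends on [y] only through its distance from the foot point,
    so hyperbolic polar coordinates on the submanifold apply. *)
Lemma integral_sheet_profile h : 0 < h ->
  (\int[lebT R k]_y
     ((sheetdens h y)%:E * spherical_mean mu abspow (normE (xipt0 n h y))) =
   s%:E * \int[leb R]_u ((pw (k%:R - 1) u * (1 + u ^+ 2) `^ (- 2^-1) *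
       schur_weight k%:R del (sinh h) u `^ (1 - p))%:E * profile (sinhdist (sinh h) u)))%E.
Proof.
move=> h0.
pose g u : \bar R :=
  ((schur_weight k%:R del (sinh h) u `^ (1 - p))%:E * profile (sinhdist (sinh h) u))%E.
have mg : measurable_fun [set: R] g.
  apply: emeasurable_funM.
    apply: measurable_fun_EFin; apply: measurable_fun_powR.
    by apply: measurable_fun_schur_weight; mfun.
  apply: (measurableT_comp measurable_profile).
  by apply: measurable_fun_sinhdist; mfun.
have g0 u : (0 <= g u)%E by rewrite mule_ge0 ?profile_ge0// lee_fin powR_ge0.
transitivity (\int[lebT R k]_y ((if inball y then hdens y else 0%R)%:E *
    g (ballsinh (normE y))))%E; last first.
  rewrite (sE mg g0); congr (_ * _)%E; apply: eq_integral => u _.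
  by rewrite /g muleA -EFinM.
apply: eq_integral => y _; rewrite /g /sheetdens /balldens.
case: ifP => yB; last by rewrite mulr0 !mul0e.
have /andP[t0 r1] := normE_xipt0 kn (ltW h0) yB.
by rewrite profileE ?normE_ge0// ballsinh_xipt0// muleA -EFinM mulrC.
Qed.

(** For [t = sinh h] one has [cosh^2 h = 1 + t^2] and [dh = (1 + t^2)^(-1/2) dt], which lowers the
    exponent [b2 + k] of the hyperbolic cosine by 1. *)
Lemma integral_xidens (I : R -> \bar R) : measurable_fun [set: R] I ->
  (forall t, (0 <= I t)%E) ->
  (\int[leb R]_h ((xidens h)%:E * I (sinh h)) =
   \int[leb R]_t ((pw (b1 + n%:R - k%:R - 1) t *
      (1 + t ^+ 2) `^ ((b2 + k%:R - 1) / 2))%:E * I t))%E.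
Proof.
move=> mI I0; rewrite [RHS]integral_leb_sinh; last 2 first.
- by mfun.
- by move=> t; rewrite mule_ge0// lee_fin mulr_ge0 ?pw_ge0 ?powR_ge0.
apply: eq_integral => h _; rewrite muleAC -EFinM; congr (_%:E * _)%E.
rewrite /xidens -sinh_gt0; case: ifPn => [t0|]; last first.
  by rewrite /pw => /negbTE ->; rewrite !mul0r.
have c1 := cosh_gt0 h; rewrite pwE// /wgt.
have -> : sinh h ^+ (n - k - 1) = sinh h `^ (n%:R - k%:R - 1).
  by rewrite -powR_mulrn ?ltW// natrB ?subn_gt0// natrB// ltnW.
have -> : (1 + sinh h ^+ 2) `^ ((b2 + k%:R - 1) / 2) = cosh h `^ (b2 + k%:R - 1).
  by rewrite -cosh2 -(powR_mulrn 2 (ltW c1)) -powRrM; congr (_ `^ _); field.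
have -> : sinh h `^ (b1 + n%:R - k%:R - 1) = sinh h `^ b1 * sinh h `^ (n%:R - k%:R - 1).
  by rewrite -powRD ?(gt_eqF t0) ?implybT//; congr (_ `^ _); ring.
have e : cosh h `^ (b2 + k%:R - 1) * cosh h = cosh h `^ b2 * cosh h ^+ k.
  transitivity (cosh h `^ (b2 + k%:R - 1) * cosh h `^ 1); first by rewrite powRr1// ltW.
  by rewrite -(powR_mulrn k (ltW c1)) -!powRD ?(gt_eqF c1) ?implybT//; congr (_ `^ _); ring.
rewrite -[RHS]mulrA e.
by ring.
Qed.

Lemma Xinorm_le_profile : (Xinorm_p k mu c b1 b2 p f <= (c * A `^ (p - 1) * s)%:E *
  \int[leb R]_t ((pw (b1 + n%:R - k%:R - 1) t *
      (1 + t ^+ 2) `^ ((b2 + k%:R - 1) / 2))%:E *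
    \int[leb R]_u ((pw (k%:R - 1) u * (1 + u ^+ 2) `^ (- 2^-1) *
      schur_weight k%:R del t u `^ (1 - p))%:E * profile (sinhdist t u))))%E.
Proof.
pose J t u : \bar R := ((pw (k%:R - 1) u * (1 + u ^+ 2) `^ (- 2^-1) *
      schur_weight k%:R del t u `^ (1 - p))%:E * profile (sinhdist t u))%E.
have J0 t u : (0 <= J t u)%E.
  by rewrite mule_ge0 ?profile_ge0// lee_fin !mulr_ge0 ?pw_ge0 ?powR_ge0.
have mJ : measurable_fun [set: R * R] (fun q => J q.1 q.2).
  apply: emeasurable_funM.
    apply: measurable_fun_EFin; apply: measurable_funM; first by mfun.
    by apply: measurable_fun_powR; apply: measurable_fun_schur_weight; mfun.
  apply: (measurableT_comp measurable_profile).
  by apply: measurable_fun_sinhdist; mfun.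
pose I t : \bar R := (\int[leb R]_u J t u)%E.
have I0 t : (0 <= I t)%E by exact: integral_ge0.
have mI : measurable_fun [set: R] I by exact: (measurable_integral2 (leb R) mJ).
apply: (le_trans Xinorm_le); rewrite le_eqVlt; apply/orP; left; apply/eqP.
rewrite [in RHS]EFinM -[RHS]muleA; congr (_ * _)%E.
rewrite -(integral_xidens mI I0) -ge0_integralZl; last 4 first.
- exact: measurableT.
- apply: emeasurable_funM; last by apply: (measurableT_comp mI); mfun.
  by apply: measurable_fun_EFin; apply: measurable_fun_xidens; mfun.
- by move=> h _; rewrite mule_ge0// lee_fin xidens_ge0.
- by rewrite lee_fin ltW.
apply: eq_integral => h _; have [h0|h0] := ltP 0 h.
  by rewrite integral_sheet_profile// muleCA.
by rewrite /xidens ltNge h0/= !mul0e mule0.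
Qed.

(** Weight and volume density depend on the norm of [x] only, so [|f|^p] may be replaced by its
    spherical means. Being an equality, this loses nothing for functions [f] that are not radial. *)
Lemma Hnorm_profile (a1 a2 sn : R) :
  (forall g : R -> \bar R, measurable_fun [set: R] g -> (forall r, (0 <= g r)%E) ->
  (\int[lebT R n]_y ((if inball y then hdens y else 0%R)%:E * g (ballsinh (normE y))) =
   sn%:E * \int[leb R]_u ((pw (n%:R - 1) u * (1 + u ^+ 2) `^ (- 2^-1))%:E * g u))%E) ->
  (Hnorm_p a1 a2 p f = sn%:E *
   \int[leb R]_x ((pw (n%:R + a1 - 1) x * (1 + x ^+ 2) `^ ((a2 - 1) / 2))%:E * profile x))%E.
Proof.
move=> snE.
pose v (u : R) : R := u `^ a1 * (1 + u ^+ 2) `^ (a2 / 2).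
have v0 u : 0 <= v u by rewrite mulr_ge0 ?powR_ge0.
have mv : measurable_fun [set: R] v by rewrite /v; mfun.
(* The absolute value keeps [w] nonnegative also for [r < -1], a value that no norm takes. *)
pose w (r : R) : \bar R :=
  ((if r < 1 then `|2 / (1 - r ^+ 2)| ^+ n else 0) * v (ballsinh r))%:E.
have w0 r : (0 <= w r)%E.
  by rewrite lee_fin mulr_ge0//; case: ifP => // _; rewrite exprn_ge0.
have mw : measurable_fun [set: R] w.
  apply: measurable_fun_EFin; apply: measurable_funM; first by mfun.
  by apply: (measurableT_comp mv); rewrite /ballsinh; mfun.
have wE (x : n.-tuple R) : w (normE x) = (balldens x * v (ballsinh (normE x)))%:E.
  rewrite /w /balldens inball_normE; case: ifP => // x1; rewrite normE_sq ger0_norm//.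
  by rewrite divr_ge0// subr_ge0 -normE_sq expr_le1 ?normE_ge0// ltW.
have -> : Hnorm_p a1 a2 p f = (\int[lebT R n]_x (w (normE x) * abspow x))%E.
  rewrite /Hnorm_p (_ : (fun x => _) = (fun x => w (normE x) * abspow x)%E).
    rewrite iintE//; last by move=> x; rewrite mule_ge0// abspow_ge0.
    by apply: emeasurable_funM; [apply: (measurableT_comp mw); mfun|exact: measurable_abspow].
  apply/funext => x; rewrite wE /balldens /abspow; case: ifP => xB; last first.
    by rewrite mul0r mul0e.
  rewrite -EFinM; congr EFin; rewrite /wgt sinh_hdist0// /v.
  have c1 := cosh_gt0 (hdist0 x).
  rewrite -(sinh_hdist0 xB) -cosh2 -(powR_mulrn 2 (ltW c1)) -powRrM.
  rewrite (_ : 2%:R * (a2 / 2) = a2); last by field.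
  by ring.
rewrite (integral_spherical_mean haar n2 measurable_abspow abspow_ge0 mw w0).
pose g u : \bar R := ((v u)%:E * profile u)%E.
have mg : measurable_fun [set: R] g.
  by apply: emeasurable_funM; [apply: measurable_fun_EFin|exact: measurable_profile].
have g0 u : (0 <= g u)%E by rewrite mule_ge0 ?profile_ge0// lee_fin.
transitivity (\int[lebT R n]_y ((if inball y then hdens y else 0%R)%:E *
    g (ballsinh (normE y))))%E.
  apply: eq_integral => x _; rewrite wE /balldens /g.
  have [xB|xB] := boolP (inball x); last by rewrite mul0r !mul0e.
  rewrite profileE; last by rewrite normE_ge0 -inball_normE.
  by rewrite muleA -EFinM.
rewrite (snE g mg g0); congr (_ * _)%E; apply: eq_integral => u _.
rewrite /g muleA -EFinM; congr (_%:E * _)%E; rewrite /v.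
have [u0|u0] := ltP 0 u; last by rewrite /pw ltNge u0/= !mul0r.
have U0 : 0 < 1 + u ^+ 2 by rewrite ltr_pwDl// sqr_ge0.
rewrite !pwE// mulrACA -!powRD ?(gt_eqF u0) ?(gt_eqF U0) ?implybT//.
by congr (_ `^ _ * _ `^ _); field.
Qed.

End transform_estimate.

Theorem theorem7p2 (R : realType) (n k : nat) (a1 a2 b1 b2 p : R)
  (mu : probability (n.-tuple (n.-tuple R)) R) (c : R) :
  (2 <= n)%N -> (1 <= k)%N -> (k <= n - 1)%N ->
  a1 + a2 > k%:R - n%:R ->
  1 <= p -> p <= (a1 + a2 + n%:R + 1) / (k%:R + 1) ->
  b1 > k%:R - n%:R ->
  b2 - a2 <= a1 - b1 -> a1 - b1 <= k%:R * (p - 1) ->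
  b1 + b2 < p * (k%:R + 1) - (n%:R + 1) ->
  is_Haar_SO mu -> 0 < c ->
  exists C : R, 0 < C /\
    forall f : n.-tuple R -> R,
      measurable_fun setT f ->
      (Hnorm_p a1 a2 p f < +oo)%E ->
      (poweR (Xinorm_p k mu c b1 b2 p f) p^-1
        <= C%:E * poweR (Hnorm_p a1 a2 p f) p^-1)%E.
Proof.
move=> n2 k0 kn1 a12 p1 ph hb1 b2a2 ab _ haar c0.
have n0 : (0 < n)%N by exact: ltn_trans n2.
have kn : (k < n)%N by move: kn1; rewrite subn1 -ltnS prednK.
have kR1 : 1 <= k%:R :> R by rewrite ler1n.
have [s [s0 sE]] := hyperbolic_polar R k0.
have [sn [sn0 snE]] := hyperbolic_polar R n0.
have [del [C [del0 C0 radial]]] := radial_estimate kR1 a12 p1 ph hb1 b2a2 ab.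
(* [c] normalises the measure on submanifolds, the power comes from Hoelder's inequality, and [s]
   from polar coordinates on a submanifold. In the final constant [sn], from polar coordinates in
   the whole space, is divided out. *)
pose B := c * (s * (k%:R^-1 + del^-1)) `^ (p - 1) * s.
have B0 : 0 < B.
  rewrite !mulr_gt0// powR_gt0// mulr_gt0// addr_gt0// invr_gt0//.
  exact: lt_le_trans kR1.
have D0 : 0 < B * C / sn by rewrite divr_gt0// mulr_gt0.
exists ((B * C / sn) `^ p^-1); split=> [|f mf _]; first exact: powR_gt0.
have main : (Xinorm_p k mu c b1 b2 p f <= (B * C / sn)%:E * Hnorm_p a1 a2 p f)%E.
  apply: le_trans (Xinorm_le_profile b1 b2 n2 kn k0 haar c0 mf p1 del0 s0 sE) _.
  rewrite (Hnorm_profile p n2 haar mf a1 a2 snE) [leRHS]muleA -EFinM divfK; last first.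
    by rewrite gt_eqF.
  rewrite -/B [in leRHS]EFinM -[leRHS]muleA.
  apply: lee_wpmul2l; first by rewrite lee_fin ltW.
  apply: radial => [|r]; [exact: measurable_profile|exact: profile_ge0].
have p0 : 0 <= p^-1 by rewrite invr_ge0 (le_trans ler01).
have H0 : (0 <= Hnorm_p a1 a2 p f)%E.
  rewrite (Hnorm_profile p n2 haar mf a1 a2 snE); apply: mule_ge0; first by rewrite lee_fin ltW.
  apply: integral_ge0 => x _.
  by rewrite mule_ge0 ?profile_ge0// lee_fin mulr_ge0 ?pw_ge0 ?powR_ge0.
rewrite -poweR_EFin -poweRM//; last by rewrite lee_fin ltW.
apply: gt0_ler_poweR => //.
- by rewrite in_itv/= leey andbT; exact: Xinorm_ge0.
- by rewrite in_itv/= leey andbT mule_ge0// lee_fin ltW.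
Qed.
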